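(* Let $K\subset\mathbb{C}^n$ be a compact non-pluripolar set, $U$ an $s$-dimensional complex Hermitian space with fixed orthonormal basis $u_1,\dots,u_s$, $w=(w_1,\dots,w_s)$ a weight with each $w_l:K\to\,]0,+\infty[$ continuous, $\mu$ a finite positive Borel measure on $K$, and $v:K\to U$ a $\mu$-measurable function with $\|v(x)\|_U=1$ for $\mu$-a.e. $x$. Assume that $(K,w,v,\mu)$ satisfies the weighted Bernstein–Markov property in $\mathcal{M}(K,U)$. Then $$\lim_{r\to\infty}\frac{n+1}{2nrN}\log\det G_r^{v,\mu,w}=\lim_{r\to\infty}\frac{n+1}{2nrN}\log Z_r^{v,\mu,w}=\log\delta^w(K,U),$$ where $N=N(r)=s\binom{n+r}{n}$, $G_r^{v,\mu,w}$ is the weighted Gram matrix, $Z_r^{v,\mu,w}$ is the free energy, and $\delta^w(K,U)$ is the weighted transfinite diameter of $K$ with respect to $U$.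
   Context: Notation. $m_r:=\binom{n+r}{n}$, $N:=s\,m_r$, $\ell_r:=\sum_{k=1}^r k(m_k-m_{k-1})$. $\mathscr{P}_{r,n}U$ is the space of $U$-valued polynomials on $\mathbb{C}^n$ of degree at most $r$, with basis $q_1,\dots,q_N$ given by an enumeration of the functions $x\mapsto x^\beta u_i$, $|\beta|\le r$, $1\le i\le s$. For $a=\sum a_iu_i$, $b=\sum b_iu_i$, put $a\odot b=\sum a_ib_iu_i$; $w$ is identified with $\sum_i w_iu_i$ and $w^r:=\sum_i w_i^ru_i$. The Hermitian product $(\cdot,\cdot)_U$ is taken conjugate-linear in the first and linear in the second argument. Semimetric and seminorm. Set $g_x(\omega,\theta):=\overline{(v(x),\omega(x))_U}\,(v(x),\theta(x))_U$ and $\|\omega\|_{v,\mu}:=\big(\int_K g_x(\omega,\omega)\,d\mu(x)\big)^{1/2}$. Weighted Bernstein–Markov property. $(K,w,v,\mu)$ has this property if, for every $r$, $\omega\mapsto\|\omega\odot w^r\|_{v,\mu}$ is a norm on $\mathscr{P}_{r,n}U$ and $$\limsup_{r\to\infty}\ \sup_{\omega\in\mathscr{P}_{r,n}U\setminus\{0\}}\left(\frac{\max_{x\in K}\|\omega(x)\odot w^r(x)\|_U}{\|\omega\odot w^r\|_{v,\mu}}\right)^{1/r}\le 1.$$ Gram matrix: $(G_r^{v,\mu,w})_{i,j}:=\int_K g_x(q_i\odot w^r,q_j\odot w^r)\,d\mu(x)$, $i,j=1,\dots,N$. Free energy: $$Z_r^{v,\mu,w}:=\int_K\cdots\int_K\Big|\sum_{\sigma\in\Sigma_N}\mathrm{sgn}(\sigma)\bigotimes_{j=1}^N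 (q_{\sigma(j)}\odot w^r)(x_j)\Big|^2_{g^\otimes}\,d\mu(x_1)\cdots d\mu(x_N),$$ where $\Sigma_N$ is the set of permutations of $\{1,\dots,N\}$ and $|\cdot|^2_{g^\otimes}$ is the squared seminorm on $U^{\otimes N}$ at $(x_1,\dots,x_N)$ induced by the sesquilinear form determined by $g^\otimes_{(x_1,\dots,x_N)}(\otimes_j z_j,\otimes_j y_j)=\prod_{j=1}^N\overline{(v(x_j),z_j)_U}\,(v(x_j),y_j)_U$. Vector transfinite diameter. $\mathcal{M}(K,U)$ is the dual of the Banach space $\mathscr{C}^0(K,U)$ of continuous functions $K\to U$ with norm $\max_{x\in K}\|\omega(x)\|_U$; $$\delta^{w,r}(K,U):=\Big[\max_{T_1,\dots,T_N\in\mathcal{M}(K,U),\ \|T_i\|=1}\big|\det[T_i(q_j\odot w^r)]_{i,j=1}^N\big|\Big]^{1/(s\ell_r)},\qquad \delta^w(K,U):=\lim_{r\to\infty}\delta^{w,r}(K,U)$$ (the limit exists). A set is pluripolar if it is contained in the $-\infty$ set of a plurisubharmonic function on $\mathbb{C}^n$ not identically $-\infty$. *)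

(* Defs.v *)
From HB Require Import structures.
From mathcomp Require Import all_boot all_order all_algebra all_fingroup.
From mathcomp Require Import sesquilinear complex.
From mathcomp Require Import all_classical all_reals all_analysis.

Set Implicit Arguments.
Unset Strict Implicit.
Unset Printing Implicit Defensive.

Import Order.TTheory GRing.Theory Num.Theory.
Import numFieldNormedType.Exports.

Local Open Scope classical_set_scope.
Local Open Scope ring_scope.

(* The regular module [R[i]^o] carries the topology of the field [R[i]]. *)
Notation Cspace R n := 'rV[(R[i])^o]_n.
Notation Borel R n := (g_sigma_algebraType (@open (Cspace R n))).

(* The norm of a normed module over [R[i]] takes its values in [R[i]]; this is
   the same norm with values in [R]. *)
Definition rnorm (R : realType) (V : normedModType R[i]) (a : V) : R :=
  complex.Re `|a|.

Section pluripolar.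
Context {R : realType}.

Definition circle (c : (R[i])^o) (rho t : R) : (R[i])^o :=
  c + (rho * cos t +i* (rho * sin t))%C.

(* The function identically equal to [-oo] is allowed here and in [psh]. *)
Definition subharmonic (phi : (R[i])^o -> \bar R) : Prop :=
  [/\ forall z, (phi z < +oo)%E,
      lower_semicontinuous (fun z => (- phi z)%E) &
      forall (c : (R[i])^o) (rho : R), 0 < rho ->
        (phi c <= ((2 * pi)^-1)%:E *
          \int[lebesgue_measure]_(t in `[0%R, (2 * pi)%R])
             phi (circle c rho t))%E].

Definition psh (n : nat) (phi : Cspace R n -> \bar R) : Prop :=
  [/\ forall x, (phi x < +oo)%E,
      lower_semicontinuous (fun x => (- phi x)%E) &
      forall a b : Cspace R n, subharmonic (fun z => phi (a + z *: b))].

Definition pluripolar (n : nat) (K : set (Cspace R n)) : Prop :=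
  exists phi : Cspace R n -> \bar R,
    [/\ psh phi, exists x, phi x <> -oo%E & forall x, K x -> phi x = -oo%E].

End pluripolar.

Section measure.
Context {R : realType} {d : measure_display} {T : measurableType d}.
Variable mu : {measure set T -> \bar R}.

(* Membership in the completion of the sigma-algebra of [T] for [mu]. *)
Definition mu_measurable_set (A : set T) : Prop :=
  exists2 B, measurable B & mu.-negligible ((A `\` B) `|` (B `\` A)).

Definition mu_measurable_fun (V : topologicalType) (D : set T) (f : T -> V) :=
  forall O : set V, open O -> mu_measurable_set (D `&` f @^-1` O).

Definition Cintegral (D : set T) (f : T -> R[i]) : R[i] :=
  (Rintegral mu D (fun x => complex.Re (f x))
    +i* Rintegral mu D (fun x => complex.Im (f x)))%C.

Fixpoint iterated_integral (D : set T) (N : nat) :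
    (N.-tuple T -> \bar R) -> \bar R :=
  if N is N'.+1 then
    fun F => (\int[mu]_(x in D)
      @iterated_integral D N' (fun t => F [tuple of x :: t]))%E
  else fun F => F [tuple].

End measure.

Definition polydim (n r : nat) : nat := 'C(n + r, n).
Definition polydimU (n s r : nat) : nat := (s * polydim n r)%N.
Definition ell (n r : nat) : nat :=
  (\sum_(1 <= k < r.+1) k * (polydim n k - polydim n k.-1))%N.

Definition mdegree (n : nat) (beta : {ffun 'I_n -> nat}) : nat :=
  (\sum_j beta j)%N.

Definition monomial (R : realType) (n : nat) (beta : {ffun 'I_n -> nat})
    (x : Cspace R n) : R[i] := \prod_j (x 0 j) ^+ beta j.

(* [e] lists every pair (beta, i) with |beta| <= r exactly once; it stands for
   the enumeration of the functions x |-> x^beta u_i. *)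
Definition monomial_enumeration (n s r : nat)
    (e : 'I_(polydimU n s r) -> {ffun 'I_n -> nat} * 'I_s) : Prop :=
  injective e /\
  forall (beta : {ffun 'I_n -> nat}) (i : 'I_s),
    (exists k, e k = (beta, i)) <-> (mdegree beta <= r)%N.

Section hermitian_space.
Context {R : realType} {U : normedModType R[i]}.
Variable herm : {dot U for Num.conj}.

(* (a, b)_U, conjugate-linear in a and linear in b: the forms of the library are
   linear in the first argument. *)
Definition hprod (a b : U) : R[i] := herm b a.

Definition hermitian_norm : Prop := forall a : U, `|a| ^+ 2 = hprod a a.

Variables (s : nat) (u : s.-tuple U).

Definition orthonormal_basis : Prop :=
  orthonormal herm u /\
  forall a : U, exists c : 'I_s -> R[i], a = \sum_i c i *: tnth u i.

(* In an orthonormal basis the i-th coordinate of a is (u_i, a). *)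
Definition ucoord (i : 'I_s) (a : U) : R[i] := hprod (tnth u i) a.

Definition odot (a b : U) : U :=
  \sum_i (ucoord i a * ucoord i b) *: tnth u i.

(* A model of the N-fold tensor power of U: a tensor is given by its
   coefficients in the basis of the u_(k 0) (x) ... (x) u_(k (N-1)). *)
Definition tensor (N : nat) := {ffun {ffun 'I_N -> 'I_s} -> (R[i])^o}.

Definition pure_tensor (N : nat) (z : 'I_N -> U) : tensor N :=
  [ffun k : {ffun 'I_N -> 'I_s} => \prod_j ucoord (k j) (z j)].

Variables (X : Type) (v : X -> U).

Definition gform (x : X) (a b : U) : R[i] :=
  Num.conj (hprod (v x) a) * hprod (v x) b.

(* The sesquilinear form whose values on the tensors of basis vectors are the
   products of the values of [gform]; see [gtensor_pure]. *)
Definition gtensor (N : nat) (x : 'I_N -> X) (S T : tensor N) : R[i] :=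
  \sum_k \sum_l Num.conj (S k) * T l *
    \prod_j gform (x j) (tnth u (k j)) (tnth u (l j)).

End hermitian_space.

Section tensor_lemmas.
Context {R : realType} {U : normedModType R[i]}.
Variables (herm : {dot U for Num.conj}) (s : nat) (u : s.-tuple U).
Hypothesis hu : orthonormal_basis herm u.

Lemma hprod_basis (i j : 'I_s) :
  hprod herm (tnth u i) (tnth u j) = (i == j)%:R.
Proof.
have [/orthonormalP[uniq_u ou] _] := hu.
rewrite /hprod ou ?mem_tnth// (inj_eq (tuple_uniqP _ uniq_u)).
by rewrite eq_sym.
Qed.

Lemma hprod_suml (a : U) (c : 'I_s -> R[i]) :
  hprod herm a (\sum_i c i *: tnth u i) = \sum_i c i * hprod herm a (tnth u i).
Proof.
rewrite /hprod linear_sumlz; apply: eq_bigr => i _.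
by rewrite linearZl_LR.
Qed.

Lemma ucoord_sum (a : U) : a = \sum_i ucoord herm u i a *: tnth u i.
Proof.
have [_ /(_ a)[c ac]] := hu.
rewrite {1}ac; apply: eq_bigr => i _; congr (_ *: _).
rewrite /ucoord ac hprod_suml (bigD1 i)//= hprod_basis eqxx mulr1.
by rewrite big1 ?addr0// => j ji; rewrite hprod_basis eq_sym (negbTE ji) mulr0.
Qed.

Lemma gform_coord (X : Type) (v : X -> U) (x : X) (a b : U) :
  gform herm v x a b =
  \sum_k \sum_l Num.conj (ucoord herm u k a) * ucoord herm u l b *
    gform herm v x (tnth u k) (tnth u l).
Proof.
rewrite {1}/gform {1}(ucoord_sum a) {1}(ucoord_sum b) !hprod_suml.
rewrite rmorph_sum /= mulr_suml; apply: eq_bigr => k _.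
rewrite mulr_sumr; apply: eq_bigr => l _.
by rewrite rmorphM /gform mulrACA.
Qed.

Lemma gtensor_pure (X : Type) (v : X -> U) (N : nat) (x : 'I_N -> X)
    (z y : 'I_N -> U) :
  gtensor herm u v x (pure_tensor herm u z) (pure_tensor herm u y) =
  \prod_j gform herm v (x j) (z j) (y j).
Proof.
under [RHS]eq_bigr do rewrite gform_coord.
rewrite bigA_distr_bigA; apply: eq_bigr => k _.
rewrite bigA_distr_bigA; apply: eq_bigr => l _.
by rewrite !ffunE rmorph_prod /= -!big_split.
Qed.

End tensor_lemmas.

Section vector_polynomials.
Context {R : realType} {n s : nat} {U : normedModType R[i]}.
Variables (herm : {dot U for Num.conj}) (u : s.-tuple U).
Variable K : set (Cspace R n).

(* The polynomials of degree at most r on C^n with values in U; in the sum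
   |beta| <= r bounds each beta j by r. *)
Definition polyU (r : nat) : set (Cspace R n -> U) :=
  [set omega | exists a : {ffun 'I_n -> 'I_r.+1} -> U,
    omega = fun x : Cspace R n => \sum_(beta : {ffun 'I_n -> 'I_r.+1} |
                           (\sum_j beta j <= r)%N)
                       (\prod_j (x 0 j) ^+ beta j) *: a beta].

(* Functions on K are represented by functions on C^n; their values outside K
   never matter. *)
Definition max_norm (f : Cspace R n -> U) : R := sup [set rnorm (f x) | x in K].

Definition norm_on (V : set (Cspace R n -> U)) (p : (Cspace R n -> U) -> R) :=
  [/\ forall f, V f -> 0 <= p f,
      forall f g, V f -> V g -> p (f + g) <= p f + p g,
      forall (c : (R[i])^o) f, V f -> p (c *: f) = rnorm c * p f &
      forall f, V f -> p f = 0 -> f = 0].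

Definition contU : set (Cspace R n -> U) :=
  [set f | {within K, continuous f}].

(* The elements of the dual of C^0(K, U). The bound forces T f to depend only
   on the restriction of f to K; values of T outside [contU] are irrelevant. *)
Definition dualU (T : (Cspace R n -> U) -> (R[i])^o) : Prop :=
  (forall (c : R[i]) f g, contU f -> contU g -> T (c *: f + g) = c * T f + T g)
  /\ exists M : R, forall f, contU f -> rnorm (T f) <= M * max_norm f.

Definition dual_norm (T : (Cspace R n -> U) -> (R[i])^o) : R :=
  sup [set rnorm (T f) | f in [set f | contU f /\ max_norm f <= 1]].

Variable w : 'I_s -> Cspace R n -> R.

(* w^r as a U-valued function *)
Definition wpow (r : nat) (x : Cspace R n) : U :=
  \sum_i ((w i x ^+ r)%:C)%C *: tnth u i.

Definition weighted (r : nat) (f : Cspace R n -> U) (x : Cspace R n) : U :=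
  odot herm u (f x) (wpow r x).

Variable e :
  forall r, 'I_(polydimU n s r) -> {ffun 'I_n -> nat} * 'I_s.

Definition qpoly (r : nat) (k : 'I_(polydimU n s r)) (x : Cspace R n) : U :=
  monomial (e k).1 x *: tnth u (e k).2.

(* The supremum is attained, by weak-* compactness of the unit ball. *)
Definition tdiam (r : nat) : R :=
  (sup [set rnorm (\det (\matrix_(i, j) T i (weighted r (qpoly j)))
                    : (R[i])^o)
       | T in [set T : 'I_(polydimU n s r) ->
                         (Cspace R n -> U) -> (R[i])^o |
               forall i, dualU (T i) /\ dual_norm (T i) = 1]])
  `^ ((s * ell n r)%:R^-1).

Definition transfinite_diameter : R := limn tdiam.

Variables (v : Cspace R n -> U) (mu : {measure set (Borel R n) -> \bar R}).

Definition vmu_norm (f : Cspace R n -> U) : R :=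
  Num.sqrt (Rintegral mu K (fun x => complex.Re (gform herm v x (f x) (f x)))).

Definition bm_sup (r : nat) : \bar R :=
  ereal_sup
    [set ((max_norm (weighted r omega) / vmu_norm (weighted r omega))
            `^ (r%:R^-1))%:E
    | omega in polyU r `\ 0].

Definition bernstein_markov : Prop :=
  (forall r, norm_on (polyU r) (fun omega => vmu_norm (weighted r omega))) /\
  (limn_esup bm_sup <= 1)%E.

Definition gram (r : nat) : 'M[R[i]]_(polydimU n s r) :=
  \matrix_(i, j) Cintegral mu K (fun x =>
    gform herm v x (weighted r (qpoly i) x)
                   (weighted r (qpoly j) x)).

Definition slater (r : nat) (x : 'I_(polydimU n s r) -> Cspace R n) :
    @tensor R s (polydimU n s r) :=
  \sum_(sigma : 'S_(polydimU n s r))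
    (-1) ^+ sigma *: pure_tensor herm u
      (fun j => weighted r (qpoly (sigma j)) (x j)).

Definition free_energy (r : nat) : R :=
  fine (iterated_integral mu K (fun t : (polydimU n s r).-tuple (Borel R n) =>
    (complex.Re (gtensor herm u v (tnth t) (slater (tnth t))
                                           (slater (tnth t))))%:E)).

End vector_polynomials.

(* Main.v *)
Require Import Defs.
From HB Require Import structures.
From mathcomp Require Import all_boot all_order all_algebra all_fingroup.
From mathcomp Require Import sesquilinear complex.
From mathcomp Require Import all_classical all_reals all_analysis.
From mathcomp Require Import spectral ring lra zify.

Set Implicit Arguments.
Unset Strict Implicit.
Unset Printing Implicit Defensive.

Import Order.TTheory GRing.Theory Num.Theory.
Import numFieldNormedType.Exports.

Local Open Scope classical_set_scope.
Local Open Scope ring_scope.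

(** Write [D_r] for the supremum in the definition of the transfinite diameter,
    [N = s m_r] and [G_r] for the Gram matrix.

    Convergence of [ln D_r / (s l_r)]. Ordering the monomials lexicographically,
    triangular changes of basis bound [D_r], up to a factor [N! 2^N], from above
    and from below (greedy choice of point evaluations) by the product over the
    basis of the Chebyshev constants
    [inf {max_K |p| w_k^r : p = x^b + lexicographically lower terms}].
    Their logarithms are subadditive in [(r, b)], so their averages over
    [|b| <= r] converge as soon as they are bounded by [O(r)]. The bound from below
    is where non-pluripolarity enters: if there were monic polynomials with
    [max_K |p| < c^r] for every [c > 0], a series of terms [a_j ln |P_j|] built from
    them would be plurisubharmonic, [-oo] on [K] and finite somewhere.

    Comparison with [G_r]. Expanding the Slater tensor gives [Z_r = N! det G_r],
    while its squared seminorm at [(x_1, ..., x_N)] is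
    [|det (v (x_j), q_i (x_j) w^r)|^2 <= D_r^2], hence
    [Z_r <= mu(K)^N D_r^2]. Conversely, in an orthonormal eigenbasis of [G_r] the
    Bernstein-Markov property bounds maximum norms by [(1 + eps)^r] times the square
    roots of the eigenvalues, hence [D_r <= N! (1 + eps)^(r N) (det G_r)^(1/2)].
    Since [ln N! = o (r N)], the logarithms agree up to [o (r N)]. *)

(** * Norms and polynomials *)

(** Everything is decided on the scale r N. Since N is polynomial in r, ln N = o(r), so factors such
    as N!, 2^N or mu(K)^N are harmless, and so is working with polynomials that attain an infimum
    only up to a factor. The constant (n+1)/(2nrN) is 1/(2 s l_r), because (n+1) l_r = n r m_r; its
    2 matches the square in the seminorm. The weight is raised to the degree bound r, not to |b|. A
    Chebyshev constant therefore depends on the pair (r, b), the bound r has to be carried along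
    with the leading monomial, and multiplying two competitors adds both. The lower bound is the
    delicate one: only non-pluripolarity excludes monic polynomials that are tiny on K, so failure
    of the bound has to be turned into an explicit plurisubharmonic function. Its logarithms are cut
    off from below, which reduces the sub-mean-value inequality to continuous functions on circles;
    there it follows from averages over roots of unity, and the cutoff is removed by monotone
    convergence. *)

Section real_norm.
Context {R : realType}.
Implicit Types V : normedModType R[i].

Lemma norm_rnorm V (a : V) : `|a| = ((rnorm a)%:C)%C.
Proof. by rewrite /rnorm RRe_real// normr_real. Qed.

Lemma rnorm_ge0 V (a : V) : 0 <= rnorm a.
Proof. by rewrite -ler0c -norm_rnorm. Qed.

Lemma rnorm0 V : rnorm (0 : V) = 0.
Proof. by rewrite /rnorm normr0. Qed.

Lemma rnorm0_eq0 V (a : V) : rnorm a = 0 -> a = 0.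
Proof. by move=> a0; apply/eqP; rewrite -normr_eq0 norm_rnorm a0. Qed.

Lemma rnorm_gt0 V (a : V) : (0 < rnorm a) = (a != 0).
Proof.
rewrite lt_neqAle rnorm_ge0 andbT eq_sym; congr (~~ _).
by apply/eqP/eqP => [/rnorm0_eq0//|->]; rewrite rnorm0.
Qed.

Lemma rnormD V (a b : V) : rnorm (a + b) <= rnorm a + rnorm b.
Proof. by rewrite -lecR rmorphD/= -!norm_rnorm ler_normD. Qed.

Lemma rnormN V (a : V) : rnorm (- a) = rnorm a.
Proof. by rewrite /rnorm normrN. Qed.

Lemma rnormB V (a b : V) : rnorm (a - b) = rnorm (b - a).
Proof. by rewrite -rnormN opprB. Qed.

Lemma rnorm_sum V (I : Type) (r : seq I) (P : pred I) (F : I -> V) :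
  rnorm (\sum_(i <- r | P i) F i) <= \sum_(i <- r | P i) rnorm (F i).
Proof.
elim/big_ind2 : _ => [|a b c d ab cd|//]; first by rewrite rnorm0.
by rewrite (le_trans (rnormD _ _))// lerD.
Qed.

Lemma rnormZ V (c : R[i]) (a : V) :
  rnorm (c *: a) = rnorm (c : (R[i])^o) * rnorm a.
Proof. by apply: complexI; rewrite rmorphM/= -!norm_rnorm normrZ. Qed.

Local Notation C := (R[i])^o.

Lemma rnormM (a b : C) : rnorm (a * b : C) = rnorm a * rnorm b.
Proof. exact: rnormZ. Qed.

Lemma rnorm1 : rnorm (1 : C) = 1.
Proof. by rewrite /rnorm normr1. Qed.

Lemma rnormX (a : C) k : rnorm (a ^+ k : C) = rnorm a ^+ k.
Proof. by elim: k => [|k IH]; rewrite ?rnorm1// !exprS rnormM IH. Qed.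

Lemma rnorm_prod (I : Type) (r : seq I) (P : pred I) (F : I -> C) :
  rnorm (\prod_(i <- r | P i) F i : C) = \prod_(i <- r | P i) rnorm (F i).
Proof. by elim/big_ind2 : _ => [|a b c d <- <-|//]; rewrite ?rnorm1 ?rnormM. Qed.

Lemma rnorm_sign k : rnorm ((-1) ^+ k : C) = 1.
Proof. by rewrite rnormX rnormN rnorm1 expr1n. Qed.

Lemma rnorm_real (x : R) : rnorm ((x%:C)%C : C) = `|x|.
Proof. by apply: complexI; rewrite -norm_rnorm normc_def/= expr0n addr0 sqrtr_sqr. Qed.

Lemma rnorm_nat k : rnorm (k%:R : C) = k%:R.
Proof. by rewrite -(rmorph_nat (real_complex R)) /= rnorm_real normr_nat. Qed.

Lemma rnormJ (a : C) : rnorm (Num.conj (a : R[i]) : C) = rnorm a.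
Proof. by congr complex.Re; exact: norm_conjC. Qed.

Lemma normr_Re_le (a : C) : `|complex.Re a| <= rnorm a.
Proof. by rewrite -lecR -norm_rnorm normc_ge_Re. Qed.

Lemma normr_Im_le (a : C) : `|complex.Im a| <= rnorm a.
Proof.
have := normr_Re_le ((a : R[i]) * 'i%C : R[i]).
rewrite ReiNIm normrN rnormM => /le_trans; apply.
by rewrite /rnorm normc_def /= expr0n expr1n add0r sqrtr1 mulr1.
Qed.

Lemma rnorm_le_ReIm (a : C) : rnorm a <= `|complex.Re a| + `|complex.Im a|.
Proof.
case: a => x y; rewrite {1}(complexE (x +i* y)%C) /=.
rewrite (le_trans (rnormD _ _))// rnorm_real lerD2l rnormM rnorm_real.
by rewrite /rnorm normc_def /= expr0n expr1n add0r sqrtr1 mul1r.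
Qed.

Lemma rnorm_row_le n (x : Cspace R n) (c : R) : 0 <= c ->
  (rnorm x <= c) <-> (forall j, rnorm (x 0 j) <= c).
Proof.
move=> c0; split => [xc j|xc].
  apply: le_trans xc; rewrite -lecR -!norm_rnorm [leRHS]mx_normE.
  rewrite -[leLHS]nngE num_le.
  exact: (le_bigmax _ (fun ij : 'I_1 * 'I_n => `|x ij.1 ij.2|%:nng) (0, j)).
rewrite -lecR -norm_rnorm [leLHS]mx_normE.
have c0' : 0 <= (c%:C)%C :> R[i] by rewrite ler0c.
rewrite -[leRHS]/((NngNum c0')%:num) num_le; apply/bigmax_leP.
split => [|[i j] _ /=]; first by rewrite -num_le.
by rewrite -num_le /= ord1 norm_rnorm lecR.
Qed.

End real_norm.

Section real_norm_topology.
Context {R : realType}.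
Local Notation C := (R[i])^o.

Lemma nbhs_rnormP (V : normedModType R[i]) (x : V) (A : set V) :
  nbhs x A <-> exists2 d : R, 0 < d & forall y, rnorm (x - y) < d -> A y.
Proof.
split=> [/nbhs_ballP[d /= d0 dA]|[d d0 dA]].
  exists (complex.Re d); first by move: d0; rewrite ltcE => /andP[_].
  have dE : d = ((complex.Re d)%:C)%C by rewrite RRe_real// gtr0_real.
  move=> y xy; apply: dA; rewrite -ball_normE /ball_/= norm_rnorm dE ltcR.
  exact: xy.
apply/nbhs_ballP; exists ((d%:C)%C) => /=; first by rewrite ltcR.
by move=> y; rewrite -ball_normE /ball_/= norm_rnorm ltcR => /dA.
Qed.

Lemma continuous_rnormP (V W : normedModType R[i]) (f : V -> W) (x : V) :
  {for x, continuous f} <-> forall eps : R, 0 < eps ->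
    exists2 d : R, 0 < d & forall y, rnorm (x - y) < d -> rnorm (f x - f y) < eps.
Proof.
split=> [fx eps e0|fx A /nbhs_rnormP[eps e0 eA]].
  apply/(nbhs_rnormP x (fun y => rnorm (f x - f y) < eps)).
  by apply: (fx [set z | rnorm (f x - z) < eps]); apply/nbhs_rnormP; exists eps.
by have [d d0 dA] := fx _ e0; apply/nbhs_rnormP; exists d => // y /dA/eA.
Qed.

Lemma continuous_Re : continuous (@complex.Re R : C -> R).
Proof.
move=> x A /nbhs_ballP[d /= d0 dA]; apply/nbhs_rnormP; exists d => // y xy.
apply: dA; rewrite /ball/=; apply: le_lt_trans xy.
by rewrite (le_trans _ (normr_Re_le _))//; case: (x) (y) => ? ? [].
Qed.

Lemma continuous_Im : continuous (@complex.Im R : C -> R).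
Proof.
move=> x A /nbhs_ballP[d /= d0 dA]; apply/nbhs_rnormP; exists d => // y xy.
apply: dA; rewrite /ball/=; apply: le_lt_trans xy.
by rewrite (le_trans _ (normr_Im_le _))//; case: (x) (y) => ? ? [].
Qed.

Lemma continuous_real_complex : continuous (fun x : R => (x%:C)%C : C).
Proof.
move=> x A /nbhs_rnormP[d /= d0 dA]; apply/nbhs_ballP; exists d => // y xy.
by apply: dA; rewrite -rmorphB rnorm_real.
Qed.

Lemma continuous_rnorm (V : normedModType R[i]) : continuous (@rnorm R V).
Proof.
move=> x A /nbhs_ballP[d /= d0 dA]; apply/nbhs_rnormP; exists d => // y xy.
apply: dA; rewrite /ball/=; apply: le_lt_trans xy; rewrite ler_norml.
rewrite lerNl opprB !lerBlDr; apply/andP; split.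
  by rewrite -{1}(subrK x y) rnormB rnormD.
by rewrite -{1}(subrK y x) rnormD.
Qed.

Lemma continuous_coord n (j : 'I_n) : continuous (fun x : Cspace R n => x 0 j : C).
Proof.
move=> x; apply/continuous_rnormP => e e0; exists e => // y xy.
have := (rnorm_row_le (x - y) (rnorm_ge0 (x - y))).1 (lexx _) j.
by rewrite !mxE => /le_lt_trans; apply.
Qed.

End real_norm_topology.

(** * Multi-indices in lexicographic order *)

Section multiindices.
Variable n : nat.
Local Notation mi := {ffun 'I_n -> nat}.
Implicit Types b c d : mi.

(** The order is purely lexicographic, not graded: it is invariant under translation, which makes
    leading monomials multiplicative, but [lexlt c b] does not bound the degree of [c]. *)
Definition lexlt b c := [exists i, (b i < c i)%N &&
  [forall j : 'I_n, (j < i)%N ==> (b j == c j)]].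

Lemma lexltP b c : reflect (exists2 i, (b i < c i)%N &
  forall j : 'I_n, (j < i)%N -> b j = c j) (lexlt b c).
Proof.
apply: (iffP existsP) => [[i /andP[bc /forallP e]]|[i bc e]]; exists i => //.
  by move=> j ji; apply/eqP; have /implyP := e j; apply.
by rewrite bc; apply/forallP => j; apply/implyP => /e/eqP.
Qed.

Lemma lexlt_irr b : lexlt b b = false.
Proof. by case: lexltP => // -[k]; rewrite ltnn. Qed.

Lemma lexlt_trans c b d : lexlt b c -> lexlt c d -> lexlt b d.
Proof.
move=> /lexltP[i bc bcE] /lexltP[j cd cdE]; apply/lexltP.
have [ij|ji|ij] := ltngtP i j.
- by exists i; [rewrite -cdE|move=> k ki; rewrite bcE// cdE// (ltn_trans ki)].
- by exists j; [rewrite bcE|move=> k kj; rewrite bcE ?cdE// (ltn_trans kj)].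
- have ? : i = j by exact: val_inj.
  subst j; exists i; first exact: ltn_trans cd.
  by move=> k ki; rewrite bcE// cdE.
Qed.

Lemma lexlt_total b c : b != c -> lexlt b c || lexlt c b.
Proof.
move=> bc; have [i0 bci0] : exists i, b i != c i.
  apply/existsP; apply: contraR bc; rewrite negb_exists => /forallP e.
  by apply/eqP/ffunP => i; apply/eqP; have := e i; rewrite negbK.
case: (@arg_minnP _ i0 (fun i => b i != c i) (fun i : 'I_n => i : nat) bci0).
move=> i bci imin.
have E (j : 'I_n) : (j < i)%N -> b j = c j.
  by move=> ji; apply/eqP; apply: contraTT ji => /imin; rewrite -leqNgt.
case: (ltngtP (b i) (c i)) bci => // h _; apply/orP; [left|right];
  by apply/lexltP; exists i => // j ji; rewrite E.
Qed.

Lemma lexlt_addl b c d : lexlt b c -> lexlt (d + b) (d + c).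
Proof.
move=> /lexltP[i bc e]; apply/lexltP; exists i => [|j ji]; rewrite !ffunE.
  by rewrite ltn_add2l.
by rewrite e.
Qed.

Lemma mdegreeD b c : mdegree (b + c) = (mdegree b + mdegree c)%N.
Proof. by rewrite /mdegree -big_split; apply: eq_bigr => i _; rewrite ffunE. Qed.

Lemma leq_mdegree b i : (b i <= mdegree b)%N.
Proof. by rewrite /mdegree (bigD1 i)//= leq_addr. Qed.

End multiindices.

Section monomial_span.
Context {R : realType} {n : nat}.
Local Notation mi := {ffun 'I_n -> nat}.
Local Notation C := (R[i])^o.

Lemma monomialD (b c : mi) (x : Cspace R n) :
  monomial (b + c) x = monomial b x * monomial c x.
Proof.
by rewrite /monomial -big_split; apply: eq_bigr => i _; rewrite ffunE exprD.
Qed.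

(** The linear span of the monomials with exponents in [P], as an inductive predicate, so that a
    property preserved by linear combinations only has to be checked on monomials. *)
Inductive mspan (P : mi -> Prop) : (Cspace R n -> R[i]) -> Prop :=
| mspan0 : mspan P (fun=> 0)
| mspanS a b f : P b -> mspan P f -> mspan P (fun x => a * monomial b x + f x).

Lemma mspan_sub (P Q : mi -> Prop) f :
  (forall b, P b -> Q b) -> mspan P f -> mspan Q f.
Proof.
move=> PQ; elim=> [|a b g Pb _ IH]; first exact: mspan0.
exact: mspanS (PQ _ Pb) IH.
Qed.

Lemma mspan_add P f g : mspan P f -> mspan P g -> mspan P (fun x => f x + g x).
Proof.
move=> + Pg; elim=> [|a b h Pb _ IH].
  by rewrite (_ : (fun x => _) = g)//; apply/funext => x; rewrite add0r.
rewrite (_ : (fun x => _) = (fun x => a * monomial b x + (h x + g x))).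
  exact: mspanS.
by apply/funext => x; rewrite addrA.
Qed.

Lemma mspan_scale P a f : mspan P f -> mspan P (fun x => a * f x).
Proof.
elim=> [|a' b h Pb _ IH].
  rewrite (_ : (fun x => _) = (fun=> 0)); first exact: mspan0.
  by apply/funext => x; rewrite mulr0.
rewrite (_ : (fun x => _) = (fun x => (a * a') * monomial b x + (a * h x))).
  exact: mspanS.
by apply/funext => x; rewrite mulrDr mulrA.
Qed.

Lemma mspan_monomial (P : mi -> Prop) a b :
  P b -> mspan P (fun x => a * monomial b x).
Proof.
move=> Pb; rewrite (_ : (fun x => _) = (fun x => a * monomial b x + 0)).
  by apply: mspanS => //; exact: mspan0.
by apply/funext => x; rewrite addr0.
Qed.

Lemma mspan_sum (I : Type) (r : seq I) (p : pred I) P (F : I -> _ -> _) :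
  (forall i, p i -> mspan P (F i)) -> mspan P (fun x => \sum_(i <- r | p i) F i x).
Proof.
move=> PF; elim: r => [|i r IH].
  rewrite (_ : (fun x => _) = (fun=> 0)); first exact: mspan0.
  by apply/funext => x; rewrite big_nil.
rewrite (_ : (fun x => _) = (fun x =>
  (if p i then F i x else 0) + \sum_(i <- r | p i) F i x)).
  by apply: mspan_add IH; case: (boolP (p i)) => [/PF//|_]; exact: mspan0.
by apply/funext => x; rewrite big_cons; case: ifP; rewrite ?add0r.
Qed.

Lemma mspan_mul (P Q S : mi -> Prop) f g :
  (forall b c, P b -> Q c -> S (b + c)) ->
  mspan P f -> mspan Q g -> mspan S (fun x => f x * g x).
Proof.
move=> PQS Pf Qg; elim: Pf => [|a b h Pb _ IH].
  rewrite (_ : (fun x => _) = (fun=> 0)); first exact: mspan0.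
  by apply/funext => x; rewrite mul0r.
rewrite (_ : (fun x => _) = (fun x => a * (monomial b x * g x) + h x * g x)).
  apply: mspan_add IH; apply: mspan_scale.
  elim: Qg => [|a' c k Qc _ IH].
    rewrite (_ : (fun x => _) = (fun=> 0)); first exact: mspan0.
    by apply/funext => x; rewrite mulr0.
  rewrite (_ : (fun x => _) =
    (fun x => a' * monomial (b + c) x + monomial b x * k x)).
    by apply: mspanS IH; exact: PQS.
  by apply/funext => x; rewrite monomialD mulrDr mulrCA.
by apply/funext => x; rewrite mulrDl mulrA.
Qed.

Lemma continuous_monomial b : continuous (monomial b : Cspace R n -> C).
Proof.
move=> x; rewrite /monomial /prop_for /continuous_at.
elim: (index_enum _) => [|j r IHr].
  rewrite big_nil; under eq_fun do rewrite big_nil.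
  exact: cst_continuous.
rewrite big_cons; under eq_fun do rewrite big_cons.
apply: (@cvgM _ _ _ _ (fun x : Cspace R n => x 0 j ^+ b j : C)
  (fun x => \prod_(j <- r) x 0 j ^+ b j : C)) IHr.
elim: (b j) => [|k IHk].
  rewrite expr0; under eq_fun do rewrite expr0.
  exact: cst_continuous.
rewrite exprS; under eq_fun do rewrite exprS.
have hj := @continuous_coord R n j x.
exact: (@cvgM _ _ _ _ (fun x : Cspace R n => x 0 j : C)
  (fun x : Cspace R n => x 0 j ^+ k : C) _ _ hj IHk).
Qed.

Lemma mspan_continuous P f : mspan P f -> continuous (f : Cspace R n -> C).
Proof.
elim=> [|a b g _ _ IH] x; first exact: cst_continuous.
apply: (@continuousD _ _ _ (fun x => a * monomial b x : C) g) (IH x).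
apply: (@continuousM _ _ (fun=> a : C) (monomial b : _ -> C)).
  exact: cst_continuous.
exact: continuous_monomial.
Qed.

Definition degle r (b : mi) : Prop := (mdegree b <= r)%N.

(** The degree of the tail is bounded separately because, for [n > 1], lexicographically smaller
    monomials can have arbitrarily large degree. *)
Definition lead r (b : mi) (p : Cspace R n -> R[i]) : Prop :=
  mspan (fun c => lexlt c b /\ degle r c) (fun x => p x - monomial b x).

Lemma lead_mspan r b p : degle r b -> lead r b p -> mspan (degle r) p.
Proof.
move=> br /(mspan_sub (fun c => @proj2 _ _)) pb.
rewrite (_ : p = (fun x => 1 * monomial b x + (p x - monomial b x))).
  exact: mspanS.
by apply/funext => x; rewrite mul1r addrC subrK.
Qed.

Lemma lead_monomial r b : lead r b (monomial b).
Proof.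
rewrite /lead (_ : (fun x => _) = (fun=> 0)); first exact: mspan0.
by apply/funext => x; rewrite subrr.
Qed.

(** Write [p p' - x^(b+b')] as [(p - x^b) p' + x^b (p' - x^b')]; translation invariance of the order
    puts every monomial of both terms below [b + b']. *)
Lemma leadM r r' b b' p p' : degle r b -> degle r' b' ->
  lead r b p -> lead r' b' p' ->
  lead (r + r') (b + b') (fun x => p x * p' x).
Proof.
move=> br br' pb pb'; rewrite /lead.
rewrite (_ : (fun x => _) = (fun x => (p x - monomial b x) * p' x +
   monomial b x * (p' x - monomial b' x))); last first.
  by apply/funext => x; rewrite monomialD; ring.
rewrite {1}/degle in br br'; apply: mspan_add.
  rewrite (_ : (fun x => _) = (fun x => (p x - monomial b x) * monomial b' x +
     (p x - monomial b x) * (p' x - monomial b' x))); last first.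
    by apply/funext => x; ring.
  apply: mspan_add.
    apply: (mspan_mul _ pb (_ : mspan (fun c => c = b') _)).
      move=> c d [cb cr] ->; split; last by rewrite /degle mdegreeD leq_add.
      by rewrite ![_ + b']addrC; exact: lexlt_addl.
    rewrite -[monomial b']mul1r; exact: mspan_monomial.
  apply: (mspan_mul _ pb pb') => c d [cb cr] [db dr].
  split; last by rewrite /degle mdegreeD leq_add.
  apply: (@lexlt_trans _ (c + b')); first exact: lexlt_addl.
  by rewrite ![_ + b']addrC; exact: lexlt_addl.
apply: (mspan_mul _ (_ : mspan (fun c => c = b) _) pb').
  move=> c d -> [db dr]; split; last by rewrite /degle mdegreeD leq_add.
  exact: lexlt_addl.
rewrite -[monomial b]mul1r; exact: mspan_monomial.
Qed.

(** Restriction to complex lines reduces estimates in several variables to polynomials in one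
    variable. *)
Lemma mspan_line r f (a b : Cspace R n) : mspan (degle r) f ->
  exists2 q : {poly R[i]}, (size q <= r.+1)%N &
    forall z : R[i], f (a + (z : C) *: b) = q.[z].
Proof.
elim=> [|k c g cr _ [q qr gq]]; first by exists 0; [rewrite size_poly0|move=> z; rewrite horner0].
pose m : {poly R[i]} :=
  \prod_j ((a 0 j : R[i])%:P + (b 0 j : R[i]) *: 'X) ^+ c j.
have mr : (size m <= r.+1)%N.
  apply: leq_trans (_ : (mdegree c).+1 <= _)%N; last by rewrite ltnS.
  rewrite /m /mdegree; elim/big_ind2 : _ => [|p i p' i' pi pi'|j _].
  - by rewrite size_poly1.
  - by rewrite (leq_trans (size_polyMleq _ _))//; lia.
  - rewrite (leq_trans (size_poly_exp_leq _ _))// ltnS -[leqRHS]mul1n leq_mul2r.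
    apply/orP; right; rewrite -subn1 leq_subLR (leq_trans (size_polyD _ _))//.
    rewrite geq_max (leq_trans (size_polyC_leq1 _))//=.
    by rewrite (leq_trans (size_scale_leq _ _))// size_polyX.
exists (k *: m + q).
  rewrite (leq_trans (size_polyD _ _))// geq_max qr andbT.
  by rewrite (leq_trans (size_scale_leq _ _)).
move=> z; rewrite !hornerE gq; congr (_ * _ + _).
rewrite horner_prod /monomial; apply: eq_bigr => j _.
by rewrite horner_exp !hornerE !mxE mulrC.
Qed.

End monomial_span.

(** * Coefficient estimates *)

Section roots_of_unity.
Context {R : realType}.
Local Notation C := (R[i])^o.

Definition cis (t : R) : R[i] := (cos t +i* sin t)%C.

Lemma cis0 : cis 0 = 1.
Proof. by rewrite /cis cos0 sin0. Qed.

Lemma cisD a b : cis (a + b) = cis a * cis b.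
Proof. by rewrite /cis cosD sinD; simpc; congr (_ +i* _)%C; rewrite addrC. Qed.

Lemma cisX a k : cis a ^+ k = cis (a *+ k).
Proof. by elim: k => [|k IH]; rewrite ?expr0 ?cis0// exprS IH mulrS cisD. Qed.

Lemma rnorm_cis a : rnorm (cis a : C) = 1.
Proof. by rewrite /rnorm normc_def /= cos2Dsin2 sqrtr1. Qed.

Definition omega (N : nat) : R[i] := cis (2 * pi / N%:R).

Lemma rnorm_omega N k : rnorm (omega N ^+ k : C) = 1.
Proof. by rewrite rnormX rnorm_cis expr1n. Qed.

Lemma omegaN N : (0 < N)%N -> omega N ^+ N = 1.
Proof.
move=> N0; rewrite cisX -[_ *+ N]mulr_natr divfK ?pnatr_eq0 -?lt0n//.
by rewrite mulr_natl /cis cos2pi sin2pi.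
Qed.

Lemma omega_neq1 N k : (0 < k < N)%N -> omega N ^+ k != 1.
Proof.
move=> /andP[k0 kN]; rewrite cisX; apply/eqP => -[+ _].
(* Half the angle: it lies strictly between 0 and pi, so [sin t] is positive, whereas a cosine of
   [2 t] equal to 1 would force [sin t] to vanish. *)
set t : R := pi / N%:R *+ k.
have -> : 2 * pi / N%:R *+ k = t *+ 2 :> R by rewrite /t -mulrA -mulrnAr mulr_natl.
rewrite cos_mulr2n cos2sin2 => e.
have : 0 < sin t.
  have N0 : 0 < N%:R :> R by rewrite ltr0n (leq_trans _ kN).
  apply: sin_gt0_pi; rewrite /t -[_ *+ k]mulr_natr; apply/andP; split.
    by rewrite mulr_gt0 ?divr_gt0 ?pi_gt0// ltr0n.
  by rewrite mulrAC ltr_pdivrMr// ltr_pM2l ?pi_gt0// ltr_nat.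
move=> /(exprn_gt0 2); move: e; lra.
Qed.

Lemma omega_expE N k : (0 < N)%N -> omega N ^+ k = omega N ^+ (k %% N).
Proof.
by move=> N0; rewrite {1}(divn_eq k N) exprD mulnC exprM omegaN// expr1n mul1r.
Qed.

Lemma sum_omega N k : (0 < N)%N ->
  \sum_(l < N) omega N ^+ (l * k) = if (N %| k)%N then N%:R else 0.
Proof.
move=> N0; case: ifPn => Nk.
  rewrite (eq_bigr (fun=> 1)) ?sumr_const ?card_ord// => l _.
  by rewrite omega_expE// -modnMmr (eqP Nk) muln0 mod0n.
have wk : omega N ^+ k != 1.
  by rewrite omega_expE// omega_neq1// lt0n Nk ltn_mod.
have : (omega N ^+ k - 1) * \sum_(l < N) (omega N ^+ k) ^+ l = 0.
  by rewrite -subrX1 -exprM mulnC exprM omegaN// expr1n subrr.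
move=> /eqP; rewrite mulf_eq0 subr_eq0 (negbTE wk)/= => /eqP h.
by rewrite -[RHS]h; apply: eq_bigr => l _; rewrite -exprM mulnC.
Qed.

(** The exponent [N - k] stands for [- k] modulo [N]. Since [0 < j + (N - k) < 2 N], the only
    multiple of [N] it can equal is [N] itself. *)
Lemma dvdn_shift N j k : (j < N)%N -> (k < N)%N ->
  (N %| j + (N - k))%N = (j == k).
Proof.
move=> jN kN; apply/idP/eqP => [|->]; last by rewrite subnKC// ltnW.
move=> /dvdnP[[|[|q]] h]; [| |exfalso]; nia.
Qed.

Lemma coef_sum_omega N k (p : {poly R[i]}) : (size p <= N)%N -> (k < N)%N ->
  \sum_(l < N) p.[omega N ^+ l] * omega N ^+ (l * (N - k)) = N%:R * p`_k.
Proof.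
move=> pN kN; have N0 : (0 < N)%N by rewrite (leq_trans _ kN).
under eq_bigr do rewrite (horner_coef_wide _ pN) mulr_suml.
rewrite exchange_big /= mulrC; under eq_bigr => j _.
  under eq_bigr => l _ do rewrite -exprM -mulrA -exprD -mulnDr.
  rewrite -mulr_sumr sum_omega// dvdn_shift//.
over.
rewrite (bigD1 (Ordinal kN))//= eqxx big1 ?addr0// => j.
by rewrite -val_eqE/= => /negbTE ->; rewrite mulr0.
Qed.

Lemma exists_ge_average (I : finType) (F : I -> C) (a : C) :
  (0 < #|I|)%N -> \sum_i F i = #|I|%:R * a -> exists i, rnorm a <= rnorm (F i).
Proof.
move=> I0 Fa; apply: contrapT => /forallNP h.
have : \sum_i rnorm (F i) < \sum_(i : I) rnorm a.
  have [i0 _] : exists i0 : I, i0 \in I by apply/existsP; apply/existsP/card_gt0P.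
  rewrite (bigD1 i0)//= [ltRHS](bigD1 i0)//= ltr_leD//.
    by rewrite ltNge; apply/negP/h.
  by apply: ler_sum => i _; rewrite leNgt; apply/negP => /ltW /h.
rewrite sumr_const -[_ *+ _]mulr_natl ltNge => /negP; apply.
by rewrite -rnorm_nat -rnormM -Fa rnorm_sum.
Qed.

(** A discrete Cauchy estimate: the coefficient is an average of values at roots of unity times
    factors of modulus 1, so one of these values is at least as large. *)
Lemma coef_le_circle N k (p : {poly R[i]}) : (size p <= N)%N -> (k < N)%N ->
  exists l : 'I_N, rnorm (p`_k : C) <= rnorm (p.[omega N ^+ l] : C).
Proof.
move=> pN kN; have N0 : (0 < #|'I_N|)%N by rewrite card_ord (leq_trans _ kN).
have [|l] := @exists_ge_average 'I_N
  (fun l => p.[omega N ^+ l] * omega N ^+ (l * (N - k))) p`_k N0.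
  by rewrite [in RHS]card_ord; exact: coef_sum_omega pN kN.
by rewrite rnormM rnorm_omega mulr1 => h; exists l.
Qed.

(** The coefficient of [x^b] is 1, and it is the average over a finite grid of roots of unity of [p]
    times a factor of modulus 1. Roots of order [r + 1] separate all exponents that occur. *)
Lemma lead_torus n r (b : {ffun 'I_n -> nat}) (p : Cspace R n -> R[i]) :
  degle r b -> lead r b p ->
  exists2 z : Cspace R n, rnorm z <= 1 & 1 <= rnorm (p z : C).
Proof.
move=> br pb; set N := r.+1.
pose z (l : {ffun 'I_n -> 'I_N}) : Cspace R n := \row_j (omega N ^+ l j : C).
(* For [f] of degree at most [r], [A f] is [N ^ n] times the coefficient of [x^b]. *)
pose A (f : Cspace R n -> R[i]) := \sum_l f (z l) *
  \prod_j omega N ^+ (l j * (N - b j)).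
have Amon c : degle r c -> A (monomial c) = if c == b then (N ^ n)%:R else 0.
  move=> cr; have ltN d j : degle r d -> (d j < N)%N.
    by move=> dr; rewrite ltnS (leq_trans (leq_mdegree _ _)).
  transitivity (\sum_(l : {ffun 'I_n -> 'I_N})
      \prod_j omega N ^+ (l j * (c j + (N - b j)))).
    apply: eq_bigr => l _; rewrite /monomial -big_split; apply: eq_bigr => j _.
    by rewrite /= mxE -exprM -exprD -mulnDr.
  rewrite -(bigA_distr_bigA (fun j (l : 'I_N) =>
    omega N ^+ (l * (c j + (N - b j))))) /=.
  under eq_bigr => j _ do rewrite sum_omega// dvdn_shift ?ltN//.
  case: eqP => [->|cb].
    by under eq_bigr do rewrite eqxx; rewrite prodr_const card_ord natrX.
  have [j cbj] : exists j, c j != b j.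
    apply/existsP; apply: contra_notT cb; rewrite negb_exists => /forallP e.
    by apply/ffunP => i; apply/eqP; have := e i; rewrite negbK.
  by rewrite (bigD1 j)//= (negbTE cbj) mul0r.
have Ap : A p = (N ^ n)%:R.
  have -> : A p = A (monomial b) + A (fun x => p x - monomial b x).
    rewrite /A -big_split; apply: eq_bigr => l _ /=.
    by rewrite -mulrDl addrC subrK.
  rewrite [A (monomial b)]Amon// eqxx.
  rewrite [X in _ + X](_ : _ = 0) ?addr0//.
  elim: pb => [|a c f [cb cr] _ IH].
    by rewrite /A big1// => l _; rewrite mul0r.
  transitivity (a * A (monomial c) + A f).
    rewrite /A mulr_sumr -big_split; apply: eq_bigr => l _ /=.
    by rewrite mulrDl mulrA.
  rewrite IH Amon//; case: eqP cb => [->|]; first by rewrite lexlt_irr.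
  by rewrite mulr0 addr0.
have cN : #|{: {ffun 'I_n -> 'I_N}}| = (N ^ n)%N by rewrite card_ffun !card_ord.
have [||l] := @exists_ge_average {ffun 'I_n -> 'I_N}
  (fun l => p (z l) * \prod_j omega N ^+ (l j * (N - b j))) 1.
- by rewrite cN expn_gt0.
- by rewrite mulr1 cN; exact: Ap.
rewrite rnorm1 rnormM rnorm_prod (eq_bigr (fun=> 1)); last first.
  by move=> j _; rewrite rnorm_omega.
rewrite prodr_const expr1n mulr1 => zl; exists (z l) => //.
by apply/rnorm_row_le => // j; rewrite mxE rnorm_omega.
Qed.

End roots_of_unity.

(** * Growth of polynomials outside a ball *)

Section bernstein_walsh.
Context {R : realType} {n : nat}.
Local Notation C := (R[i])^o.

Lemma mspan_bounded (P : {ffun 'I_n -> nat} -> Prop) (f : Cspace R n -> R[i])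
    (B : R) : mspan P f ->
  exists2 M : R, 0 <= M & forall x, rnorm x <= B -> rnorm (f x : C) <= M.
Proof.
move=> Pf; have [B0|B0] := leP 0 B; last first.
  by exists 0 => // x xB; have := le_lt_trans xB B0; rewrite ltNge rnorm_ge0.
elim: Pf => [|a b g _ _ [M M0 gM]].
  by exists 0 => // x _; rewrite rnorm0.
exists (rnorm (a : C) * B ^+ mdegree b + M).
  by rewrite addr_ge0// mulr_ge0 ?rnorm_ge0// exprn_ge0.
move=> x xB; rewrite (le_trans (rnormD _ _))// lerD ?gM// rnormM.
rewrite ler_wpM2l ?rnorm_ge0// /monomial rnorm_prod.
rewrite (_ : B ^+ _ = \prod_j B ^+ b j); last by rewrite prodrXr.
apply: ler_prod => j _; rewrite rnorm_ge0/= rnormX lerXn2r ?nnegrE ?rnorm_ge0//.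
exact: (rnorm_row_le x B0).1.
Qed.

(** On the complex line through [z0] and [z], scaled so that the unit circle has radius [rho], the
    Cauchy estimate bounds all [r + 1] coefficients by [m]. At a parameter of size at most [E] this
    gives [(r + 1) m E^r], and [r + 1 <= 2^r]. *)
Lemma bernstein_walsh r (f : Cspace R n -> R[i]) (z0 : Cspace R n) (rho m E : R) :
  mspan (degle r) f -> 0 < rho -> 1 <= E ->
  (forall z, rnorm (z - z0) <= rho -> rnorm (f z : C) <= m) ->
  forall z, rnorm (z - z0) <= E * rho -> rnorm (f z : C) <= m * (2 * E) ^+ r.
Proof.
move=> fr rho0 E1 fm z zE.
have m0 : 0 <= m.
  by apply: le_trans (fm z0 _); rewrite ?rnorm_ge0// subrr rnorm0 ltW.
have [->|zz0] := eqVneq z z0.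
  apply: le_trans (fm z0 _) _; first by rewrite subrr rnorm0 ltW.
  by rewrite ler_peMr// exprn_ege1//; move: E1; lra.
pose t := rnorm (z - z0) / rho.
have t0 : 0 < t by rewrite divr_gt0// rnorm_gt0 subr_eq0.
have tE : t <= E by rewrite ler_pdivrMr.
have [q qr fq] := mspan_line z0 (((t^-1)%:C)%C *: (z - z0)) fr.
have qm k : (k < r.+1)%N -> rnorm (q`_k : C) <= m.
  move=> kr; have [l] := coef_le_circle qr kr; move/le_trans; apply.
  rewrite -fq fm// addrC addKr !rnormZ rnorm_omega mul1r rnorm_real.
  rewrite ger0_norm ?invr_ge0 ?(ltW t0)// /t invf_div divfK ?lexx//.
  by rewrite gt_eqF// rnorm_gt0 subr_eq0.
have -> : f z = q.[(t%:C)%C].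
  rewrite -fq scalerA -rmorphM divff ?gt_eqF// rmorph1 scale1r.
  by rewrite addrC subrK.
rewrite (horner_coef_wide _ qr) (le_trans (rnorm_sum _ _ _))//.
apply: (@le_trans _ _ (\sum_(i < r.+1) m * E ^+ r)).
  apply: ler_sum => k _; rewrite rnormM rnormX rnorm_real (ger0_norm (ltW t0)).
  apply: ler_pM; rewrite ?rnorm_ge0 ?exprn_ge0 ?(ltW t0) ?qm//.
  apply: (@le_trans _ _ (E ^+ k)); first by rewrite lerXn2r// ?nnegrE; lra.
  by rewrite ler_weXn2l// -ltnS.
rewrite sumr_const card_ord exprMn -[_ *+ _]mulr_natl mulrCA ler_wpM2l//.
rewrite ler_wpM2r ?exprn_ge0//; first by lra.
by rewrite -natrX ler_nat ltn_expl.
Qed.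

End bernstein_walsh.

(** * A plurisubharmonic function that is [-oo] on [K] *)

Section riemann.
Context {R : realType}.
Local Notation leb := (@lebesgue_measure R).

Lemma continuous_integrable_itv (F : R -> R) (a b : R) : continuous F ->
  leb.-integrable `[a, b] (EFin \o F).
Proof.
move=> cF; apply: continuous_compact_integrable; first exact: segment_compact.
exact: continuous_subspaceT.
Qed.

Lemma riemann_sum_le (F : R -> R) (a : R) (N : nat) (m : nat -> R) :
  continuous F -> 0 <= a ->
  (forall k t, (k < N)%N -> k%:R * a <= t <= k.+1%:R * a -> m k <= F t) ->
  \sum_(k < N) a * m k <= Rintegral leb `[0, N%:R * a] F.
Proof.
move=> cF a0; elim: N => [|N IH] mF.
  by rewrite big_ord0 mul0r set_itv1 Rintegral_set1.
rewrite big_ord_recr/=.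
have Na0 : 0 <= N%:R * a by rewrite mulr_ge0.
have NaS : N%:R * a <= N.+1%:R * a by rewrite ler_wpM2r// ler_nat.
have -> : Rintegral leb `[0, N.+1%:R * a] F = Rintegral leb `[0, N%:R * a] F
    + Rintegral leb `]N%:R * a, N.+1%:R * a] F.
  rewrite -(@Rintegral_itvB _ F (BLeft 0) (BRight (N.+1%:R * a)) (N%:R * a)).
  - by rewrite addrC subrK.
  - exact: continuous_integrable_itv.
  - by rewrite bnd_simp.
  - by rewrite bnd_simp.
rewrite lerD//; first by apply: IH => k t kN; apply: mF; rewrite ltnS ltnW.
have mI : measurable (`]N%:R * a, N.+1%:R * a]%classic : set (measurableTypeR R)).
  exact: measurable_itv.
have -> : a * m N = Rintegral leb `]N%:R * a, N.+1%:R * a] (fun=> m N).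
  rewrite Rintegral_cst// mulrC /= lebesgue_measure_itv/= lte_fin.
  have [_|h] := ltP (N%:R * a) (N.+1%:R * a).
    by rewrite /= -natr1; congr (_ * _); ring.
  have -> : a = 0 by move: h; rewrite -natr1; lra.
  by rewrite mulr0.
apply: le_Rintegral => //.
- have intc := @continuous_integrable_itv (fun=> m N) (N%:R * a) (N.+1%:R * a)
    (@cst_continuous _ _ _).
  by apply: integrableS intc => //; exact: subset_itv_oc_cc.
- have intF := continuous_integrable_itv (N%:R * a) (N.+1%:R * a) cF.
  by apply: integrableS intF => //; exact: subset_itv_oc_cc.
- by move=> t /=; rewrite in_itv/= => /andP[/ltW t1 t2]; apply: mF; rewrite ?t1.
Qed.

End riemann.

(** * The sub-mean-value inequality for truncated logarithms *)

Section submean.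
Context {R : realType}.
Local Notation C := (R[i])^o.
Local Notation leb := (@lebesgue_measure R).

Lemma lipschitz_cos (a b : R) : `|cos a - cos b| <= `|a - b|.
Proof.
wlog ba : a b / b <= a.
  by move=> W; case/orP: (le_total b a) => /W//; rewrite distrC [leRHS]distrC.
have [] := @MVT_segment R cos (fun x => - sin x) b a ba.
  by apply: continuous_subspaceT; exact: continuous_cos.
move=> c _ ->; rewrite normrM normrN ler_piMl// ler_norml.
by rewrite sin_geN1 sin_le1.
Qed.

Lemma lipschitz_sin (a b : R) : `|sin a - sin b| <= `|a - b|.
Proof.
wlog ba : a b / b <= a.
  by move=> W; case/orP: (le_total b a) => /W//; rewrite distrC [leRHS]distrC.
have [] := @MVT_segment R sin cos b a ba.
  by apply: continuous_subspaceT; exact: continuous_sin.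
move=> c _ ->; rewrite normrM ler_piMl// ler_norml.
by rewrite cos_geN1 cos_le1.
Qed.

Lemma lipschitz_ln (d a b : R) : 0 < d -> d <= a -> d <= b ->
  `|ln a - ln b| <= `|a - b| / d.
Proof.
move=> d0 da db; wlog ba : a b da db / b <= a.
  move=> W; case/orP: (le_total b a) => h; first exact: W.
  by rewrite distrC [`|a - b|]distrC; exact: W.
have b0 : 0 < b by exact: lt_le_trans db.
have a0 : 0 < a by exact: lt_le_trans da.
rewrite !ger0_norm ?subr_ge0 ?ler_ln// -ln_div//.
have -> : a / b = 1 + (a - b) / b by field; rewrite gt_eqF.
apply: (@le_trans _ _ ((a - b) / b)).
  by apply: le_ln1Dx; rewrite (lt_le_trans (ltrN10 _))// divr_ge0 ?subr_ge0// ltW.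
by rewrite ler_wpM2l ?subr_ge0// lef_pV2.
Qed.

Lemma lipschitz_poly (q : {poly R[i]}) (B : R) :
  exists2 L : R, 0 <= L & forall x y : C, rnorm x <= B -> rnorm y <= B ->
    rnorm (q.[x] - q.[y] : C) <= L * rnorm (x - y).
Proof.
(* The bound [M] on the values is carried through the induction because the Lipschitz constant of
   [q X + c] involves it. *)
suff [M [L [M0 L0 qB]]] : exists M L : R, [/\ 0 <= M, 0 <= L & forall x y : C,
    rnorm x <= B -> rnorm y <= B -> rnorm (q.[x] : C) <= M /\
    rnorm (q.[x] - q.[y] : C) <= L * rnorm (x - y)].
  by exists L => // x y xB yB; have [] := qB x y xB yB.
elim/poly_ind: q => [|q c [M [L [M0 L0 qB]]]].
  exists 0, 0; split=> // x y _ _.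
  by rewrite !horner0 subrr rnorm0 mul0r.
have [B0|B0] := leP 0 B; last first.
  exists 0, 0; split=> // x y xB; have := le_lt_trans xB B0.
  by rewrite ltNge rnorm_ge0.
exists (M * B + rnorm (c : C)), (L * B + M); split.
- by rewrite addr_ge0 ?mulr_ge0 ?rnorm_ge0.
- by rewrite addr_ge0 ?mulr_ge0.
move=> x y xB yB; have [qx qxy] := qB x y xB yB; have [qy _] := qB y y yB yB.
rewrite !hornerMXaddC; split.
  by rewrite (le_trans (rnormD _ _))// lerD// rnormM ler_pM// rnorm_ge0.
have -> : q.[x] * x + c - (q.[y] * y + c) =
  (q.[x] - q.[y]) * x + q.[y] * (x - y) by ring.
rewrite (le_trans (rnormD _ _))// !rnormM mulrDl lerD//.
  by rewrite mulrAC ler_pM ?rnorm_ge0.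
by rewrite ler_wpM2r ?rnorm_ge0.
Qed.

Lemma circleE (c : C) rho t : circle c rho t = c + (rho%:C)%C * cis t.
Proof. by rewrite /circle /cis; congr (_ + _); simpc. Qed.

(** The function [ln |a|] cut off below at [ln d]: for [d > 0] it is Lipschitz, hence usable in
    Riemann sums, and it never evaluates [ln] at 0. *)
Definition logcut (d : R) (a : C) : R := ln (Num.max (rnorm a) d).

Lemma lipschitz_circle_logcut (q : {poly R[i]}) (c : C) (rho d : R) :
  0 < d -> 0 < rho -> exists2 L : R, 0 <= L & forall s t : R,
   `|logcut d q.[circle c rho s] - logcut d q.[circle c rho t]| <= L * `|s - t|.
Proof.
move=> d0 rho0; have [L L0 qL] := lipschitz_poly q (rnorm c + rho).
have cB t : rnorm (circle c rho t : C) <= rnorm c + rho.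
  rewrite circleE (le_trans (rnormD _ _))// lerD2l rnormM rnorm_cis mulr1.
  by rewrite rnorm_real gtr0_norm.
exists (L * (rho * 2) / d).
  by rewrite divr_ge0 ?mulr_ge0// ltW.
move=> s t; apply: le_trans (lipschitz_ln d0 _ _) _.
- by rewrite le_max lexx orbT.
- by rewrite le_max lexx orbT.
rewrite mulrAC ler_wpM2r ?invr_ge0 ?(ltW d0)//.
have mx (a b : R) : `|Num.max a d - Num.max b d| <= `|a - b|.
  rewrite /Num.max; case: ifPn; case: ifPn; rewrite -?leNgt => h1 h2;
  rewrite ler_norml; apply/andP; have := ler_norm (a - b);
  have := ler_norm (b - a); rewrite distrC; lra.
apply: le_trans (mx _ _) _.
have -> : L * (rho * 2) * `|s - t| = L * (rho * (`|s - t| + `|s - t|)) by ring.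
apply: (@le_trans _ _ (rnorm (q.[circle c rho s] - q.[circle c rho t] : C))).
  have h (a b : C) : rnorm a - rnorm b <= rnorm (a - b).
    by rewrite lerBlDr -{1}(subrK b a) rnormD.
  by rewrite ler_norml h lerNl opprB rnormB h.
apply: le_trans (qL _ _ (cB _) (cB _)) _; rewrite ler_wpM2l//.
rewrite !circleE opprD addrACA subrr add0r -mulrBr rnormM rnorm_real gtr0_norm//.
rewrite ler_wpM2l ?(ltW rho0)//.
by rewrite (le_trans (rnorm_le_ReIm _))// lerD//= ?lipschitz_cos ?lipschitz_sin.
Qed.

(* As a polynomial in [cis th], the product of the [q.[...]] has constant term
   [q.[c] ^+ N], which is an average of its values at roots of unity. *)
Lemma exists_rotation (q : {poly R[i]}) (c : C) (rho : R) (N : nat) : (0 < N)%N ->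
  exists2 th : R, 0 <= th <= 2 * pi / N%:R & rnorm (q.[c] : C) ^+ N <=
    \prod_(k < N) rnorm (q.[circle c rho (k%:R * (2 * pi / N%:R) + th)] : C).
Proof.
move=> N0; pose Q (k : nat) (z : C) := q.[c + (rho%:C)%C * omega N ^+ k * z].
pose P : {poly R[i]} := \prod_(k < N)
  (q \Po (c%:P + ((rho%:C)%C * omega N ^+ k) *: 'X)).
have PE z : P.[z] = \prod_(k < N) Q k z.
  rewrite /P horner_prod; apply: eq_bigr => k _.
  by rewrite horner_comp !hornerE.
(* [L] is a multiple of [N] and at least the size of [P]; every [L]-th root of unity is an [N]-th
   root of unity times a rotation by less than [2 pi / N]. *)
set M := (size P).+1; set L := (N * M)%N.
have L0 : (0 < L)%N by rewrite muln_gt0 N0.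
have [|l] := @coef_le_circle R L 0 P _ L0.
  by rewrite (leq_trans (leqnSn _))// leq_pmull.
rewrite -horner_coef0 !PE.
rewrite (eq_bigr (fun=> q.[c])); last first.
  by move=> k _; rewrite /Q mulr0 addr0.
rewrite prodr_const card_ord rnormX => h.
(* Shifting the indices amounts to multiplying [z] by a power of [omega N] and permutes the factors
   cyclically; hence only [l %% M] matters. *)
have Qper z j : \prod_(k < N) Q (k + j)%N z = \prod_(k < N) Q k z.
  elim: j => [|j <-]; first by apply: eq_bigr => k _; rewrite addn0.
  case: N N0 @Q {P PE M L L0 l h} => // N _ Q.
  rewrite big_ord_recr [RHS]big_ord_recl /= mulrC; congr (_ * _).
    by rewrite /Q add0n addnS -addSn exprD omegaN// mul1r.
  by apply: eq_bigr => k _; rewrite /bump/= addnS addSn.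
have lE : (l : nat) = (l %/ M * M + l %% M)%N by exact: divn_eq.
exists ((l %% M)%:R * (2 * pi / L%:R)).
  rewrite mulr_ge0 ?divr_ge0 ?mulr_ge0 ?pi_ge0//=.
  have M0 : 0 < M%:R :> R by rewrite ltr0n.
  have -> : (l %% M)%:R * (2 * pi / L%:R) = 2 * pi / N%:R * ((l %% M)%:R / M%:R) :> R.
    by rewrite /L natrM; field; rewrite !pnatr_eq0 -!lt0n N0.
  rewrite ler_piMr ?divr_ge0 ?mulr_ge0 ?pi_ge0//.
  by rewrite ler_pdivrMr// mul1r ler_nat ltnW// ltn_mod.
apply: le_trans h _.
have wl : omega L ^+ l = omega N ^+ (l %/ M) * omega L ^+ (l %% M) :> R[i].
  rewrite {1}lE exprD; congr (_ * _); rewrite mulnC exprM; congr (_ ^+ _).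
  rewrite /omega cisX; congr cis; rewrite -[LHS]mulr_natr /L natrM.
  by field; rewrite !pnatr_eq0 -!lt0n N0.
have -> : \prod_(k < N) Q k (omega L ^+ l) =
    \prod_(k < N) Q k (omega L ^+ (l %% M)).
  rewrite -[RHS](Qper _ (l %/ M)%N); apply: eq_bigr => k _.
  by rewrite /Q wl; congr q.[c + _]; rewrite exprD !mulrA.
rewrite rnorm_prod; apply: ler_prod => k _; rewrite rnorm_ge0/=.
rewrite /Q circleE -mulrA cisD /omega !cisX.
by rewrite -[_ *+ k]mulr_natl -[_ *+ (l %% M)]mulr_natl.
Qed.

Lemma continuous_circle_logcut (q : {poly R[i]}) (c : C) (rho d : R) :
  0 < d -> 0 < rho -> continuous (fun t : R => logcut d q.[circle c rho t]).
Proof.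
move=> d0 rho0; have [L L0 FL] := lipschitz_circle_logcut q c d0 rho0.
  move=> x; apply/cvgrPdist_lt => e e0.
have L1 : 0 < L + 1 by rewrite ltr_wpDl.
apply/nbhs_ballP; exists (e / (L + 1)); first by rewrite /= divr_gt0.
move=> y; rewrite /ball/= => xy; apply: le_lt_trans (FL _ _) _.
rewrite (@le_lt_trans _ _ ((L + 1) * `|x - y|))//.
  by rewrite ler_wpM2r// lerDl.
by rewrite mulrC -ltr_pdivlMr.
Qed.

(** [exists_rotation] gives the inequality for [N] equidistant points. Comparing with the integral
    costs at most [L a] on each of the [N] arcs of length [a = 2 pi / N], in total [(2 pi)^2 L / N],
    which tends to 0. *)
Lemma logcut_submean (q : {poly R[i]}) (c : C) (rho d : R) :
  0 < d -> 0 < rho -> 2 * pi * logcut d q.[c] <=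
    Rintegral leb `[0, 2 * pi] (fun t => logcut d q.[circle c rho t]).
Proof.
move=> d0 rho0; set F := (fun t => logcut d q.[circle c rho t]).
have [L L0 FL] := lipschitz_circle_logcut q c d0 rho0.
have cF : continuous F by exact: continuous_circle_logcut.
have pi2 : 0 < 2 * pi :> R by rewrite mulr_gt0// pi_gt0.
have key N : (0 < N)%N -> 2 * pi * logcut d q.[c] - (2 * pi) ^+ 2 * L / N%:R <=
    Rintegral leb `[0, 2 * pi] F.
  move=> N0; have N0' : 0 < N%:R :> R by rewrite ltr0n.
  have [th /andP[th0 thN] qth] := exists_rotation q c rho N0.
  set a := 2 * pi / N%:R in th0 thN qth.
  have a0 : 0 <= a by rewrite divr_ge0// ltW.
  have -> : 2 * pi = N%:R * a by rewrite /a; field; rewrite gt_eqF.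
  apply: le_trans (riemann_sum_le (m := fun k => F (k%:R * a + th) - L * a) cF a0 _).
    rewrite -mulr_sumr sumrB sumr_const card_ord -[L * a *+ N]mulr_natl.
    have -> : (N%:R * a) ^+ 2 * L / N%:R = a * (N%:R * (L * a)).
      by field; rewrite gt_eqF.
    rewrite mulrBr lerB// [N%:R * a]mulrC -mulrA ler_wpM2l//.
    have expF k : expR (F (k%:R * a + th)) =
        Num.max (rnorm (q.[circle c rho (k%:R * a + th)] : C)) d.
      by rewrite /F /logcut lnK// posrE lt_max d0 orbT.
    have mx0 : 0 < Num.max (rnorm (q.[c] : C)) d by rewrite lt_max d0 orbT.
    rewrite mulr_natl -lnXn// -ler_expR lnK ?posrE ?exprn_gt0// expR_sum.
    under [leRHS]eq_bigr do rewrite expF.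
    (* If the cutoff is active at the centre, it suffices that every factor is at least [d];
       otherwise [exists_rotation] applies to the uncut values. *)
    have [qd|dq] := leP (rnorm (q.[c] : C)) d.
      rewrite -[X in _ ^+ X](card_ord N) -prodr_const; apply: ler_prod => k _.
      by rewrite (ltW d0) le_max lexx orbT.
    apply: le_trans qth _; apply: ler_prod => k _.
    by rewrite rnorm_ge0 le_max lexx.
  move=> k t kN /andP[t1 t2]; rewrite lerBlDr -lerBlDl.
  apply: le_trans (ler_norm _) _; apply: le_trans (FL _ _) _.
  rewrite ler_wpM2l// ler_norml; move: t2; rewrite -natr1; nra.
apply/ler_addgt0Pl => e e0.
pose N := (Num.truncn ((2 * pi) ^+ 2 * L / e)).+1.
have N0' : 0 < N%:R :> R by rewrite ltr0n.
rewrite -lerBlDl; apply: le_trans (key N _) => //; rewrite lerB//.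
rewrite ler_pdivrMr// [e * _]mulrC -ler_pdivrMr// ltW//.
exact: truncnS_gt.
Qed.

End submean.

Lemma continuous_sum_ord (R : realType) (T : topologicalType) (m : nat)
    (F : nat -> T -> R) : (forall j, continuous (F j)) ->
  continuous (fun x => \sum_(j < m) F j x).
Proof.
move=> cF; elim: m => [|m IH] x.
  rewrite (_ : (fun x => _) = (fun=> 0)); first exact: cst_continuous.
  by apply/funext => y; rewrite big_ord0.
rewrite (_ : (fun x => _) = (fun x => \sum_(j < m) F j x + F m x)); last first.
  by apply/funext => y; rewrite big_ord_recr.
by apply: continuousD; [exact: IH|exact: cF].
Qed.

Lemma sub_sube (R : realType) (r : R) (y : \bar R) :
  (y < +oo)%E -> (y = r%:E - (r%:E - y))%E.
Proof.
case: y => [y _| //|//].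
by rewrite -!EFinB opprB addrCA subrr addr0.
Qed.

Section psh_limit.
Context {R : realType} {n : nat}.
Local Notation C := (R[i])^o.
Local Notation leb := (@lebesgue_measure R).
Variables (P : nat -> Cspace R n -> R[i]) (a : nat -> R).
Hypothesis P_poly : forall j, exists r, mspan (degle r) (P j).
Hypothesis a_gt0 : forall j, 0 < a j.
Hypothesis P_le1 : forall j x, rnorm x <= j%:R -> rnorm (P j x : C) <= 1.

(** [J] governs both the number of terms and the cutoff: each [logsum J] is continuous, while the
    cutoff disappears in the limit. *)
Definition logsum (J : nat) (x : Cspace R n) : R :=
  \sum_(j < J) a j * logcut (expR (- J%:R)) (P j x).

(* From [J >= rnorm x] on, [logsum J x] is nonincreasing in [J], because the cutoffs
   decrease and the new terms are nonpositive: the infimum is a decreasing limit. *)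
Definition loglim (x : Cspace R n) : \bar R :=
  ereal_inf [set (logsum J x)%:E | J in [set J : nat | rnorm x <= J%:R]].

Lemma loglim_le J x : rnorm x <= J%:R -> (loglim x <= (logsum J x)%:E)%E.
Proof. by move=> xJ; apply: ereal_inf_lbound; exists J. Qed.

Lemma le_logcut (d d' : R) (z : C) : 0 < d -> d <= d' -> logcut d z <= logcut d' z.
Proof.
move=> d0 dd'; rewrite /logcut ler_ln ?posrE ?lt_max ?d0 ?(lt_le_trans d0 dd') ?orbT//.
by rewrite ge_max !le_max lexx dd' orbT.
Qed.

Lemma logcut_le0 (d : R) (z : C) : d <= 1 -> rnorm z <= 1 -> logcut d z <= 0.
Proof. by move=> d1 z1; rewrite /logcut ln_le0// ge_max z1. Qed.

Lemma logsumS J x : rnorm x <= J%:R -> logsum J.+1 x <= logsum J x.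
Proof.
move=> xJ; rewrite /logsum big_ord_recr/= -[leRHS]addr0 lerD//.
  apply: ler_sum => j _; rewrite ler_wpM2l ?(ltW (a_gt0 _))// le_logcut ?expR_gt0//.
  by rewrite ler_expR lerN2 ler_nat.
by rewrite mulr_ge0_le0 ?(ltW (a_gt0 _))// logcut_le0 ?P_le1// -expR0 ler_expR oppr_le0.
Qed.

Lemma logsum_nonincreasing J J' x : rnorm x <= J%:R -> (J <= J')%N ->
  logsum J' x <= logsum J x.
Proof.
move=> xJ; elim: J' => [|J' IH]; first by rewrite leqn0 => /eqP <-.
rewrite leq_eqVlt => /orP[/eqP->//|JJ'].
apply: le_trans (IH JJ'); apply: logsumS; apply: le_trans xJ _.
by rewrite ler_nat.
Qed.

Lemma continuous_logcut (d : R) (f : Cspace R n -> C) : 0 < d -> continuous f ->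
  continuous (fun x => logcut d (f x)).
Proof.
move=> d0 cf x; rewrite /logcut.
apply: (@continuous_comp _ _ _ (fun x => Num.max (rnorm (f x)) d) (@ln R)); last first.
  by apply: continuous_ln; rewrite lt_max d0 orbT.
apply: (@continuous_max _ _ (fun x => rnorm (f x)) (fun=> d)); last exact: cst_continuous.
by apply: (@continuous_comp _ _ _ f (@rnorm R C)); [exact: cf|exact: continuous_rnorm].
Qed.

Lemma continuous_logsum J : continuous (logsum J).
Proof.
rewrite /logsum; move: (expR (- J%:R)) (expR_gt0 (- J%:R : R)) => d d0.
apply: (@continuous_sum_ord _ _ _ (fun j x => a j * logcut d (P j x))) => j x.
apply: (@continuousM _ _ (fun=> a j) (fun x => logcut d (P j x))).
  exact: cst_continuous.
have [r Pr] := P_poly j.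
exact: continuous_logcut d0 (mspan_continuous Pr) x.
Qed.

Lemma loglim_lt_pinfty x : (loglim x < +oo)%E.
Proof.
apply: le_lt_trans (loglim_le (_ : rnorm x <= (Num.truncn (rnorm x)).+1%:R)) _.
  by rewrite ltW// truncnS_gt.
by rewrite ltry.
Qed.

Lemma lower_semicontinuous_loglim : lower_semicontinuous (fun x => - loglim x)%E.
Proof.
move=> x t; rewrite lteNr => /ereal_inf_lt[_ [J /= xJ <-]]; rewrite lte_fin => h.
(* Passing from [J] to [J.+1] makes the ball of admissible points an open neighbourhood of [x];
   [logsumS] preserves the bound. *)
exists [set y | rnorm y < J.+1%:R /\ logsum J.+1 y < - t].
  apply: filterI.
    apply: (@continuous_rnorm R (Cspace R n) x [set r | r < J.+1%:R]).
    apply: lt_nbhsl; apply: le_lt_trans xJ _; by rewrite ltr_nat.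
  apply: (@continuous_logsum J.+1 x [set r | r < - t]).
  by apply: lt_nbhsl; apply: le_lt_trans h; exact: logsumS.
move=> y [yJ yt]; rewrite lteNr; apply: le_lt_trans (loglim_le (ltW yJ)) _.
by rewrite lte_fin.
Qed.

Lemma P_line (x y : Cspace R n) j :
  exists q : {poly R[i]}, forall z : C, P j (x + z *: y) = q.[z].
Proof. by have [r Pr] := P_poly j; have [q _ Pq] := mspan_line x y Pr; exists q. Qed.

Lemma continuous_circle_term (x y : Cspace R n) (c : C) (rho d : R) j :
  0 < rho -> 0 < d ->
  continuous (fun t => a j * logcut d (P j (x + circle c rho t *: y))).
Proof.
move=> rho0 d0 t; apply: (@continuousM _ _ (fun=> a j) (fun t =>
    logcut d (P j (x + circle c rho t *: y)))); first exact: cst_continuous.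
have [q Pq] := P_line x y j.
rewrite (_ : (fun t => _) = (fun t => logcut d q.[circle c rho t])).
  exact: continuous_circle_logcut.
by apply/funext => s; rewrite Pq.
Qed.

Lemma continuous_circle_logsum J (x y : Cspace R n) (c : C) (rho : R) : 0 < rho ->
  continuous (fun t => logsum J (x + circle c rho t *: y)).
Proof.
move=> rho0; apply: (@continuous_sum_ord _ _ _ (fun j t =>
  a j * logcut (expR (- J%:R)) (P j (x + circle c rho t *: y)))) => j.
by apply: continuous_circle_term => //; rewrite expR_gt0.
Qed.

Lemma logsum_submean J (x y : Cspace R n) (c : C) (rho : R) : 0 < rho ->
  2 * pi * logsum J (x + c *: y) <=
    Rintegral leb `[0, 2 * pi] (fun t => logsum J (x + circle c rho t *: y)).
Proof.
move=> rho0; rewrite /logsum.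
(* The cutoff is generalised so that it stays fixed during the induction on the number of terms. *)
move: (expR (- J%:R)) (expR_gt0 (- J%:R : R)) => d d0.
elim: J => [|k IH].
  rewrite big_ord0 mulr0; under eq_Rintegral do rewrite big_ord0.
  by rewrite Rintegral_cst// mul0r.
rewrite big_ord_recr/= mulrDr.
under eq_Rintegral do rewrite big_ord_recr/=.
rewrite RintegralD//; last 2 first.
- apply: continuous_integrable_itv; apply: (@continuous_sum_ord _ _ _ (fun j t =>
    a j * logcut d (P j (x + circle c rho t *: y)))) => j.
  exact: continuous_circle_term.
- by apply: continuous_integrable_itv; exact: continuous_circle_term.
rewrite lerD//; have [q Pq] := P_line x y k.
under eq_Rintegral do rewrite Pq.
rewrite RintegralZl//; last first.
  by apply: continuous_integrable_itv; exact: continuous_circle_logcut.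
by rewrite mulrCA ler_wpM2l ?(ltW (a_gt0 _))// Pq; exact: logcut_submean.
Qed.

Lemma loglim_cvg (N : nat) x : rnorm x <= N%:R ->
  (logsum (N + J) x)%:E @[J --> \oo] --> loglim x.
Proof.
move=> xN; rewrite /loglim.
have -> : ereal_inf [set (logsum J x)%:E | J in [set J : nat | rnorm x <= J%:R]] =
    ereal_inf (range (fun J => (logsum (N + J) x)%:E)).
  apply/eqP; rewrite eq_le; apply/andP; split; apply: le_ereal_inf_tmp.
    move=> _ [J _ <-]; apply: ereal_inf_lbound; exists (N + J)%N => //=.
    by rewrite (le_trans xN)// ler_nat leq_addr.
  move=> _ [J /= xJ <-]; apply: ge_ereal_inf; exists (logsum (N + J) x)%:E.
    by exists J.
  by rewrite lee_fin logsum_nonincreasing// leq_addl.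
apply: ereal_nonincreasing_cvgn => J J' JJ'; rewrite lee_fin.
rewrite logsum_nonincreasing ?leq_add2l// (le_trans xN)// ler_nat leq_addr//.
Qed.

(** The inequality for [logsum (N + J)] passes to the limit by monotone convergence, applied to the
    nonnegative increasing differences [g J], where [N] bounds the norm on the whole circle. If the
    left side is [-oo] there is nothing to show. *)
Lemma loglim_submean (x y : Cspace R n) (c : C) (rho : R) : 0 < rho ->
  (loglim (x + c *: y) <= ((2 * pi)^-1)%:E *
     \int[leb]_(t in `[0%R, (2 * pi)%R]) loglim (x + circle c rho t *: y))%E.
Proof.
move=> rho0; pose I : set (measurableTypeR R) := `[0, 2 * pi]%classic.
have pi2 : 0 < 2 * pi :> R by rewrite mulr_gt0// pi_gt0.
have muI : leb I = (2 * pi)%:E.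
  by rewrite /I lebesgue_measure_itv/= lte_fin pi2 sube0.
pose X (t : R) := x + circle c rho t *: y.
have [N XN cN] : exists2 N : nat, (forall t, rnorm (X t) <= N%:R) &
    rnorm (x + c *: y) <= N%:R.
  pose B := rnorm x + (rnorm c + rho) * rnorm y.
  exists (Num.truncn B).+1 => [t|]; apply: le_trans (ltW (truncnS_gt B)).
    rewrite (le_trans (rnormD _ _))// lerD2l rnormZ ler_wpM2r ?rnorm_ge0//.
    rewrite circleE (le_trans (rnormD _ _))// lerD2l rnormM rnorm_cis mulr1.
    by rewrite rnorm_real gtr0_norm.
  rewrite (le_trans (rnormD _ _))// lerD2l rnormZ ler_wpM2r ?rnorm_ge0//.
  by rewrite lerDl ltW.
case phicE : (loglim (x + c *: y)) => [phic| |]; [|exfalso|by rewrite leNye].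
  2: by have := loglim_lt_pinfty (x + c *: y); rewrite phicE.
have mI : measurable I by exact: measurable_itv.
have cX J : continuous (fun t => logsum J (X t)) by exact: continuous_circle_logsum.
have iX J : leb.-integrable I (fun t => (logsum J (X t))%:E).
  exact: continuous_integrable_itv (cX J).
pose g J (t : measurableTypeR R) : \bar R := (logsum N (X t) - logsum (N + J) (X t))%:E.
pose h (t : measurableTypeR R) : \bar R := ((logsum N (X t))%:E - loglim (X t))%E.
have ig J : leb.-integrable I (g J).
  rewrite (_ : g J = (fun t => (logsum N (X t))%:E - (logsum (N + J) (X t))%:E)%E).
    exact: integrableB.
  by apply/funext => t; rewrite /g EFinB.
have mg J := measurable_int _ (ig J).
have g0 J t : (0 <= g J t)%E.
  by rewrite lee_fin subr_ge0; exact: logsum_nonincreasing (XN t) (leq_addr _ _).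
have ndg t : nondecreasing_seq (g^~ t).
  move=> J J' JJ'; rewrite lee_fin lerD2l lerN2 logsum_nonincreasing ?leq_add2l//.
  by rewrite (le_trans (XN t))// ler_nat leq_addr.
have gh t : g J t @[J --> \oo] --> h t.
  rewrite /g /h; under eq_fun do rewrite EFinB.
  have d0 : ((logsum N (X t))%:E +? - loglim (X t))%E by exact: fin_num_adde_defr.
  exact: (@cvgeB nat \oo _ R (fun=> (logsum N (X t))%:E)
    (fun J => (logsum (N + J) (X t))%:E) _ _ d0 (@cvg_cst _ _ _ _ _) (@loglim_cvg N (X t) (XN t))).
pose A := Rintegral leb I (fun t => logsum N (X t)).
have AE : (\int[leb]_(t in I) (logsum N (X t))%:E = A%:E)%E.
  by rewrite /A /Rintegral fineK//; exact: integrable_fin_num.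
have hA : (\int[leb]_(t in I) h t <= (A - 2 * pi * phic)%:E)%E.
  have -> : (\int[leb]_(t in I) h t = \int[leb]_(t in I) (limn (g^~ t)))%E.
    by apply: eq_integral => t _; apply/esym/cvg_lim => //; exact: gh.
  rewrite monotone_convergence//; apply: lime_le.
    apply: ereal_nondecreasing_is_cvgn => J J' JJ'.
    by apply: ge0_le_integral => // t _; exact: ndg.
  near=> J; rewrite /g; under eq_integral do rewrite EFinB.
  rewrite integralB// AE.
  rewrite (_ : (\int[leb]_(t in I) (logsum (N + J) (X t))%:E)%E =
    (Rintegral leb I (fun t => logsum (N + J) (X t)))%:E); last first.
    by rewrite /Rintegral fineK//; exact: integrable_fin_num.
  rewrite -EFinB lee_fin lerD2l lerN2.
  apply: le_trans (logsum_submean (N + J) x y c rho0).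
  rewrite ler_pM2l// -lee_fin -phicE loglim_le// (le_trans cN)//.
  by rewrite ler_nat leq_addr.
have h0 t : (0 <= h t)%E.
  by rewrite -(cvg_lim _ (gh t))//; apply: lime_ge; [exact: cvgP (gh t)|near=> J].
have mh := measurable_realfun.emeasurable_fun_cvg g h mg (fun t _ => gh t).
(* The bound [hA], finite because the value at the centre is, makes [h] integrable, so that the
   integral of the difference splits. *)
have ih : leb.-integrable I h.
  apply/integrableP; split => //; apply: le_lt_trans (ltry (A - 2 * pi * phic)).
  by apply: le_trans hA; under eq_integral do rewrite gee0_abs//.
have -> : (\int[leb]_(t in `[0%R, (2 * pi)%R]) loglim (x + circle c rho t *: y) =
    \int[leb]_(t in I) ((logsum N (X t))%:E - h t))%E.
  by apply: eq_integral => t _; exact: sub_sube (loglim_lt_pinfty (X t)).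
rewrite integralB// AE -(fineK (integrable_fin_num _ ih))//.
move: hA; rewrite -{1}(fineK (integrable_fin_num _ ih))// lee_fin => hA.
rewrite -EFinB -EFinM lee_fin mulrC ler_pdivlMr//.
by move: hA; lra.
Unshelve. all: by end_near. Qed.

Lemma psh_loglim : psh loglim.
Proof.
split; [exact: loglim_lt_pinfty|exact: lower_semicontinuous_loglim|].
move=> x y; split; first by move=> z; exact: loglim_lt_pinfty.
  move=> z t /lower_semicontinuous_loglim[V xV tV].
  exists [set z' | V (x + z' *: y)] => [|z']; last exact: tV.
  move: xV => /nbhs_rnormP[d d0 dV]; apply/nbhs_rnormP.
  have y0 : 0 < rnorm y + 1 by rewrite ltr_wpDl ?rnorm_ge0.
  exists (d / (rnorm y + 1)) => [|z' zz']; first by rewrite divr_gt0.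
  apply: dV; rewrite opprD addrACA subrr add0r -scalerBl rnormZ.
  rewrite (@le_lt_trans _ _ (rnorm (z - z') * (rnorm y + 1)))//.
    by rewrite ler_wpM2l ?rnorm_ge0// lerDl.
  by rewrite -ltr_pdivlMr.
by move=> c rho rho0; exact: loglim_submean.
Qed.

End psh_limit.

(** * Monic polynomials on a set that is not pluripolar *)

Section nonpluripolar.
Context {R : realType} {n : nat}.
Local Notation C := (R[i])^o.

(** Real and imaginary parts of each coordinate are found separately, as suprema of left endpoints
    of nested intervals. Adding the two errors gives [rho j *+ 2], the radius that appears in
    [stage]. *)
Lemma nested_boxes (z : nat -> Cspace R n) (rho : nat -> R) :
  (forall j, rnorm (z j.+1 - z j) + rho j.+1 <= rho j) -> (forall j, 0 < rho j) ->
  exists x, forall j, rnorm (x - z j) <= rho j *+ 2.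
Proof.
move=> znest rho0.
have reals (f : C -> R) : (forall a b : C, `|f a - f b| <= rnorm (a - b)) ->
    forall k, exists t : R, forall j, `|t - f (z j 0 k)| <= rho j.
  move=> f1 k.
  have step j : `|f (z j.+1 0 k) - f (z j 0 k)| + rho j.+1 <= rho j.
    apply: le_trans (znest j); rewrite lerD2r; apply: le_trans (f1 _ _) _.
    have := (rnorm_row_le (z j.+1 - z j) (rnorm_ge0 _)).1 (lexx _) k.
    by rewrite !mxE.
  have nest i j : (i <= j)%N -> f (z i 0 k) - rho i <= f (z j 0 k) - rho j /\
      f (z j 0 k) + rho j <= f (z i 0 k) + rho i.
    elim: j => [|j IH]; first by rewrite leqn0 => /eqP ->.
    rewrite leq_eqVlt => /orP[/eqP->//|/IH[h1 h2]].
    by have := step j; have := ler_norm (f (z j.+1 0 k) - f (z j 0 k));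
       have := ler_norm (f (z j 0 k) - f (z j.+1 0 k)); rewrite distrC; lra.
  have le i j : f (z i 0 k) - rho i <= f (z j 0 k) + rho j.
    have := rho0 i; have := rho0 j.
    by have [/nest[]|/ltnW/nest[]] := leqP i j; lra.
  pose S := [set f (z j 0 k) - rho j | j in [set: nat]].
  have hS : has_sup S.
    split; first by exists (f (z 0%N 0 k) - rho 0%N), 0%N.
    by exists (f (z 0%N 0 k) + rho 0%N) => _ [j _ <-].
  exists (sup S) => j; rewrite ler_distl; apply/andP; split.
    by apply: sup_upper_bound => //; exists j.
  by apply: sup_le_ub => [|_ [i _ <-]]; [exact: hS.1|exact: le].
have [|re reP] := choice (reals (@complex.Re R) _).
  by move=> a b; apply: le_trans (normr_Re_le _); case: a b => ? ? [].
have [|im imP] := choice (reals (@complex.Im R) _).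
  by move=> a b; apply: le_trans (normr_Im_le _); case: a b => ? ? [].
exists (\row_k ((re k +i* im k)%C : C)) => j.
apply/rnorm_row_le => [|k]; first by rewrite mulrn_wge0// ltW.
rewrite !mxE (le_trans (rnorm_le_ReIm _))// mulr2n lerD//.
  by apply: le_trans (reP k j); case: (z j 0 k).
by apply: le_trans (imP k j); case: (z j 0 k).
Qed.

Variable K : set (Cspace R n).

(* A step of a Baire-type construction: [a * ln |P|] is at most [-1] on [K] and at
   least [- 2^-j] near the centre [z'] of the next ball, so the sum of these
   functions is [-oo] on [K] and finite at a common point of the nested balls. *)
Definition stage (j : nat) (z : Cspace R n) (rho : R) (P : Cspace R n -> R[i])
    (a : R) (z' : Cspace R n) (rho' : R) : Prop :=
  [/\ [/\ exists r, mspan (degle r) P, 0 < a, 0 < rho' &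
         rnorm (z' - z) + rho' <= rho],
      forall x, rnorm x <= j%:R -> rnorm (P x : C) <= 1,
      forall x, K x -> rnorm (P x : C) <= expR (- a^-1) &
      forall x, rnorm (x - z') <= rho' *+ 2 ->
        expR (- (2^-1 ^+ j / a)) <= rnorm (P x : C)].

(** With [m] the supremum of [|p|] on the ball of radius [rho / 2], Bernstein-Walsh bounds [|p|] by
    [m S^r] on a large ball. This number is at least 1 because [p] is monic, so dividing by it makes
    [p] at most 1 there and no larger on [K]; yet the quotient stays above [1 / (4 S^r)] near a
    point where [|p| > m / 2]. *)
Lemma pluripolar_step (j : nat) (z : Cspace R n) (rho : R) : 0 < rho ->
  (forall c : R, 0 < c -> exists r b (p : Cspace R n -> R[i]),
    [/\ (0 < r)%N, degle r b, lead r b p & forall x, K x -> rnorm (p x : C) < c ^+ r]) ->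
  exists P a z' rho', stage j z rho P a z' rho'.
Proof.
move=> rho0 small.
(* The ball of radius [E * (rho / 2)] about [z] contains the one of radius [j + 1] about 0; the
   extra 1 keeps the unit torus inside also for [j = 0]. *)
pose E : R := 1 + (j%:R + rnorm z + 1) / (rho / 2).
have rho20 : 0 < rho / 2 by rewrite divr_gt0.
have E1 : 1 <= E.
  by rewrite lerDl divr_ge0 ?(ltW rho20)// !addr_ge0 ?rnorm_ge0.
have zE x : rnorm x <= j%:R + 1 -> rnorm (x - z) <= E * (rho / 2).
  move=> xj; rewrite /E mulrDl mul1r divfK ?gt_eqF//.
  by have := rnormD x (- z); rewrite rnormN; move: xj (ltW rho20); lra.
pose S := 2 * E; have S2 : 2 <= S by rewrite /S; lra.
have S0 : 0 < S by lra.
(* Chosen so that [(4 S)^-r], a lower bound for the normalised polynomial near [z'], equals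
   [exp (- 2^-j r / a)]; the coefficient of its logarithm will be [a / r]. *)
pose a : R := 2^-1 ^+ j / ln (4 * S).
have lnS0 : 0 < ln (4 * S) by rewrite ln_gt0//; lra.
have a0 : 0 < a by rewrite divr_gt0// exprn_gt0.
have [r [b [p [r0 br pb pK]]]] := small (expR (- a^-1)) (expR_gt0 _).
have pr := lead_mspan br pb.
have r0' : 0 < r%:R :> R by rewrite ltr0n.
have Sr0 : 0 < S ^+ r by rewrite exprn_gt0.
pose A := [set rnorm (p x : C) | x in [set x | rnorm (x - z) <= rho / 2]].
pose m := sup A.
have hA : has_sup A.
  split.
    by exists (rnorm (p z : C)), z => //=; rewrite subrr rnorm0 ltW.
  have [M M0 pM] := mspan_bounded (j%:R + 1 + rnorm z + rho) pr.
  exists M => _ [x /= xz <-]; apply: pM.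
  have := rnormD (x - z) z; rewrite subrK.
  have : (0 : R) <= j%:R by []. by move: xz rho0; lra.
have pm x : rnorm (x - z) <= rho / 2 -> rnorm (p x : C) <= m.
  by move=> xz; apply: sup_upper_bound => //; exists x.
have pS x : rnorm x <= j%:R + 1 -> rnorm (p x : C) <= m * S ^+ r.
  by move=> /zE; exact: bernstein_walsh pr rho20 E1 pm x.
have mS1 : 1 <= m * S ^+ r.
  have [t t1 pt] := lead_torus br pb; apply: le_trans pt (pS _ _).
  by rewrite (le_trans t1)// lerDr.
have m0 : 0 < m.
  by rewrite -(pmulr_lgt0 _ Sr0) (lt_le_trans ltr01 mS1).
have [_ [z' /= z'z <-] mz'] : exists2 y, A y & m / 2 < y.
  by apply: sup_gt => //; [exact: hA.1|rewrite -/m; lra].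
have [d d0 dP] : exists2 d : R, 0 < d &
    forall x, rnorm (z' - x) < d -> m / 4 < rnorm (p x : C).
  apply/(nbhs_rnormP z' (fun x => m / 4 < rnorm (p x : C))).
  apply: (@continuous_comp _ _ _ (p : _ -> C) (@rnorm R C) z' _ _
    [set y | m / 4 < y]).
  - exact: mspan_continuous pr z'.
  - exact: continuous_rnorm.
  - by apply: lt_nbhsr; move: mz' m0; lra.
pose k : R := (m * S ^+ r)^-1.
have k0 : 0 < k by rewrite invr_gt0 (lt_le_trans ltr01 mS1).
(* [rho / 2] keeps the new ball inside the old one; with [d / 4] even the doubled ball stays where
   [|p| > m / 4]. *)
pose rho' := Num.min (rho / 2) (d / 4).
have rho'0 : 0 < rho' by rewrite /rho' lt_min rho20 divr_gt0.
exists (fun x => ((k%:C)%C : R[i]) * p x), (a / r%:R), z', rho'.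
have kp x : rnorm (((k%:C)%C : R[i]) * p x : C) = k * rnorm (p x : C).
  by rewrite rnormM rnorm_real gtr0_norm.
split; [split|..].
- by exists r; exact: mspan_scale.
- by rewrite divr_gt0.
- exact: rho'0.
- have : rho' <= rho / 2 by rewrite /rho' ge_min lexx.
  by move: z'z; lra.
- move=> x xj; rewrite kp mulrC ler_pdivrMr ?mul1r ?(lt_le_trans ltr01 mS1)//.
  by apply: pS; rewrite (le_trans xj)// lerDl.
- move=> x Kx; rewrite kp invf_div -mulrN expRM_natl.
  apply: (@le_trans _ _ (rnorm (p x : C))); last exact: ltW (pK x Kx).
  by rewrite ler_piMl ?rnorm_ge0// invf_le1// (lt_le_trans ltr01 mS1).
- move=> x xz'; rewrite kp.
  have xd : m / 4 < rnorm (p x : C).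
    apply: dP; rewrite rnormB (le_lt_trans xz')//.
    have : rho' <= d / 4 by rewrite /rho' ge_min lexx orbT.
    by move: d0; rewrite mulr2n; lra.
  apply: (@le_trans _ _ (k * (m / 4))); last by rewrite ler_pM2l// ltW.
  have -> : - (2^-1 ^+ j / (a / r%:R)) = - (ln (4 * S) * r%:R).
    congr (- _); rewrite /a; field; rewrite !gt_eqF ?exprn_gt0//=.
  have -> : expR (- (ln (4 * S) * r%:R)) = (4 ^+ r * S ^+ r)^-1.
    by rewrite expRN mulrC expRM_natl lnK ?exprMn// posrE mulr_gt0.
  have -> : k * (m / 4) = (4 * S ^+ r)^-1.
    by rewrite /k; field; rewrite !gt_eqF.
  rewrite lef_pV2 ?posrE ?mulr_gt0 ?exprn_gt0//.
  by rewrite ler_pM2r// -[leLHS](expr1 4) ler_weXn2l// ler1n.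
Qed.

(** By contraposition: if every [c] fails, [pluripolar_step] can be iterated for ever, and the
    resulting [loglim] exhibits [K] as pluripolar. *)
Lemma nonpluripolar_lead_ge : ~ pluripolar K ->
  exists2 c : R, 0 < c & forall r b (p : Cspace R n -> R[i]),
    (0 < r)%N -> degle r b -> lead r b p ->
    exists2 x, K x & c ^+ r <= rnorm (p x : C).
Proof.
move=> Knp; apply: contrapT => h; apply: Knp.
have small (c : R) : 0 < c -> exists r b (p : Cspace R n -> R[i]),
    [/\ (0 < r)%N, degle r b, lead r b p &
      forall x, K x -> rnorm (p x : C) < c ^+ r].
  move=> c0; apply: contrapT => h'; apply: h; exists c => // r b p r0 br pb.
  apply: contrapT => h; apply: h'; exists r, b, p; split => // x Kx.
  by rewrite ltNge; apply/negP => cp; apply: h; exists x.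
pose St := (Cspace R n * R)%type.
pose Q (js : nat * St) (t : (Cspace R n -> R[i]) * R * St) :=
  0 < js.2.2 -> stage js.1 js.2.1 js.2.2 t.1.1 t.1.2 t.2.1 t.2.2.
have [|f fP] := @choice _ _ Q.
  move=> [j [z rho]]; rewrite /Q/=.
  (* A dummy value for [rho <= 0] makes the choice function total; the iteration keeps its radii
     positive. *)
  have [rho0|_] := ltP 0 rho; last by exists (fun=> 0, 0, (0, 0)).
  have [P [a [z' [rho' h']]]] := pluripolar_step j z rho0 small.
  by exists (P, a, (z', rho')).
pose st := fix st j : St := if j is j'.+1 then (f (j', st j')).2 else (0, 1).
have st0 j : 0 < (st j).2.
  by elim: j => [|j IH] //=; have [[]] := fP (j, st j) IH.
pose P j := (f (j, st j)).1.1; pose a j := (f (j, st j)).1.2.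
have FP j : stage j (st j).1 (st j).2 (P j) (a j) (st j.+1).1 (st j.+1).2.
  exact: fP (j, st j) (st0 j).
have P_poly j : exists r, mspan (degle r) (P j) by have [[]] := FP j.
have a0 j : 0 < a j by have [[]] := FP j.
have P1 j x : rnorm x <= j%:R -> rnorm (P j x : C) <= 1.
  by have [_ + _ _] := FP j; exact.
have [|zs zsP] := @nested_boxes (fun j => (st j).1) (fun j => (st j).2) _ st0.
  by move=> j; have [[]] := FP j.
exists (loglim P a); split; first exact: psh_loglim.
  exists zs; suff : ((- 2)%:E <= loglim P a zs)%E by move=> /[swap] ->.
  apply: le_ereal_inf_tmp => _ [J /= _ <-]; rewrite lee_fin.
  (* [zs] lies in every doubled ball, so the [j]-th term is at least [- 2^-j] and the partial sums
     stay above [- 2]. *)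
  apply: (@le_trans _ _ (\sum_(j < J) - 2^-1 ^+ j)).
    rewrite sumrN lerN2; have := @subrX1 R 2^-1 J.
    have : 0 < 2^-1 ^+ J :> R by rewrite exprn_gt0// invr_gt0.
    set s := \sum_(_ < _) _; lra.
  apply: ler_sum => j _; rewrite -ler_pdivrMl// mulrC mulNr.
  rewrite /logcut -[leLHS]expRK ler_ln ?posrE ?expR_gt0 ?lt_max ?expR_gt0 ?orbT//.
  by rewrite le_max; have [_ _ _ ->//] := FP j.
move=> x Kx; apply: eq_ninfty => t.
pose m := (Num.truncn `|t|).+1.
(* Once [J] dominates [1 / a j] for all [j < m], the cutoff [e^-J] lies below [e^(-1 / a j)] and
   each of these [m] terms is at most [- 1]; the remaining terms are nonpositive. *)
have [L La] : exists L : nat, forall j, (j < m)%N -> (a j)^-1 <= L%:R.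
  elim: m => [|m [L La]]; first by exists 0%N.
  exists (maxn L (Num.truncn (a m)^-1).+1) => j; rewrite ltnS leq_eqVlt.
  move=> /orP[/eqP ->|/La/le_trans]; last by apply; rewrite ler_nat leq_maxl.
  apply: ltW; apply: lt_le_trans (truncnS_gt _) _; by rewrite ler_nat leq_maxr.
pose J := maxn (Num.truncn (rnorm x)).+1 (maxn L m).
apply: (le_trans (loglim_le P a (_ : rnorm x <= J%:R))).
  by rewrite ltW// (lt_le_trans (truncnS_gt _))// ler_nat leq_maxl.
rewrite lee_fin.
have term j : (j < J)%N -> a j * logcut (expR (- J%:R)) (P j x) <=
    if (j < m)%N then - 1 else 0.
  move=> jJ; have [_ _ /(_ _ Kx) Pj _] := FP j.
  case: ifPn => jm.
    have aV : (a j)^-1 <= J%:R.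
      by rewrite (le_trans (La j jm))// ler_nat /J !leq_max leqnn orbT.
    rewrite -ler_pdivlMl// mulrN1 /logcut -[leRHS]expRK.
    rewrite ler_ln ?posrE ?expR_gt0 ?lt_max ?expR_gt0 ?orbT//.
    by rewrite ge_max Pj ler_expR lerN2.
  have e1 (s : R) : 0 <= s -> expR (- s) <= 1.
    by move=> s0; rewrite -expR0 ler_expR oppr_le0.
  rewrite pmulr_rle0// logcut_le0 ?e1//.
  by apply: le_trans Pj (e1 _ _); rewrite invr_ge0 ltW.
apply: (@le_trans _ _ (\sum_(j < J) (if (j < m)%N then - 1 else 0 : R))).
  by apply: ler_sum => j _; exact: term.
have mJ : (m <= J)%N by rewrite /J !leq_max leqnn !orbT.
rewrite -big_mkcond -(big_ord_widen J (fun=> - 1 : R) mJ) sumr_const card_ord.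
rewrite mulNrn lerNl; have := truncnS_gt `|t|; rewrite -/m => tm.
by rewrite (le_trans (ler_norm _))// normrN ltW.
Qed.

End nonpluripolar.

(** * Averages of subadditive functions of multi-indices *)

Section multiindex_lists.
Variable n : nat.
Local Notation mi := {ffun 'I_n -> nat}.

Definition natffun k (b : {ffun 'I_n -> 'I_k}) : mi := [ffun i => b i : nat].

Lemma natffun_inj k : injective (@natffun k).
Proof.
move=> b c /ffunP bc; apply/ffunP => i; apply: val_inj.
by have := bc i; rewrite !ffunE.
Qed.

Definition midx r : seq mi :=
  map (@natffun r.+1) (seq.filter (fun b : {ffun 'I_n -> 'I_r.+1} =>
    (\sum_j b j <= r)%N) (enum {: {ffun 'I_n -> 'I_r.+1}})).

Definition box k : seq mi := map (@natffun k) (enum {: {ffun 'I_n -> 'I_k}}).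

Lemma midx_uniq r : uniq (midx r).
Proof.
rewrite map_inj_uniq; last exact: natffun_inj.
by rewrite filter_uniq// enum_uniq.
Qed.

Lemma box_uniq k : uniq (box k).
Proof. by rewrite map_inj_uniq; [rewrite enum_uniq|exact: natffun_inj]. Qed.

Lemma size_box k : size (box k) = (k ^ n)%N.
Proof. by rewrite size_map -cardT card_ffun !card_ord. Qed.

Lemma mem_midx r b : (b \in midx r) = (mdegree b <= r)%N.
Proof.
have dE k (c : {ffun 'I_n -> 'I_k}) : mdegree (natffun c) = (\sum_j c j)%N.
  by apply: eq_bigr => j _; rewrite ffunE.
apply/mapP/idP => [[c]|br]; first by rewrite mem_filter -dE => /andP[h _] ->.
have bE i : (inord (b i) : 'I_r.+1) = b i :> nat.
  by rewrite inordK// ltnS (leq_trans (leq_mdegree _ _)).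
exists [ffun i => inord (b i)]; last by apply/ffunP => i; rewrite !ffunE bE.
rewrite mem_filter mem_enum andbT; apply: leq_trans br.
by apply: leq_sum => i _; rewrite ffunE bE.
Qed.

Lemma mem_box k b : b \in box k -> forall i, (b i < k)%N.
Proof. by move=> /mapP[c _ ->] i; rewrite ffunE. Qed.

Definition comb k (c d : mi) : mi := c *+ k + d.

Lemma combE k c d i : comb k c d i = (c i * k + d i)%N.
Proof.
rewrite /comb ffunE; congr (_ + _)%N.
by elim: k => [|k IH]; rewrite ?mulr0n ?ffunE ?muln0// mulrS ffunE IH mulnS.
Qed.

Lemma mdegreeMn k (c : mi) : mdegree (c *+ k) = (k * mdegree c)%N.
Proof.
elim: k => [|k IH]; last by rewrite mulrS mdegreeD IH mulSn.
by rewrite mulr0n /mdegree big1// => i _; rewrite ffunE.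
Qed.

Lemma mdegree_box k (d : mi) : d \in box k -> (mdegree d <= n * k)%N.
Proof.
move=> dk; rewrite /mdegree (leq_trans (leq_sum _ (fun i _ => ltnW (mem_box dk i))))//.
by rewrite sum_nat_const card_ord.
Qed.

Definition combs k s := [seq comb k c d | c <- midx s, d <- box k].

(** Euclidean division by [k] in each coordinate recovers the pair: the entries of a box are
    remainders. *)
Lemma combs_uniq k s : uniq (combs k s).
Proof.
apply: allpairs_uniq; [exact: midx_uniq|exact: box_uniq|].
move=> [c d] [c' d'] /allpairsP[[x y] /= [_ yk [-> ->]]].
move=> /allpairsP[[x' y'] /= [_ y'k [-> ->]]] /ffunP e.
have h i : x i = x' i /\ y i = y' i.
  have := e i; have := mem_box yk i; have := mem_box y'k i; rewrite !combE => h1 h2 h3.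
  have k0 : (0 < k)%N by exact: leq_ltn_trans h1.
  have := congr1 (modn^~ k) h3; rewrite !modnMDl !modn_small// => yy.
  split => //; move: h3; rewrite yy => /addIn /eqP.
  by rewrite eqn_pmul2r// => /eqP.
by congr pair; apply/ffunP => i; have [] := h i.
Qed.

Lemma combs_sub k s r : (k * (s + n) <= r)%N -> {subset combs k s <= midx r}.
Proof.
move=> kr _ /allpairsP[[c d] /= [+ /mdegree_box dk ->]].
rewrite !mem_midx mdegreeD mdegreeMn => cs.
by apply: leq_trans kr; rewrite mulnDr leq_add// ?leq_mul2l ?cs ?orbT// mulnC.
Qed.

Lemma polydim_gt0 r : (0 < polydim n r)%N.
Proof. by rewrite bin_gt0 leq_addr. Qed.

(** Multiplied by [n!], the dimension is the product of the [n] factors [r + 1, ..., r + n], each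
    between [r] and [n + r]; this gives both this bound and the next one. *)
Lemma polydim_ge r : (r ^ n <= polydim n r * n`!)%N.
Proof.
rewrite /polydim bin_ffact; elim: n => [|m IH]; first by rewrite expn0.
by rewrite addSn ffactSS expnS leq_mul// -addSn leq_addl.
Qed.

Lemma polydim_le r : (polydim n r * n`! <= (n + r) ^ n)%N.
Proof.
rewrite /polydim bin_ffact; move: (n + r)%N; elim: n => [|m IH] a; first by rewrite expn0.
rewrite ffactnS expnS leq_mul//; apply: leq_trans (IH _) _.
by case: m {IH} => [|m]; rewrite ?expn0// leq_exp2r ?leq_pred.
Qed.

End multiindex_lists.

Section subadditive_average.
Context {R : realType} (n : nat).
Local Notation mi := {ffun 'I_n -> nat}.
Variables (a : nat -> mi -> R) (c : R).
Hypothesis size_midx : forall r, size (midx n r) = polydim n r.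
Hypothesis a_sub : forall r r' (b b' : mi), degle r b -> degle r' b' ->
  a (r + r')%N (b + b') <= a r b + a r' b'.
Hypothesis a_bound : forall r b, degle r b -> `|a r b| <= c * r%:R.

Local Notation m r := ((polydim n r)%:R : R).

Definition degsum r : R := \sum_(b <- midx n r) a r b.
Definition average r : R := degsum r / (r%:R * m r).

Lemma c_ge0 : 0 <= c.
Proof.
have := a_bound (_ : degle 1 (0 : mi)); rewrite mulr1 => /(_ _)/(le_trans _)-> //.
by rewrite /degle/= /mdegree big1// => i _; rewrite ffunE.
Qed.

Lemma a_muln k s b : (0 < k)%N -> degle s b -> a (k * s)%N (b *+ k) <= k%:R * a s b.
Proof.
case: k => // k _ bs; elim: k => [|k IH]; first by rewrite mul1n mulr1n mul1r.
rewrite mulSn mulrS -natr1 [_ + 1]addrC mulrDl mul1r.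
apply: le_trans (a_sub bs (_ : degle (k.+1 * s) (b *+ k.+1))) _.
  by rewrite /degle mdegreeMn leq_mul2l bs orbT.
by rewrite lerD2l.
Qed.

Lemma a_comb k s r b d : (0 < k)%N -> (k * (s + n) <= r)%N ->
  b \in midx n s -> d \in box n k ->
  a r (comb k b d) <= k%:R * a s b + c * (r%:R - (k * s)%:R).
Proof.
move=> k0 kr; rewrite mem_midx => bs dk.
have ksr : (k * s <= r)%N by apply: leq_trans kr; rewrite leq_mul2l leq_addr orbT.
have dr : degle (r - k * s) d.
  by have := mdegree_box dk; rewrite /degle; move: kr; rewrite mulnDr; lia.
rewrite -{1}(subnKC ksr) -natrB//.
apply: le_trans (a_sub _ dr) _; first by rewrite /degle mdegreeMn leq_mul2l bs orbT.
by rewrite lerD ?a_muln// (le_trans (ler_norm _))// a_bound.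
Qed.

(* The multi-indices [k b + d], with [|b| <= s] and [d] in the box of side [k], are
   distinct; for [s] large and [k] close to [r / s] they are most of those of degree
   at most [r], and on the others [a] is bounded by [c * r]. *)
Lemma degsum_le k s r : (0 < k)%N -> (k * (s + n) <= r)%N ->
  degsum r <= (k ^ n)%:R * (k%:R * degsum s) +
    (k ^ n)%:R * m s * (c * (r%:R - (k * s)%:R)) +
    c * r%:R * (m r - (k ^ n)%:R * m s).
Proof.
move=> k0 kr; pose G := combs n k s.
have sizeG : size G = (k ^ n * polydim n s)%N.
  by rewrite size_allpairs size_midx size_box mulnC.
have Gr := combs_sub kr.
have pG : perm_eq [seq b <- midx n r | b \in G] G.
  apply: uniq_perm; rewrite ?filter_uniq ?midx_uniq ?combs_uniq// => b.
  by rewrite mem_filter andb_idr// => /Gr.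
rewrite /degsum -(perm_big _ (permEl (perm_filterC (mem G) (midx n r)))) /= big_cat/=.
rewrite lerD//.
  rewrite [X in X <= _](_ : _ = \sum_(b <- G) a r b); last exact: perm_big.
  rewrite /G /combs big_allpairs_dep.
  apply: (@le_trans _ _ (\sum_(b <- midx n s)
      (k ^ n)%:R * (k%:R * a s b + c * (r%:R - (k * s)%:R)))).
    rewrite !big_seq; apply: ler_sum => b bs.
    apply: (@le_trans _ _ (\sum_(d <- box n k) (k%:R * a s b + c * (r%:R - (k * s)%:R)))).
      by rewrite !big_seq; apply: ler_sum => d dk; exact: a_comb.
    by rewrite big_const_seq count_predT iter_addr_0 size_box -[leLHS]mulr_natl.
  rewrite -mulr_sumr big_split/= -mulr_sumr big_const_seq count_predT iter_addr_0.
  rewrite size_midx -[c * _ *+ _]mulr_natl le_eqVlt; apply/orP; left.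
  by apply/eqP; ring.
apply: (@le_trans _ _ (\sum_(b <- [seq b <- midx n r | predC (mem G) b]) c * r%:R)).
  rewrite !big_seq; apply: ler_sum => b; rewrite mem_filter mem_midx => /andP[_ br].
  by rewrite (le_trans (ler_norm _))// a_bound.
rewrite big_const_seq count_predT iter_addr_0 -[leLHS]mulr_natr ler_wpM2l ?mulr_ge0 ?c_ge0//.
rewrite size_filter -(size_midx r) -(count_predC (mem G) (midx n r)).
have := perm_size pG; rewrite size_filter sizeG => ->.
by rewrite natrD natrM addrAC subrr add0r.
Qed.

Lemma average_bound r : `|average r| <= c.
Proof.
have mr0 : 0 < m r by rewrite ltr0n polydim_gt0.
have tr : `|degsum r| <= c * (r%:R * m r).
  rewrite /degsum (le_trans (ler_norm_sum _ _ _))//.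
  apply: (@le_trans _ _ (\sum_(b <- midx n r) c * r%:R)).
    by rewrite !big_seq; apply: ler_sum => b; rewrite mem_midx => /a_bound.
  by rewrite big_const_seq count_predT iter_addr_0 size_midx -[leLHS]mulr_natr mulrA.
rewrite /average; case: r mr0 tr => [|r] mr0 tr.
  by rewrite mul0r invr0 mulr0 normr0 c_ge0.
by rewrite normrM normfV [`|_ * m _|]gtr0_norm ?mulr_gt0// ler_pdivrMr ?mulr_gt0.
Qed.

Lemma one_sub_exprn_le (y : R) k : 0 <= y <= 1 -> 1 - y ^+ k <= k%:R * (1 - y).
Proof.
move=> /andP[y0 y1]; elim: k => [|k IH]; first by rewrite expr0 subrr mul0r.
rewrite exprS -natr1 mulrDl mul1r.
have : 0 <= y ^+ k <= 1 by rewrite exprn_ge0// exprn_ile1.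
by move: IH; nra.
Qed.

(** Divided by [r m_r], [degsum_le] bounds [average r] by [x q] times [average s] plus
    [c q (1 - x) + c (1 - q) = c (1 - x q)]. Replacing [x q] by 1 in front of [average s] costs
    another [c (1 - x q)], whence the factor [2 c]. *)
Lemma average_le s r : (0 < s)%N -> (s * (s + n) <= r)%N ->
  average r <= average s + 2 * c * (n.+1 * (n * 3).+1)%:R / s%:R.
Proof.
move=> s0 snr.
have s0' : 0 < s%:R :> R by rewrite ltr0n.
pose k := (r %/ (s + n))%N.
have sn0 : (0 < s + n)%N by rewrite addn_gt0 s0.
have sk : (s <= k)%N by rewrite leq_divRL.
have k0 : (0 < k)%N by exact: leq_trans sk.
have krle : (k * (s + n) <= r)%N by exact: leq_trunc_div.
have rk : (r < k.+1 * (s + n))%N by exact: ltn_ceil.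
have r0 : (0 < r)%N by apply: leq_trans krle; rewrite muln_gt0 k0.
(* From [r < (k + 1) (s + n)], the left side is at most [k s + k n + s + 2 n]; now [s <= k] and
   [1 <= k] bound this by [k (s + 3 n + 1)]. *)
pose d := (n * 3).+1; have rk' : (r + n <= k * (s + d))%N.
  by move: rk sk k0; rewrite /d mulSn !mulnDr; nia.
have := degsum_le k0 krle.
have mr0 : 0 < m r by rewrite ltr0n polydim_gt0.
have r0' : 0 < r%:R :> R by rewrite ltr0n.
have k0' : 0 < k%:R :> R by rewrite ltr0n.
have ms0 : 0 < m s by rewrite ltr0n polydim_gt0.
pose x : R := k%:R * s%:R / r%:R.
pose q : R := (k ^ n)%:R * m s / m r.
pose y : R := s%:R / (s + d)%:R.
have sd0 : 0 < (s + d)%:R :> R by rewrite ltr0n addn_gt0 s0.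
have y01 : 0 <= y <= 1.
  by rewrite divr_ge0 ?ler_pdivrMr ?mul1r ?ler_nat ?leq_addr.
have yx : y <= x.
  have -> : x = s%:R * (k%:R / r%:R) by rewrite /x; ring.
  rewrite /y ler_wpM2l// ler_pdivlMr// mulrC ler_pdivrMr//.
  by rewrite -natrM ler_nat (leq_trans _ rk')// leq_addr.
have x1 : x <= 1.
  rewrite /x ler_pdivrMr// mul1r -natrM ler_nat; apply: leq_trans krle.
  by rewrite leq_mul2l leq_addr orbT.
(* [q] is the proportion, among the multi-indices of degree at most [r], of those in [combs k s]. *)
have q1 : q <= 1.
  rewrite /q ler_pdivrMr// mul1r -natrM ler_nat -!size_midx -size_box.
  rewrite mulnC -(size_allpairs (comb k)); apply: uniq_leq_size; first exact: combs_uniq.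
  exact: combs_sub.
have yq : y ^+ n <= q.
  have f0 : 0 < n`!%:R :> R by rewrite ltr0n fact_gt0.
  rewrite /q ler_pdivlMr// -(ler_pM2r f0) /y expr_div_n.
  rewrite -mulrA mulrAC ler_pdivrMr ?exprn_gt0//.
  rewrite -!natrX -!natrM ler_nat.
  have h1 := polydim_le n r; have h2 := polydim_ge n s.
  have h3 : ((n + r) ^ n <= (k * (s + d)) ^ n)%N.
    by case: (n) rk' => [|n'] rk'; rewrite ?expn0// leq_exp2r// addnC.
  rewrite expnMn in h3.
  apply: leq_trans (leq_mul (leqnn _) (leq_trans h1 h3)) _.
  by rewrite mulnCA mulnA [(_ * polydim n s)%N]mulnC -!mulnA; move: h2; nia.
(* From [y <= x] and [y^n <= q] follows [y^(n+1) <= x q], and Bernoulli's inequality applies to the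
   power. *)
have xq : 1 - x * q <= n.+1%:R * (d%:R / s%:R).
  apply: (@le_trans _ _ (1 - y ^+ n.+1)).
    rewrite lerB// exprS ler_pM//; first by case/andP: y01.
    by rewrite exprn_ge0//; case/andP: y01.
  apply: le_trans (one_sub_exprn_le _ y01) _; rewrite ler_wpM2l//.
  rewrite /y natrD; have -> : 1 - s%:R / (s%:R + d%:R) = d%:R / (s%:R + d%:R) :> R.
    by field; rewrite gt_eqF// -natrD.
  by rewrite ler_wpM2l// lef_pV2 ?posrE -?natrD// natrD lerDl.
have -> : 2 * c * (n.+1 * d)%:R / s%:R = 2 * c * (n.+1%:R * (d%:R / s%:R)).
  by rewrite natrM; ring.
move=> h; apply: (@le_trans _ _ (average s + 2 * c * (1 - x * q))); last first.
  by rewrite lerD2l ler_wpM2l// mulr_ge0// c_ge0.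
apply: (@le_trans _ _ (x * q * average s + c * q * (1 - x) + c * (1 - q))).
  rewrite /average ler_pdivrMr ?mulr_gt0//; apply: le_trans h _.
  rewrite le_eqVlt; apply/orP; left; apply/eqP; rewrite /x /q natrM.
  by field; rewrite !gt_eqF.
have := average_bound s; rewrite ler_norml => /andP[A1 A2].
have q0 : 0 <= q by apply: le_trans yq; rewrite exprn_ge0//; case/andP: y01.
have x0 : 0 <= x by apply: le_trans yx; case/andP: y01.
have xq1 : 0 <= 1 - x * q by nra.
have c0 := c_ge0.
have : (1 - x * q) * (- c) <= (1 - x * q) * average s by rewrite ler_wpM2l.
by nra.
Qed.

(** As in Fekete's lemma the limit is an infimum, here of [average s + e / s]: [average_le] with a
    nearly optimal [s] gives the upper bound for large [r], and taking [s = r] in the infimum gives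
    the lower one. *)
Lemma average_cvg : cvgn average.
Proof.
pose e : R := 2 * c * (n.+1 * (n * 3).+1)%:R.
have e0 : 0 <= e by rewrite !mulr_ge0// c_ge0.
pose S := [set average s + e / s%:R | s in [set s : nat | (0 < s)%N]].
have hS : has_inf S.
  split; first by exists (average 1 + e / 1), 1%N.
  exists (- c) => _ [s /= s0 <-]; have := average_bound s.
  have es : 0 <= e / s%:R by rewrite divr_ge0.
  by rewrite ler_norml => /andP[h _]; lra.
apply/cvg_ex; exists (inf S); apply/cvgrPdist_le => eps eps0.
have [_ [s /= s0 <-] sE] := inf_adherent eps0 hS.
near=> r; rewrite ler_distl; apply/andP; split.
  rewrite lerBlDr; apply: le_trans (ltW sE); apply: average_le => //.
  by near: r; exact: nbhs_infty_ge.
have r0 : (0 < r)%N by near: r; exact: nbhs_infty_gt.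
have h : inf S <= average r + e / r%:R by apply: ge_inf; [exact: hS.2|exists r].
apply: le_trans h _; rewrite lerD2l ler_pdivrMr ?ltr0n// mulrC -ler_pdivrMr//.
by near: r; exact: nbhs_infty_ger.
Unshelve. all: by end_near. Qed.

End subadditive_average.

(** * Weighted Chebyshev constants *)

Section chebyshev.
Context {R : realType} {n : nat}.
Local Notation C := (R[i])^o.
Local Notation mi := {ffun 'I_n -> nat}.
Variables (K : set (Cspace R n)) (W : Cspace R n -> R) (B wlo whi c : R).
Hypothesis B1 : 1 <= B.
Hypothesis KB : forall x, K x -> rnorm x <= B.
Hypothesis wlo0 : 0 < wlo.
Hypothesis Wb : forall x, K x -> wlo <= W x <= whi.
Hypothesis K0 : K !=set0.
Hypothesis c0 : 0 < c.
Hypothesis leadK : forall r (b : mi) (p : Cspace R n -> R[i]),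
  (0 < r)%N -> degle r b -> lead r b p ->
  exists2 x, K x & c ^+ r <= rnorm (p x : C).

Definition wsup (r : nat) (p : Cspace R n -> R[i]) : R :=
  sup [set rnorm (p x : C) * W x ^+ r | x in K].

Definition cheb (r : nat) (b : mi) : R := inf [set wsup r p | p in lead r b].

Lemma W_gt0 x : K x -> 0 < W x.
Proof. by move=> /Wb /andP[h _]; exact: lt_le_trans h. Qed.

Lemma whi_gt0 : 0 < whi.
Proof. by have [x Kx] := K0; have /andP[_] := Wb Kx; apply: lt_le_trans; exact: W_gt0. Qed.

Lemma has_wsup r (p : Cspace R n -> R[i]) P : mspan P p ->
  has_sup [set rnorm (p x : C) * W x ^+ r | x in K].
Proof.
move=> pr; split; first by have [x Kx] := K0; exists (rnorm (p x : C) * W x ^+ r), x.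
have [M M0 pM] := mspan_bounded B pr.
exists (M * whi ^+ r) => _ [x Kx <-]; have /andP[_ Wx] := Wb Kx.
have W0 := W_gt0 Kx.
rewrite ler_pM ?rnorm_ge0 ?exprn_ge0 ?(ltW W0)//; first exact: pM (KB Kx).
by rewrite lerXn2r// nnegrE ltW// whi_gt0.
Qed.

Lemma wsup_ub r (p : Cspace R n -> R[i]) P x : mspan P p -> K x ->
  rnorm (p x : C) * W x ^+ r <= wsup r p.
Proof. by move=> pr Kx; apply: sup_upper_bound; [exact: has_wsup pr|exists x]. Qed.

Lemma wsup_le r (p : Cspace R n -> R[i]) t :
  (forall x, K x -> rnorm (p x : C) * W x ^+ r <= t) -> wsup r p <= t.
Proof.
move=> pt; apply: sup_le_ub => [|_ [x Kx <-]]; last exact: pt.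
by have [x Kx] := K0; exists (rnorm (p x : C) * W x ^+ r), x.
Qed.

(** Degree bound 0 is not covered by [leadK]; there the constant 1 is the only competitor. *)
Lemma lead0E b (p : Cspace R n -> R[i]) : degle 0 b -> lead 0 b p -> p = fun=> 1.
Proof.
rewrite /degle leqn0 => b0 pb.
have d0 (d : mi) : (mdegree d <= 0)%N -> d = 0.
  move=> dd; apply/ffunP => i; rewrite ffunE; apply/eqP; rewrite -leqn0.
  exact: leq_trans (leq_mdegree _ _) dd.
have b0' : b = 0 by apply: d0; rewrite (eqP b0).
have h (f : Cspace R n -> R[i]) :
      mspan (fun d : mi => lexlt d b /\ degle 0 d) f -> forall x, f x = 0.
  elim=> [//|a' d g [db /d0 d0'] _ _ x].
  by move: db; rewrite d0' b0' lexlt_irr.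
apply/funext => x; rewrite -[LHS](subrK (monomial b x)) (h _ pb x).
by rewrite add0r b0' /monomial big1// => j _; rewrite ffunE.
Qed.

Lemma wsup_ge r b (p : Cspace R n -> R[i]) : degle r b -> lead r b p ->
  (c * wlo) ^+ r <= wsup r p.
Proof.
move=> br pb; have pr := lead_mspan br pb.
have [x Kx px] : exists2 x, K x & c ^+ r <= rnorm (p x : C).
  have [r0|r0] := posnP r; last exact: leadK pb.
  have [x Kx] := K0; exists x => //; move: br pb; rewrite r0 => br pb.
  by rewrite (lead0E br pb) rnorm1.
apply: le_trans (wsup_ub _ pr Kx).
rewrite exprMn ler_pM ?exprn_ge0 ?(ltW c0) ?(ltW wlo0)//.
have /andP[h _] := Wb Kx.
by rewrite lerXn2r// nnegrE ltW// W_gt0.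
Qed.

Lemma has_cheb r b : degle r b -> has_inf [set wsup r p | p in lead r b].
Proof.
move=> br; split.
  by exists (wsup r (monomial b)), (monomial b) => //; exact: lead_monomial.
by exists ((c * wlo) ^+ r) => _ [p pb <-]; exact: wsup_ge pb.
Qed.

Lemma cheb_ge r b : degle r b -> (c * wlo) ^+ r <= cheb r b.
Proof.
move=> br; apply: lb_le_inf; first exact: (has_cheb br).1.
by move=> _ [p pb <-]; exact: wsup_ge pb.
Qed.

Lemma cheb_gt0 r b : degle r b -> 0 < cheb r b.
Proof. by move=> /cheb_ge; apply: lt_le_trans; rewrite exprn_gt0// mulr_gt0. Qed.

Lemma cheb_le_wsup r b p : degle r b -> lead r b p -> cheb r b <= wsup r p.
Proof. by move=> br pb; apply: ge_inf; [exact: (has_cheb br).2|exists p]. Qed.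

Lemma cheb_le r b : degle r b -> cheb r b <= (B * whi) ^+ r.
Proof.
move=> br; apply: le_trans (cheb_le_wsup br (lead_monomial r b)) _.
apply: wsup_le => x Kx; have /andP[_ Wx] := Wb Kx; have W0 := W_gt0 Kx.
have B0 : 0 <= B by rewrite (le_trans _ B1).
rewrite exprMn ler_pM ?rnorm_ge0 ?exprn_ge0 ?(ltW W0)//; last first.
  by rewrite lerXn2r// nnegrE ltW// whi_gt0.
apply: (@le_trans _ _ (B ^+ mdegree b)); last by rewrite ler_weXn2l.
rewrite /monomial rnorm_prod /mdegree -prodrXr; apply: ler_prod => j _.
rewrite rnorm_ge0/= rnormX lerXn2r ?nnegrE ?rnorm_ge0//.
exact: (rnorm_row_le x B0).1 (KB Kx) j.
Qed.

(** A competitor within a factor 2 avoids the question whether the infimum is attained; this is the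
    origin of the [2^N] in the bounds on determinants. *)
Lemma exists_near_cheb r b : degle r b ->
  exists2 p, lead r b p & wsup r p <= 2 * cheb r b.
Proof.
move=> br; have c1 := cheb_gt0 br.
have [_ [p pb <-] pc] := inf_adherent c1 (has_cheb br).
by exists p => //; rewrite mulr_natl mulr2n ltW.
Qed.

Lemma lead_ge_cheb r b (p : Cspace R n -> R[i]) : degle r b -> lead r b p ->
  exists2 x, K x & cheb r b / 2 <= rnorm (p x : C) * W x ^+ r.
Proof.
move=> br pb; have c1 := cheb_gt0 br.
have [||_ [x Kx <-] h] := @sup_gt _ [set rnorm (p x : C) * W x ^+ r | x in K] (cheb r b / 2).
- exact: (has_wsup r (lead_mspan br pb)).1.
- by rewrite -/(wsup r p); have := cheb_le_wsup br pb; lra.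
- by exists x => //; exact: ltW.
Qed.

(** A product of competitors is a competitor for the sum of the pairs, by [leadM], and the weights
    multiply; the two infima are then taken one after the other. *)
Lemma cheb_submul r r' b b' : degle r b -> degle r' b' ->
  cheb (r + r') (b + b') <= cheb r b * cheb r' b'.
Proof.
move=> br br'; have brr : degle (r + r') (b + b').
  by rewrite /degle mdegreeD leq_add.
have key p p' : lead r b p -> lead r' b' p' ->
    cheb (r + r') (b + b') <= wsup r p * wsup r' p'.
  move=> pb pb'; apply: le_trans (cheb_le_wsup brr (leadM br br' pb pb')) _.
  apply: wsup_le => x Kx; have W0 := W_gt0 Kx.
  rewrite rnormM exprD mulrACA ler_pM ?mulr_ge0 ?rnorm_ge0 ?exprn_ge0 ?(ltW W0)//.
    exact: wsup_ub (lead_mspan br pb) Kx.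
  exact: wsup_ub (lead_mspan br' pb') Kx.
have c1 := cheb_gt0 br; have c2 := cheb_gt0 br'.
rewrite mulrC -ler_pdivrMr//; apply: lb_le_inf; first exact: (has_cheb br').1.
move=> _ [p' pb' <-]; have w0 := lt_le_trans c2 (cheb_le_wsup br' pb').
rewrite ler_pdivrMr// mulrC -ler_pdivrMr//; apply: lb_le_inf; first exact: (has_cheb br).1.
by move=> _ [p pb <-]; rewrite ler_pdivrMr//; exact: key.
Qed.

Definition logcheb r b : R := ln (cheb r b).

Lemma logcheb_sub r r' b b' : degle r b -> degle r' b' ->
  logcheb (r + r')%N (b + b') <= logcheb r b + logcheb r' b'.
Proof.
move=> br br'; have c1 := cheb_gt0 br; have c2 := cheb_gt0 br'.
rewrite /logcheb -lnM ?posrE// ler_ln ?posrE ?mulr_gt0//; first exact: cheb_submul.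
by apply: cheb_gt0; rewrite /degle mdegreeD leq_add.
Qed.

Lemma logcheb_bound r b : degle r b ->
  `|logcheb r b| <= (`|ln (c * wlo)| + `|ln (B * whi)|) * r%:R.
Proof.
move=> br; have c1 := cheb_gt0 br.
have cw : 0 < c * wlo by rewrite mulr_gt0.
have Bw : 0 < B * whi by rewrite mulr_gt0 ?whi_gt0// (lt_le_trans ltr01).
rewrite ler_norml /logcheb; apply/andP; split.
  apply: (@le_trans _ _ (ln ((c * wlo) ^+ r))); last first.
    by rewrite ler_ln ?posrE ?exprn_gt0// cheb_ge.
  rewrite lnXn// -[leRHS]mulr_natr -mulNr ler_wpM2r// lerNl.
  by rewrite (le_trans (ler_norm _))// normrN lerDl.
apply: (@le_trans _ _ (ln ((B * whi) ^+ r))).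
  by rewrite ler_ln ?posrE ?exprn_gt0// cheb_le.
rewrite lnXn// -[leLHS]mulr_natr ler_wpM2r//.
by rewrite (le_trans (ler_norm _))// lerDr.
Qed.

Lemma average_logcheb_cvg : (forall r, size (midx n r) = polydim n r) ->
  cvgn (average logcheb).
Proof.
move=> sz; apply: (average_cvg sz); first exact: logcheb_sub.
exact: logcheb_bound.
Qed.

End chebyshev.

Section enumeration.
Variables (n s r : nat) (e : 'I_(polydimU n s r) -> {ffun 'I_n -> nat} * 'I_s).
Hypothesis e_enum : monomial_enumeration e.
Local Notation mi := {ffun 'I_n -> nat}.

Lemma e_degree k : (mdegree (e k).1 <= r)%N.
Proof. by apply/(e_enum.2 _ (e k).2); exists k; case: (e k). Qed.

Lemma e_perm : perm_eq [seq e k | k <- enum 'I_(polydimU n s r)]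
  [seq (b, i) | b <- midx n r, i <- enum 'I_s].
Proof.
apply: uniq_perm.
- by rewrite map_inj_uniq ?enum_uniq//; exact: e_enum.1.
- apply: allpairs_uniq; rewrite ?midx_uniq ?enum_uniq//.
  by move=> [? ?] [? ?] _ _ [-> ->].
move=> [b i]; apply/mapP/allpairsP => [[k _ ek]|[[b' i'] /= [+ _ [-> ->]]]].
  exists (b, i); rewrite /= mem_enum mem_midx; split => //.
  by have := e_degree k; rewrite -ek.
by rewrite mem_midx => /(e_enum.2 _ i')[k ek]; exists k; rewrite ?mem_enum.
Qed.

(** The number of multi-indices is read off from the enumeration of the pairs by cancelling [s], in
    place of a combinatorial count. *)
Lemma size_midx_of_enum : (0 < s)%N -> size (midx n r) = polydim n r.
Proof.
move=> s0; have /perm_size := e_perm.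
rewrite size_map size_enum_ord size_allpairs size_enum_ord /polydimU mulnC => /eqP.
by rewrite eqn_pmul2r// => /eqP.
Qed.

Lemma sum_e (R : nmodType) (F : mi -> 'I_s -> R) :
  \sum_k F (e k).1 (e k).2 = \sum_i \sum_(b <- midx n r) F b i.
Proof.
have -> : \sum_k F (e k).1 (e k).2 =
    \sum_(x <- [seq e k | k <- enum 'I_(polydimU n s r)]) F x.1 x.2.
  by rewrite big_map big_enum.
rewrite (perm_big _ e_perm) big_allpairs_dep exchange_big/= big_enum/=.
by apply: eq_bigr => i _.
Qed.

(** Multi-indices are compared only within one component, because the triangular changes of basis do
    not mix components; across components the sorting has ties. *)
Lemma sorted_enumeration : exists sigma : 'S_(polydimU n s r),
  forall i j, (e (sigma i)).2 = (e (sigma j)).2 ->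
    (i < j)%N = lexlt (e (sigma i)).1 (e (sigma j)).1.
Proof.
pose leT (p q : mi * 'I_s) := ~~ lexlt q.1 p.1.
have leT_total : total leT.
  move=> p q; rewrite /leT -negb_and; apply/negP => /andP[h1 h2].
  by have := lexlt_trans h1 h2; rewrite lexlt_irr.
have leT_trans : transitive leT.
  move=> q p t; rewrite /leT => pq qt; apply/negP => tp.
  have [tq|tq] := eqVneq t.1 q.1; first by rewrite -tq tp in pq.
  have /orP[h|h] := lexlt_total tq; first by rewrite h in qt.
  by rewrite (lexlt_trans h tp) in pq.
pose et := [tuple e k | k < polydimU n s r].
have sz : size (sort leT et) == polydimU n s r by rewrite size_sort size_tuple.
have /tuple_permP[sigma sigmaE] : perm_eq (sort leT et) et by rewrite perm_sort.
exists sigma.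
have srt : sorted leT (sort leT et) by exact: sort_sorted.
have nthE (i : 'I_(polydimU n s r)) d : nth d (sort leT et) i = e (sigma i).
  by rewrite sigmaE -tnth_nth !tnth_mktuple.
have lt_le (i j : 'I_(polydimU n s r)) : (i < j)%N -> ~~ lexlt (e (sigma j)).1 (e (sigma i)).1.
  move=> ij; have := sorted_ltn_nth leT_trans (e i) srt.
  move=> /(_ i j); rewrite !inE (eqP sz) !ltn_ord !nthE; exact.
have neq (i j : 'I_(polydimU n s r)) : (i < j)%N -> (e (sigma i)).2 = (e (sigma j)).2 ->
    (e (sigma i)).1 != (e (sigma j)).1.
  move=> ij e2; apply/negP => /eqP e1.
  have : sigma i = sigma j by apply: e_enum.1;
    rewrite [LHS]surjective_pairing e1 e2 -surjective_pairing.
  by move=> /perm_inj ije; rewrite ije ltnn in ij.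
move=> i j e2; apply/idP/idP => [ij|lij].
  by have := lexlt_total (neq i j ij e2); rewrite (negbTE (lt_le i j ij)) orbF.
rewrite ltnNge leq_eqVlt; apply/negP => /orP[/eqP/val_inj ji|ji].
  by rewrite ji lexlt_irr in lij.
by have := lt_le j i ji; rewrite lij.
Qed.

End enumeration.

(** * Determinants of functionals *)

Section hermitian.
Context {R : realType} {U : normedModType R[i]}.
Local Notation C := (R[i])^o.
Variable herm : {dot U for Num.conj}.
Hypothesis U_hermitian : hermitian_norm herm.

Lemma hprodP a (c : R[i]) b d :
  hprod herm a (c *: b + d) = c * hprod herm a b + hprod herm a d.
Proof. by rewrite /hprod linearPl. Qed.

Lemma hprodZ a (c : R[i]) b : hprod herm a (c *: b) = c * hprod herm a b.
Proof. by rewrite /hprod linearZl_LR. Qed.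

Lemma hprodC a b : hprod herm a b = Num.conj (hprod herm b a).
Proof. by rewrite /hprod hermC/= expr0 mul1r. Qed.

Lemma hprod_rnorm a : hprod herm a a = ((rnorm a ^+ 2)%:C)%C.
Proof. by rewrite -U_hermitian norm_rnorm rmorphXn. Qed.

(** Cauchy-Schwarz: split [b] into its projection on [a] and a remainder orthogonal to [a]. *)
Lemma hprod_le a b : rnorm (hprod herm a b : C) <= rnorm a * rnorm b.
Proof.
have [->|a0] := eqVneq a 0.
  by rewrite /hprod linear0r !rnorm0 mul0r.
have A0 : 0 < rnorm a by rewrite rnorm_gt0.
pose c : R[i] := hprod herm a b / hprod herm a a.
have AE := hprod_rnorm a.
have Anz : hprod herm a a != 0 by rewrite AE gt_eqF// ltcR exprn_gt0.
pose d := b - c *: a.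
have ad : hprod herm a d = 0.
  by rewrite /d /hprod linearBl linearZl_LR/= divfK ?subrr.
have hE : hprod herm a b = c * hprod herm a a by rewrite divfK.
have bE : hprod herm b b = c * Num.conj c * hprod herm a a + hprod herm d d.
  have -> : b = c *: a + d by rewrite /d addrC subrK.
  rewrite hprodP hprodC hprodP [hprod herm (_ + d) d]hprodC hprodP.
  rewrite [hprod herm d a]hprodC ad !rmorphD !rmorphM/= !rmorph0 !mulr0 !add0r addr0.
  by rewrite -(hprodC a a) -(hprodC d d) !mulrA.
have : (rnorm (c : C) * rnorm a) ^+ 2 <= rnorm b ^+ 2.
  rewrite -lecR -hprod_rnorm bE exprMn rmorphM/= -hprod_rnorm.
  rewrite -normCK (norm_rnorm (c : C)) -rmorphXn lerDl hprod_rnorm ler0c.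
  by rewrite exprn_ge0// rnorm_ge0.
rewrite ler_pXn2r ?nnegrE ?mulr_ge0 ?rnorm_ge0// => h.
rewrite hE rnormM AE rnorm_real ger0_norm ?exprn_ge0 ?rnorm_ge0//.
by rewrite expr2 mulrA [leRHS]mulrC ler_wpM2r ?rnorm_ge0.
Qed.

Variables (s : nat) (u : s.-tuple U).
Hypothesis u_basis : orthonormal_basis herm u.

Lemma rnorm_basis i : rnorm (tnth u i) = 1.
Proof.
have := hprod_basis u_basis i i; rewrite hprod_rnorm eqxx => /complexI h.
by apply/eqP; rewrite -(@eqrXn2 _ 2) ?rnorm_ge0// h expr1n.
Qed.

Lemma ucoord_comb i (c : 'I_s -> R[i]) :
  ucoord herm u i (\sum_j c j *: tnth u j) = c i.
Proof.
rewrite /ucoord hprod_suml (bigD1 i)//= hprod_basis// eqxx mulr1 big1 ?addr0//.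
by move=> j ji; rewrite hprod_basis// eq_sym (negbTE ji) mulr0.
Qed.

Lemma ucoordP i (c : R[i]) a b :
  ucoord herm u i (c *: a + b) = c * ucoord herm u i a + ucoord herm u i b.
Proof. exact: hprodP. Qed.

Lemma rnorm_ucoord_le i a : rnorm (ucoord herm u i a : C) <= rnorm a.
Proof. by rewrite (le_trans (hprod_le _ _))// rnorm_basis mul1r. Qed.

Variables (n : nat) (K : set (Cspace R n)).
Hypothesis K_compact : compact K.
Hypothesis K0 : K !=set0.

Lemma contU_bounded (f : Cspace R n -> U) : contU K f ->
  has_sup [set rnorm (f x) | x in K].
Proof.
move=> cf; split; first by have [x Kx] := K0; exists (rnorm (f x)), x.
have /compact_bounded[M [_ MP]] : compact ((fun x => rnorm (f x)) @` K).
  apply: continuous_compact => //.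
  move=> x; apply: (@continuous_comp _ _ _ (f : subspace K -> U) (@rnorm R U)).
    exact: cf.
  exact: continuous_rnorm.
exists (M + 1) => _ [x Kx <-]; rewrite (le_trans (ler_norm _))//.
by apply: (MP (M + 1)); [rewrite ltrDl|exists x].
Qed.

Lemma max_norm_ub (f : Cspace R n -> U) x : contU K f -> K x ->
  rnorm (f x) <= max_norm K f.
Proof. by move=> cf Kx; apply: sup_upper_bound; [exact: contU_bounded|exists x]. Qed.

Lemma max_norm_le (f : Cspace R n -> U) t :
  (forall x, K x -> rnorm (f x) <= t) -> max_norm K f <= t.
Proof.
move=> ft; apply: sup_le_ub => [|_ [x Kx <-]]; last exact: ft.
by have [x Kx] := K0; exists (rnorm (f x)), x.
Qed.

Lemma contU_cst (a : U) : contU K (fun=> a).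
Proof. by move=> x; exact: cst_continuous. Qed.

Lemma contUP (c : R[i]) (f g : Cspace R n -> U) : contU K f -> contU K g -> contU K (c *: f + g).
Proof.
move=> cf cg x; apply: (@continuousD _ _ _ (c *: f : subspace K -> U) g); last exact: cg.
apply: (@continuousZl_tmp _ _ _ (f : subspace K -> U) c); exact: cf.
Qed.

Lemma contU_sum (I : Type) (r : seq I) (c : I -> R[i]) (F : I -> Cspace R n -> U) :
  (forall i, contU K (F i)) -> contU K (fun x => \sum_(i <- r) c i *: F i x).
Proof.
move=> cF; elim: r => [|i r IH].
  rewrite (_ : (fun x => _) = fun=> 0); first exact: contU_cst.
  by apply/funext => x; rewrite big_nil.
rewrite (_ : (fun x => _) = c i *: F i + (fun x => \sum_(i <- r) c i *: F i x)).
  exact: contUP.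
by apply/funext => x; rewrite big_cons.
Qed.

Section functionals.
Variable T : (Cspace R n -> U) -> C.
Hypothesis dT : dualU K T.

Lemma dual0 : T (fun=> 0) = 0.
Proof.
have c0 := @contU_cst 0.
have : T (1 *: (fun=> 0) + (fun=> 0)) = 1 * T (fun=> 0) + T (fun=> 0).
  exact: dT.1.
rewrite (_ : 1 *: _ + _ = fun=> 0); last first.
  by apply/funext => x; rewrite /= scaler0 addr0.
by rewrite mul1r => /esym/eqP; rewrite -subr_eq0 addrK => /eqP.
Qed.

Lemma dual_sum (I : Type) (r : seq I) (c : I -> R[i]) (F : I -> Cspace R n -> U) :
  (forall i, contU K (F i)) ->
  T (fun x => \sum_(i <- r) c i *: F i x) = \sum_(i <- r) c i * T (F i).
Proof.
move=> cF; elim: r => [|i r IH].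
  rewrite big_nil -[RHS]dual0; congr T.
  by apply/funext => x; rewrite big_nil.
rewrite big_cons -IH -dT.1//; last exact: contU_sum.
by congr T; apply/funext => x; rewrite big_cons.
Qed.

Lemma dual_le f : dual_norm K T = 1 -> contU K f -> rnorm (T f) <= max_norm K f.
Proof.
move=> T1 cf; have [M TM] := dT.2.
have TZ (c : R[i]) : T (c *: f) = c * T f.
  have := dT.1 c f (fun=> 0) cf (@contU_cst 0).
  rewrite dual0 => h; rewrite -[RHS]addr0 -h.
  by congr T; apply/funext => x /=; rewrite addr0.
have m0 : 0 <= max_norm K f.
  by have [x Kx] := K0; rewrite (le_trans (rnorm_ge0 (f x)))// max_norm_ub.
(* A function of maximum norm 0 cannot be normalised; for it the bound contained in [dualU] gives
   the claim. *)
have [m00|mn0] := eqVneq (max_norm K f) 0.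
  by have := TM f cf; rewrite m00 mulr0.
have m1 : 0 < max_norm K f by rewrite lt_neqAle eq_sym mn0.
pose c : R[i] := (((max_norm K f)^-1)%:C)%C.
have cc : rnorm (c : C) = (max_norm K f)^-1.
  by rewrite rnorm_real ger0_norm// invr_ge0.
have ccf : contU K (c *: f).
  by have := @contUP c _ _ cf (@contU_cst 0); congr contU; apply/funext => x /=; rewrite addr0.
have : rnorm (T (c *: f)) <= 1.
  rewrite -T1; apply: sup_upper_bound.
    split; first by exists (rnorm (T (fun=> 0))), (fun=> 0) => //; split;
      [exact: contU_cst|apply: max_norm_le => x _; rewrite rnorm0].
    exists (Num.max M 0) => _ [g [cg g1] <-]; apply: le_trans (TM g cg) _.
    have g0 : 0 <= max_norm K g.
      by have [x Kx] := K0; rewrite (le_trans (rnorm_ge0 (g x)))// max_norm_ub.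
    have : M <= Num.max M 0 by rewrite le_max lexx.
    have : 0 <= Num.max M 0 by rewrite le_max lexx orbT.
    by nra.
  exists (c *: f) => //; split => //.
  apply: max_norm_le => x Kx; rewrite rnormZ cc ler_pdivrMl// mulr1.
  exact: max_norm_ub.
by rewrite TZ rnormM cc ler_pdivrMl// mulr1.
Qed.

End functionals.

Definition evalT (eta : U) (x : Cspace R n) (f : Cspace R n -> U) : C :=
  hprod herm eta (f x).

Lemma evalT_dual eta x : K x -> dualU K (evalT eta x).
Proof.
move=> Kx; split=> [c f g _ _|]; first by rewrite /evalT hprodP.
exists (rnorm eta) => f cf; rewrite /evalT (le_trans (hprod_le _ _))//.
by rewrite ler_wpM2l ?rnorm_ge0// max_norm_ub.
Qed.

(** The norm is attained at the constant function [eta]. *)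
Lemma evalT_norm eta x : K x -> rnorm eta = 1 -> dual_norm K (evalT eta x) = 1.
Proof.
move=> Kx eta1; apply/eqP; rewrite eq_le; apply/andP; split.
  apply: sup_le_ub => [|_ [f [cf f1] <-]].
    exists (rnorm (evalT eta x (fun=> 0))), (fun=> 0) => //; split.
      exact: contU_cst.
    by apply: max_norm_le => y _; rewrite rnorm0.
  rewrite /evalT (le_trans (hprod_le _ _))// eta1 mul1r (le_trans _ f1)//.
  exact: max_norm_ub.
apply: sup_upper_bound.
  split.
    exists (rnorm (evalT eta x (fun=> 0))), (fun=> 0) => //; split.
      exact: contU_cst.
    by apply: max_norm_le => y _; rewrite rnorm0.
  exists 1 => _ [f [cf f1] <-].
  rewrite /evalT (le_trans (hprod_le _ _))// eta1 mul1r (le_trans _ f1)//.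
  exact: max_norm_ub.
exists (fun=> eta).
  by split; [exact: contU_cst|apply: max_norm_le => y _; rewrite eta1].
by rewrite /evalT hprod_rnorm eta1 expr1n rnorm1.
Qed.

End hermitian.

Lemma det_le (R : realType) N (A : 'M[R[i]]_N) (m : 'I_N -> R) :
  (forall i j, rnorm (A i j : (R[i])^o) <= m j) ->
  rnorm (\det A : (R[i])^o) <= N`!%:R * \prod_j m j.
Proof.
move=> Am; rewrite /determinant (le_trans (rnorm_sum _ _ _))//.
apply: (@le_trans _ _ (\sum_(t : 'S_N) \prod_j m j)).
  apply: ler_sum => t _; rewrite rnormM rnorm_sign mul1r rnorm_prod.
  rewrite [leRHS](reindex_inj (@perm_inj _ t))/=.
  by apply: ler_prod => j _; rewrite rnorm_ge0 Am.
by rewrite sumr_const card_Sn -[leLHS]mulr_natl.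
Qed.

Lemma mulf_divK (F : fieldType) (a b x y : F) :
  y != 0 -> a * b * x = y * (x / y * a * b).
Proof. by move=> y0; field. Qed.

(** * Bounds for the determinants in terms of Chebyshev constants *)

Section vandermonde.
Context {R : realType} {U : normedModType R[i]}.
Local Notation C := (R[i])^o.
Variable herm : {dot U for Num.conj}.
Hypothesis U_hermitian : hermitian_norm herm.
Variables (s : nat) (u : s.-tuple U).
Hypothesis u_basis : orthonormal_basis herm u.
Variables (n : nat) (K : set (Cspace R n)).
Hypothesis K_compact : compact K.
Hypothesis K0 : K !=set0.
Variable w : 'I_s -> Cspace R n -> R.
Hypothesis w_cont : forall l, {within K, continuous (w l)}.
Variable e : forall r, 'I_(polydimU n s r) -> {ffun 'I_n -> nat} * 'I_s.
Variable r : nat.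
Hypothesis e_enum : monomial_enumeration (@e r).

Local Notation N := (polydimU n s r).
Local Notation wr := (weighted herm u w r).
Local Notation basisfun p k := (fun x => p x *: tnth u k).

Lemma weighted_basis (p : Cspace R n -> R[i]) k :
  wr (basisfun p k) = basisfun (fun x => p x * ((w k x ^+ r)%:C)%C) k.
Proof.
apply/funext => x; rewrite /weighted /odot (bigD1 k)//= big1 ?addr0.
  by rewrite /wpow ucoord_comb// /ucoord hprodZ hprod_basis// eqxx mulr1.
move=> i ik; rewrite {1}/ucoord hprodZ hprod_basis// (negbTE ik) mulr0 mul0r.
by rewrite scale0r.
Qed.

Lemma weighted_sum (I : Type) (t : seq I) (c : I -> R[i]) (F : I -> Cspace R n -> U) :
  wr (fun x => \sum_(i <- t) c i *: F i x) = fun x => \sum_(i <- t) c i *: wr (F i) x.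
Proof.
apply/funext => x; rewrite /weighted /odot.
under [RHS]eq_bigr do rewrite scaler_sumr.
rewrite exchange_big; apply: eq_bigr => k _ /=.
under [RHS]eq_bigr do rewrite scalerA mulrA.
rewrite -scaler_suml -mulr_suml; congr (_ * _ *: _).
elim: t => [|i t IH]; first by rewrite !big_nil /ucoord /hprod linear0l.
by rewrite !big_cons ucoordP IH.
Qed.

Lemma contU_weighted_basis P (p : Cspace R n -> R[i]) k : mspan P p ->
  contU K (wr (basisfun p k)).
Proof.
move=> pr; rewrite weighted_basis => x.
apply: (@continuousZr_tmp _ _ _ (fun x : subspace K => p x * ((w k x ^+ r)%:C)%C : C)).
apply: (@continuousM _ _ (p : subspace K -> C)
  (fun x : subspace K => ((w k x ^+ r)%:C)%C : C)).
  exact: continuous_subspaceT (mspan_continuous pr) x.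
apply: (@continuous_comp _ _ _ (fun x : subspace K => w k x ^+ r)
  (fun y : R => (y%:C)%C : C)); last exact: continuous_real_complex.
apply: (@continuous_comp _ _ _ (w k : subspace K -> R) (fun y : R => y ^+ r)).
  exact: w_cont.
exact: exprn_continuous.
Qed.

Definition wq (k : 'I_N) : Cspace R n -> U := wr (Defs.qpoly u e k).

Lemma wqE k : wq k =
  basisfun (fun x => monomial (e k).1 x * ((w (e k).2 x ^+ r)%:C)%C) (e k).2.
Proof. by rewrite /wq weighted_basis. Qed.

Lemma contU_wq k : contU K (wq k).
Proof.
apply: (@contU_weighted_basis (degle r)).
have := lead_mspan (e_degree e_enum k : degle r (e k).1) (lead_monomial r (e k).1).
exact.
Qed.

Definition detset : set R :=
  [set rnorm (\det (\matrix_(i, j) T i (wq j)) : C)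
   | T in [set T : 'I_N -> (Cspace R n -> U) -> C |
             forall i, dualU K (T i) /\ dual_norm K (T i) = 1]].

Lemma has_detset : (0 < s)%N -> has_sup detset.
Proof.
move=> s0; have [x0 Kx0] := K0; split.
  pose T := fun (_ : 'I_N) => evalT herm (tnth u (Ordinal s0)) x0.
  exists (rnorm (\det (\matrix_(i, j) T i (wq j)) : C)), T => // i; split.
    exact: evalT_dual.
  by apply: evalT_norm => //; exact: (rnorm_basis U_hermitian u_basis).
exists (N`!%:R * \prod_j max_norm K (wq j)) => _ [T TP <-].
apply: det_le => i j; rewrite mxE; have [dT T1] := TP i.
by apply: dual_le => //; exact: contU_wq.
Qed.

Variables (B wlo whi c : R).
Hypothesis KB : forall x, K x -> rnorm x <= B.
Hypothesis wlo0 : 0 < wlo.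
Hypothesis Wb : forall k x, K x -> wlo <= w k x <= whi.
Hypothesis c0 : 0 < c.
Hypothesis leadK : forall r (b : {ffun 'I_n -> nat}) (p : Cspace R n -> R[i]),
  (0 < r)%N -> degle r b -> lead r b p ->
  exists2 x, K x & c ^+ r <= rnorm (p x : C).

Local Notation ch k := (cheb K (w (e k).2) r (e k).1).

Lemma ch_gt0 (k : 'I_N) : 0 < ch k.
Proof.
by apply: (cheb_gt0 KB wlo0 (Wb (e k).2) K0 c0 leadK); exact: e_degree.
Qed.

Variable sigma : 'S_N.
Hypothesis sigmaP : forall i j, (e (sigma i)).2 = (e (sigma j)).2 ->
    (i < j)%N = lexlt (e (sigma i)).1 (e (sigma j)).1.

Lemma det_sigma (T : 'I_N -> (Cspace R n -> U) -> C) :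
  rnorm (\det (\matrix_(i, j) T i (wq (sigma j))) : C) =
  rnorm (\det (\matrix_(i, j) T i (wq j)) : C).
Proof.
rewrite (_ : (\matrix_(i, j) T i (wq (sigma j)) : 'M[R[i]]_N) =
    col_perm sigma (\matrix_(i, j) T i (wq j))); last first.
  by apply/matrixP => i j; rewrite !mxE.
by rewrite col_permE det_mulmx det_perm rnormM rnorm_sign mulr1.
Qed.

(** In the sorted basis, lexicographically lower monomials have strictly smaller indices; this makes
    the changes of basis triangular. *)
Lemma mspan_wq (j : 'I_N) (f : Cspace R n -> R[i]) :
  mspan (fun d => lexlt d (e (sigma j)).1 /\ degle r d) f ->
  exists2 a : 'I_N -> R[i], (forall i, a i != 0 -> (i < j)%N) &
    forall x, f x *: tnth u (e (sigma j)).2 =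
      \sum_i a i *: Defs.qpoly u e (sigma i) x.
Proof.
elim=> [|a d g [dj dr] _ [A Aj gA]].
  exists (fun=> 0) => [i|x]; first by rewrite eqxx.
  by rewrite scale0r big1// => i _; rewrite scale0r.
have [k ek] := (e_enum.2 d (e (sigma j)).2).2 dr.
pose i0 := (sigma^-1)%g k; have si0 : sigma i0 = k by rewrite permKV.
have i0j : (i0 < j)%N by rewrite sigmaP si0 ek.
exists (fun i => a *+ (i == i0) + A i) => [i|x].
  have [->//|_] := eqVneq i i0; rewrite mulr0n add0r; exact: Aj.
rewrite scalerDl gA.
under [RHS]eq_bigr do rewrite scalerDl.
rewrite big_split/=; congr (_ + _); rewrite (bigD1 i0)//= eqxx mulr1n big1 ?addr0.
  by rewrite /Defs.qpoly si0 ek/= scalerA.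
by move=> i /negbTE ->; rewrite mulr0n scale0r.
Qed.

(** Replacing each monomial by a nearly optimal polynomial with the same leading term is a
    unitriangular change of basis. It leaves the determinant unchanged, and the Leibniz expansion
    then involves only the norms of these polynomials. *)
Lemma detset_le t : detset t -> t <= N`!%:R * \prod_(k < N) (2 * ch k).
Proof.
move=> [T TP <-]; rewrite -det_sigma.
have dr (k : 'I_N) : degle r (e k).1 by exact: e_degree.
have near (k : 'I_N) : exists p, lead r (e k).1 p /\ wsup K (w (e k).2) r p <= 2 * ch k.
  have [p pb pc] := exists_near_cheb KB wlo0 (Wb (e k).2) K0 c0 leadK (dr k).
  by exists p.
have [p pP] := choice near.
have coefs (j : 'I_N) : exists A : 'I_N -> R[i], (forall i, A i != 0 -> (i < j)%N) /\
    forall x, (p (sigma j) x - monomial (e (sigma j)).1 x) *: tnth u (e (sigma j)).2 =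
      \sum_i A i *: Defs.qpoly u e (sigma i) x.
  by have [A A1 A2] := mspan_wq (pP (sigma j)).1; exists A.
have [A AP] := choice coefs.
pose M : 'M[R[i]]_N := \matrix_(i, j) ((i == j)%:R + A j i).
have detM : \det M = 1.
  have Mtrig : is_trig_mx M^T.
    apply/is_trig_mxP => i j ij; rewrite !mxE.
    have -> : (j == i) = false by apply/negbTE; rewrite -val_eqE/= gt_eqF.
    rewrite add0r; apply/eqP; apply: contraTT ij => /(AP i).1.
    by rewrite -leqNgt => /ltnW.
  rewrite -det_tr det_trig// big1// => i _; rewrite !mxE eqxx.
  suff -> : A i i = 0 by rewrite addr0.
  apply/eqP; apply: contraT => /(AP i).1; by rewrite ltnn.
pose P j : Cspace R n -> U := basisfun (p (sigma j)) (e (sigma j)).2.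
have PE j : P j = fun x => \sum_i M i j *: Defs.qpoly u e (sigma i) x.
  apply/funext => x; under eq_bigr do rewrite mxE scalerDl.
  rewrite big_split/= -(AP j).2 (bigD1 j)//= eqxx scale1r big1 ?addr0.
    by rewrite /Defs.qpoly -scalerDl addrC subrK.
  by move=> i /negbTE ->; rewrite scale0r.
have -> : \det (\matrix_(i, j) T i (wq (sigma j)) : 'M[R[i]]_N) =
    \det (\matrix_(i, j) T i (wr (P j)) : 'M[R[i]]_N).
  rewrite -[LHS]mulr1 -detM -det_mulmx; congr (\det _).
  apply/matrixP => i j; rewrite !mxE PE weighted_sum.
  rewrite (dual_sum (TP i).1); last by move=> l; exact: contU_wq.
  by apply: eq_bigr => l _; rewrite mxE mulrC.
apply: (@le_trans _ _ (N`!%:R * \prod_j (2 * ch (sigma j)))); last first.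
  by rewrite [X in _ <= _ * X](reindex_inj (@perm_inj _ sigma)).
apply: det_le => i j; rewrite mxE; have [dT T1] := TP i.
have [pb pc] := pP (sigma j); have pr := lead_mspan (dr _) pb.
apply: le_trans (dual_le K_compact K0 dT T1 (contU_weighted_basis pr)) _ => //.
apply: le_trans pc; apply: (max_norm_le K0) => x Kx.
rewrite weighted_basis rnormZ (rnorm_basis U_hermitian u_basis) mulr1 rnormM rnorm_real.
have W0 := W_gt0 wlo0 (Wb (e (sigma j)).2) Kx.
rewrite ger0_norm ?exprn_ge0 ?(ltW W0)//.
exact: (wsup_ub KB wlo0 (Wb (e (sigma j)).2) K0 r pr Kx).
Qed.

(** Indexed by [nat], with value 0 out of range, so that minors of all sizes [m <= N] are written
    with the same functions. *)
Definition wqn (j : nat) : Cspace R n -> U :=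
  if insub j is Some i then wq (sigma i) else fun=> 0.

Lemma wqn_ord (j : 'I_N) : wqn j = wq (sigma j).
Proof. by rewrite /wqn valK. Qed.

(* Expanding the new determinant along its last row turns it into the value of a
   functional at a polynomial with leading monomial the [m]-th one, so a point
   where this polynomial is large gives the next functional. *)
Lemma greedy_functionals m (mN : (m <= N)%N) : (0 < s)%N ->
  exists T : nat -> (Cspace R n -> U) -> C,
    (forall i, dualU K (T i) /\ dual_norm K (T i) = 1) /\
    \prod_(j < m) (ch (sigma (widen_ord mN j)) / 2) <=
      rnorm (\det (\matrix_(i < m, j < m) T i (wqn j)) : C).
Proof.
move=> s0; have evalP k x : K x -> dualU K (evalT herm (tnth u k) x) /\
    dual_norm K (evalT herm (tnth u k) x) = 1.
  move=> Kx; split; first exact: evalT_dual.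
  by apply: evalT_norm => //; exact: (rnorm_basis U_hermitian u_basis).
elim: m mN => [|m IH] mN.
  have [x0 Kx0] := K0; exists (fun=> evalT herm (tnth u (Ordinal s0)) x0).
  by split; [move=> _; exact: evalP|rewrite big_ord0 det_mx00 rnorm1].
have [T [TP TD]] := IH (ltnW mN).
pose im : 'I_N := Ordinal mN.
pose b := (e (sigma im)).1; pose k := (e (sigma im)).2.
have br : degle r b by exact: e_degree.
(* The cofactors along the last row; they involve only the functionals already chosen. *)
pose cf (j : 'I_m.+1) : R[i] := (-1) ^+ (m + j) *
  \det (\matrix_(i < m, l < m) T i (wqn (lift j l))).
have cfm : cf ord_max = \det (\matrix_(i < m, j < m) T i (wqn j)).
  rewrite /cf /= addnn -signr_odd odd_double expr0 mul1r; congr (\det _).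
  by apply/matrixP => i j; rewrite !mxE; congr (T i (wqn _)); exact: (lift_max j).
have ch0 (l : 'I_N) : 0 < ch l / 2 by rewrite divr_gt0// ch_gt0.
have D0 : cf ord_max != 0.
  rewrite -(rnorm_gt0 (cf ord_max : C)) cfm; apply: lt_le_trans TD.
  by apply: prodr_gt0 => l _.
(* The new functional will be [(u_k, f (x))], which vanishes on the other components, so only
   columns in component [k] contribute. Dividing by the last cofactor, nonzero by induction, makes
   [p] monic. *)
pose term (j : 'I_m.+1) (x : Cspace R n) : R[i] :=
  if (e (sigma (widen_ord mN j))).2 == k
  then cf j / cf ord_max * monomial (e (sigma (widen_ord mN j))).1 x else 0.
pose p x := \sum_j term j x.
have wm : widen_ord mN ord_max = im by exact: val_inj.
have pb : lead r b p.
  rewrite /lead; have -> : (fun x => p x - monomial b x) =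
      (fun x => \sum_(j < m) term (widen_ord (leqnSn m) j) x).
    apply/funext => x; rewrite /p big_ord_recr/= [X in _ + X - _](_ : _ = monomial b x).
      by rewrite addrK.
    by rewrite /term wm eqxx divff// mul1r.
  apply: mspan_sum => j _; rewrite /term.
  have [jk|jk] := eqVneq (e (sigma (widen_ord mN (widen_ord (leqnSn m) j)))).2 k;
    last exact: mspan0.
  apply: mspan_monomial; split; last exact: e_degree.
  by rewrite -sigmaP ?jk//=.
have [x Kx px] := lead_ge_cheb KB wlo0 (Wb k) K0 c0 leadK br pb.
pose T' i := if i == m then evalT herm (tnth u k) x else T i.
exists T'; split; first by move=> i; rewrite /T'; case: eqP => _; [exact: evalP|exact: TP].
pose A : 'M[R[i]]_m.+1 := \matrix_(i < m.+1, j < m.+1) T' i (wqn j).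
have detA : \det A = \sum_(j < m.+1) T' m (wqn j) * cf j.
  rewrite (expand_det_row A ord_max); apply: eq_bigr => j _; rewrite mxE/=.
  congr (_ * _); rewrite /cofactor /cf/=; congr (_ * \det _).
  apply/matrixP => i l; rewrite !mxE /T'/=.
  by rewrite (lift_max i : bump m i = i) ltn_eqF.
have -> : \det A = cf ord_max * (p x * ((w k x ^+ r)%:C)%C).
  rewrite detA /p mulr_suml mulr_sumr; apply: eq_bigr => j _.
  rewrite /T' eqxx (wqn_ord (widen_ord mN j)) wqE /evalT hprodZ hprod_basis// /term.
  rewrite eq_sym; case: eqP => [->|_]; last by rewrite mulr0 !mul0r mulr0.
  by rewrite mulr1; exact: mulf_divK.
rewrite big_ord_recr/= rnormM; apply: ler_pM.
- by apply: prodr_ge0 => j _; exact: ltW.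
- exact: ltW.
- rewrite cfm; apply: le_trans TD; rewrite le_eqVlt; apply/orP; left; apply/eqP.
  by apply: eq_bigr => j _; congr (ch (sigma _) / 2); exact: val_inj.
- rewrite wm; apply: le_trans px _; have W0 := W_gt0 wlo0 (Wb k) Kx.
  by rewrite rnormM rnorm_real ger0_norm ?exprn_ge0 ?(ltW W0).
Qed.

Lemma detset_ge : (0 < s)%N -> exists2 t, detset t & \prod_(k < N) (ch k / 2) <= t.
Proof.
move=> s0; have [T [TP TD]] := greedy_functionals (leqnn N) s0.
exists (rnorm (\det (\matrix_(i < N, j < N) T i (wq j)) : C)).
  by exists (fun i : 'I_N => T i) => // i; exact: TP.
rewrite -(det_sigma (fun i : 'I_N => T i)).
apply: le_trans (le_trans _ TD) _; last first.
  rewrite le_eqVlt; apply/orP; left; apply/eqP; congr rnorm; congr (\det _).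
  by apply/matrixP => i j; rewrite !mxE wqn_ord.
rewrite (reindex_inj (@perm_inj _ sigma))/= le_eqVlt; apply/orP; left; apply/eqP.
by apply: eq_bigr => j _; congr (ch (sigma _) / 2); exact: val_inj.
Qed.

End vandermonde.

(** The induction rests on [(r + 1) m_(r+1) = (n + r + 1) m_r]. *)
Lemma ell_polydim n r : (ell n r * n.+1 = n * r * polydim n r)%N.
Proof.
elim: r => [|r IH]; first by rewrite /ell big_geq// muln0 !mul0n.
have -> : (ell n r.+1 = ell n r + r.+1 * (polydim n r.+1 - polydim n r))%N.
  by rewrite /ell big_nat_recr.
have mS : (polydim n r.+1 * r.+1 = polydim n r * (n + r).+1)%N.
  have := mul_bin_left (n + r.+1) n; rewrite addKn addnS => h1.
  have := mul_bin_diag (n + r).+1 n; rewrite /= h1 => h2.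
  by rewrite /polydim addnS [RHS]mulnC h2 mulnC.
have le : (polydim n r <= polydim n r.+1)%N.
  by rewrite /polydim; apply: leq_bin2l; rewrite leq_add2l.
rewrite mulnDl IH; move: mS; rewrite -{1 3}(subnKC le).
set d := (polydim n r.+1 - polydim n r)%N; set a := polydim n r => mS.
have da : (d * r.+1 = a * n)%N.
  by apply: (@addnI (a * r.+1)); rewrite -mulnDl mS -addnS mulnDr addnC.
rewrite [(r.+1 * d)%N]mulnC da mulnDr [(n * r.+1 * d)%N]mulnAC -[(n * d * _)%N]mulnA da.
by rewrite !mulnS; lia.
Qed.

Section log_dimension.
Context {R : realType}.

Lemma ln_le_linear (eps : R) : 0 < eps ->
  exists2 M : R, 0 <= M & forall x : R, 0 < x -> ln x <= eps * x + M.
Proof.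
move=> e0; exists `|ln eps| => // x x0.
have : ln (eps * x) <= eps * x by rewrite ltW// ln_sublinear// mulr_gt0.
rewrite lnM ?posrE//; have := ler_norm (- ln eps); rewrite normrN; lra.
Qed.

Lemma cvg_divr (M : R) : M / r%:R @[r --> \oo] --> (0 : R).
Proof.
rewrite -[X in _ --> X](mulr0 M); apply: cvgM; first exact: cvg_cst.
apply/cvgrPdist_le => e e0; near=> r.
rewrite sub0r normrN ger0_norm ?invr_ge0// -[leRHS]invrK lef_pV2 ?posrE ?invr_gt0//.
  by near: r; exact: nbhs_infty_ger.
by rewrite ltr0n; near: r; exact: nbhs_infty_gt.
Unshelve. all: by end_near. Qed.

(** The dimension is at most [s (n + r)^n], so its logarithm grows at most like [n ln r]. *)
Lemma cvg_ln_polydimU n s : (0 < s)%N ->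
  ln (polydimU n s r)%:R / r%:R @[r --> \oo] --> (0 : R).
Proof.
move=> s0; apply/cvgrPdist_le => e e0.
have n10 : 0 < n.+1%:R :> R by rewrite ltr0n.
(* The slope allowed to [ln (n + r)], which is later multiplied by [n]; dividing by [n + 1] is
   legitimate also for [n = 0]. *)
have e20 : 0 < e / 2 / n.+1%:R by rewrite !divr_gt0.
have [M M0 lnM'] := ln_le_linear e20.
pose c : R := ln s%:R + n%:R * (e / 2 / n.+1%:R * n%:R + M).
have cdiv := cvg_divr c.
have : \forall r \near \oo, c / r%:R <= e / 2.
  have /cvgrPdist_le/(_ (e / 2)) := cdiv; rewrite divr_gt0// => /(_ isT).
  apply: filterS => r; rewrite sub0r normrN; apply: le_trans; exact: ler_norm.
move=> hc; near=> r.
have r0 : (0 < r)%N by near: r; exact: nbhs_infty_gt.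
have r0' : 0 < r%:R :> R by rewrite ltr0n.
have N1 : 1 <= (polydimU n s r)%:R :> R.
  by rewrite ler1n /polydimU muln_gt0 s0 polydim_gt0.
rewrite sub0r normrN ger0_norm ?divr_ge0 ?ln_ge0//.
have c1 : c / r%:R <= e / 2 by near: r.
rewrite ler_pdivrMr//.
have nr0 : 0 < (n + r)%:R :> R by rewrite ltr0n addn_gt0 r0 orbT.
have s0' : 0 < s%:R :> R by rewrite ltr0n.
have sn0 : 0 < s%:R * (n + r)%:R ^+ n :> R by rewrite mulr_gt0// exprn_gt0.
have : ln (polydimU n s r)%:R <= ln (s%:R * (n + r)%:R ^+ n) :> R.
  rewrite ler_ln ?posrE ?(lt_le_trans ltr01 N1)//.
  rewrite -natrX -natrM ler_nat leq_mul2l; apply/orP; right.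
  by apply: leq_trans (polydim_le n r); rewrite leq_pmulr// fact_gt0.
rewrite lnM ?posrE ?exprn_gt0// lnXn// -[ln _ *+ n]mulr_natl => h.
apply: le_trans h _.
have := lnM' _ nr0; set l := ln _; rewrite natrD => h1.
have : n%:R * l <= n%:R * (e / 2 / n.+1%:R * (n%:R + r%:R) + M) by rewrite ler_wpM2l.
have : n%:R * (e / 2 / n.+1%:R * r%:R) <= e / 2 * r%:R.
  rewrite mulrA ler_wpM2r// mulrCA ler_piMr//; first by rewrite divr_ge0// ltW.
  by rewrite ler_pdivrMr// mul1r ler_nat.
have : c <= e / 2 * r%:R by rewrite -ler_pdivrMr.
rewrite /c; move: (e / 2 / n.+1%:R) => q; nra.
Unshelve. all: by end_near. Qed.

Lemma ln_fact_le N : ln (N`!)%:R <= N%:R * ln N%:R :> R.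
Proof.
case: N => [|N]; first by rewrite ln1 mul0r.
rewrite mulr_natl -lnXn ?ltr0n// ler_ln ?posrE ?exprn_gt0 ?ltr0n ?fact_gt0//.
rewrite -natrX ler_nat.
have h m : (m <= N.+1)%N -> (m`! <= N.+1 ^ m)%N.
  by elim: m => // m IH mN; rewrite factS expnS leq_mul// IH// ltnW.
exact: h.
Qed.

Lemma ln_prod (I : Type) (t : seq I) (F : I -> R) : (forall i, 0 < F i) ->
  ln (\prod_(i <- t) F i) = \sum_(i <- t) ln (F i).
Proof.
move=> F0; elim: t => [|i t IH]; first by rewrite !big_nil ln1.
by rewrite !big_cons lnM ?IH// posrE ?prodr_gt0.
Qed.

End log_dimension.

Lemma cvg_sum_seq (R : realType) (I : Type) (t : seq I) (F : I -> nat -> R)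
    (l : I -> R) : (forall i, F i r @[r --> \oo] --> l i) ->
  \sum_(i <- t) F i r @[r --> \oo] --> \sum_(i <- t) l i.
Proof.
move=> Fl; elim: t => [|i t IH].
  by rewrite big_nil; under eq_fun do rewrite big_nil; exact: cvg_cst.
by rewrite big_cons; under eq_fun do rewrite big_cons; exact: cvgD.
Qed.

Lemma cvg_close (R : realType) (f g err : nat -> R) (l : R) :
  (forall r, (0 < r)%N -> `|f r - g r| <= err r) ->
  err r @[r --> \oo] --> (0 : R) -> g r @[r --> \oo] --> l ->
  f r @[r --> \oo] --> l.
Proof.
move=> close cerr cg; apply/cvgrPdist_le => eps eps0.
have eps2 : 0 < eps / 2 by rewrite divr_gt0.
near=> r; have r0 : (0 < r)%N by near: r; exact: nbhs_infty_gt.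
have h1 : `|l - g r| <= eps / 2 by near: r; move/cvgrPdist_le : cg; exact.
have : `|0 - err r| <= eps / 2 by near: r; move/cvgrPdist_le : cerr; exact.
rewrite sub0r normrN => /(le_trans (ler_norm _)) h2.
have -> : l - f r = (l - g r) - (f r - g r) by ring.
by rewrite (le_trans (ler_normB _ _))// [leRHS]splitr lerD// (le_trans (close r r0)).
Unshelve. all: by end_near. Qed.

(** * The transfinite diameter *)

Section diameter.
Context {R : realType} {n s : nat}.
Local Notation C := (R[i])^o.
Hypotheses (n_gt0 : (0 < n)%N) (s_gt0 : (0 < s)%N).
Variable K : set (Cspace R n).
Hypotheses (K_compact : compact K) (K_nonpluripolar : ~ pluripolar K).
Variables (U : normedModType R[i]) (herm : {dot U for Num.conj}).
Hypothesis U_hermitian : hermitian_norm herm.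
Variable u : s.-tuple U.
Hypothesis u_basis : orthonormal_basis herm u.
Variable w : 'I_s -> Cspace R n -> R.
Hypothesis w_gt0 : forall l x, K x -> 0 < w l x.
Hypothesis w_cont : forall l, {within K, continuous (w l)}.
Variable e : forall r, 'I_(polydimU n s r) -> {ffun 'I_n -> nat} * 'I_s.
Hypothesis e_enum : forall r, monomial_enumeration (@e r).

(** The estimate for monic polynomials, applied to the constant monomial with degree bound 1,
    produces a point of [K]. *)
Lemma nonpluripolar_nonempty : K !=set0.
Proof.
have [c c0 cP] := nonpluripolar_lead_ge K_nonpluripolar.
have [||x Kx _] := cP 1%N 0 (monomial 0) (ltn0Sn 0).
- by rewrite /degle /mdegree big1// => i _; rewrite ffunE.
- exact: lead_monomial.
- by exists x.
Qed.

Lemma compact_norm_bound : exists B, forall x, K x -> rnorm x <= B.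
Proof.
have [|c Kc cP] := compact_EVT_max nonpluripolar_nonempty K_compact
    (f := @rnorm R (Cspace R n)).
  by apply: continuous_subspaceT; exact: continuous_rnorm.
by exists (rnorm c) => x Kx; apply: cP; rewrite inE.
Qed.

Lemma weight_bounds : exists wlo whi, 0 < wlo /\
  forall k x, K x -> wlo <= w k x <= whi.
Proof.
have K0 := nonpluripolar_nonempty.
have up k : exists M, forall x, K x -> w k x <= M.
  have [c Kc cP] := compact_EVT_max K0 K_compact (w_cont (l := k)).
  by exists (w k c) => x Kx; apply: cP; rewrite inE.
have lo k : exists M, 0 < M /\ forall x, K x -> M <= w k x.
  have [c Kc cP] := compact_EVT_min K0 K_compact (w_cont (l := k)).
  exists (w k c); split; first by apply: w_gt0; rewrite inE in Kc.
  by move=> x Kx; apply: cP; rewrite inE.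
have [M MP] := choice up; have [m mP] := choice lo.
have m0 k : 0 < m k by have [] := mP k.
exists (\big[Num.min/1]_k m k), (\big[Num.max/0]_k M k); split.
  by apply: lt_bigmin => // k _.
move=> k x Kx; apply/andP; split.
  by apply: le_trans ((mP k).2 x Kx); exact: bigmin_le_cond.
by apply: le_trans (MP k x Kx) _; exact: le_bigmax_cond.
Qed.

Definition diam r : R := sup (detset herm u K w e r).
Definition logdiam_rate r : R := ln (diam r) / (s * ell n r)%:R.

Lemma tdiamE r : tdiam herm u K w e r = diam r `^ ((s * ell n r)%:R^-1).
Proof. by []. Qed.

(** The factors [2^-N] and [N! 2^N] around the product of the Chebyshev constants become an error of
    at most [N ln N + N ln 2]; [sum_e] regroups the logarithms by components. *)
Lemma diam_bounds r :
  let N := polydimU n s r in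
  0 < diam r /\ `|ln (diam r) - \sum_(k < s) degsum (logcheb K (w k)) r|
     <= N%:R * (ln N%:R + ln 2).
Proof.
move=> N; have K0 := nonpluripolar_nonempty.
have [B KB] := compact_norm_bound.
have [wlo [whi [wlo0 Wb]]] := weight_bounds.
have [c c0 leadK] := nonpluripolar_lead_ge K_nonpluripolar.
have [sigma sigmaP] := sorted_enumeration (e_enum r).
pose ch (k : 'I_N) := cheb K (w (e k).2) r (e k).1.
have ch0 k : 0 < ch k := ch_gt0 K0 (e_enum r) KB wlo0 Wb c0 leadK k.
have hD := has_detset U_hermitian u_basis K_compact K0 w_cont (e_enum r) s_gt0.
have sumE : \sum_(k < N) ln (ch k) = \sum_(k < s) degsum (logcheb K (w k)) r.
  exact: (sum_e (e_enum r) (fun b k => logcheb K (w k) r b)).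
have [t Dt tge] := detset_ge U_hermitian u_basis K_compact K0 (e_enum r) KB wlo0 Wb
  c0 leadK sigmaP s_gt0.
have p0 (a : R) : 0 < a -> 0 < \prod_(k < N) (a * ch k).
  by move=> a0; apply: prodr_gt0 => k _; rewrite mulr_gt0.
have lnp (a : R) : 0 < a -> ln (\prod_(k < N) (a * ch k)) =
    N%:R * ln a + \sum_(k < s) degsum (logcheb K (w k)) r.
  move=> a0; rewrite ln_prod => [|k]; last by rewrite mulr_gt0.
  rewrite -sumE; under eq_bigr do rewrite lnM ?posrE//.
  by rewrite big_split/= sumr_const card_ord -[ln a *+ N]mulr_natl.
have half0 : 0 < 2^-1 :> R by rewrite invr_gt0.
have Dge : \prod_(k < N) (2^-1 * ch k) <= diam r.
  apply: le_trans (sup_upper_bound hD Dt); apply: le_trans tge.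
  by rewrite le_eqVlt; apply/orP; left; apply/eqP; apply: eq_bigr => k _; rewrite mulrC.
have Dle : diam r <= N`!%:R * \prod_(k < N) (2 * ch k).
  apply: sup_le_ub; first exact: hD.1.
  move=> y; exact: (detset_le U_hermitian u_basis K_compact K0 w_cont (e_enum r)
    KB wlo0 Wb c0 leadK sigmaP).
have D0 : 0 < diam r by apply: lt_le_trans Dge; exact: p0.
split => //; have N0 : 0 < N`!%:R :> R by rewrite ltr0n fact_gt0.
have : ln (diam r) <= ln (N`!%:R * \prod_(k < N) (2 * ch k)).
  by rewrite ler_ln ?posrE ?mulr_gt0 ?p0.
rewrite lnM ?posrE ?p0// lnp// => h1.
have : ln (\prod_(k < N) (2^-1 * ch k)) <= ln (diam r) by rewrite ler_ln ?posrE ?p0.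
rewrite lnp// lnV ?posrE// => h2.
have h3 := @ln_fact_le R N.
have h4 : 0 <= N%:R * ln N%:R :> R.
  by case: (N) => [|m]; rewrite ?mul0r// mulr_ge0// ln_ge0// ler1n.
rewrite ler_norml; apply/andP; split; lra.
Qed.

Lemma rate_denominator r :
  (s * ell n r)%:R = n%:R / n.+1%:R * (r%:R * (polydimU n s r)%:R) :> R.
Proof.
have n1 : n.+1%:R != 0 :> R by rewrite pnatr_eq0.
have h : (ell n r)%:R = n%:R * r%:R * (polydim n r)%:R / n.+1%:R :> R.
  by rewrite -!natrM -ell_polydim natrM mulfK.
by rewrite /polydimU !natrM h; field.
Qed.

Definition loglimit : R :=
  n.+1%:R / (n%:R * s%:R) * \sum_(k < s) limn (average (logcheb K (w k))).

Lemma cvg_logdiam_rate : logdiam_rate r @[r --> \oo] --> loglimit.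
Proof.
pose avg r := n.+1%:R / (n%:R * s%:R) * \sum_(k < s) average (logcheb K (w k)) r : R.
have cavg : avg r @[r --> \oo] --> loglimit.
  apply: cvgM; first exact: cvg_cst.
  apply: cvg_sum_seq => k.
  have [B KB] := compact_norm_bound.
  have [wlo [whi [wlo0 Wb]]] := weight_bounds.
  have [c c0 leadK] := nonpluripolar_lead_ge K_nonpluripolar.
  have KB' x : K x -> rnorm x <= Num.max B 1.
    by move=> /KB/le_trans; apply; rewrite le_max lexx.
  have B1 : 1 <= Num.max B 1 by rewrite le_max lexx orbT.
  apply: (average_logcheb_cvg B1 KB' wlo0 (Wb k) nonpluripolar_nonempty c0 leadK).
  by move=> r; exact: size_midx_of_enum (e_enum r) s_gt0.
have n0' : 0 < n%:R :> R by rewrite ltr0n.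
have s0' : 0 < s%:R :> R by rewrite ltr0n.
pose err r := n.+1%:R / n%:R * (ln (polydimU n s r)%:R / r%:R + ln 2 / r%:R) : R.
have cerr : err r @[r --> \oo] --> (0 : R).
  rewrite -(mulr0 (n.+1%:R / n%:R)); apply: cvgM; first exact: cvg_cst.
  rewrite -[X in _ --> X](addr0 0); apply: cvgD; last exact: cvg_divr.
  exact: cvg_ln_polydimU.
have close r : (0 < r)%N -> `|logdiam_rate r - avg r| <= err r.
  move=> r0; have r0' : 0 < r%:R :> R by rewrite ltr0n.
  have N0' : 0 < (polydimU n s r)%:R :> R.
    by rewrite ltr0n muln_gt0 s_gt0 polydim_gt0.
  have m0' : 0 < (polydim n r)%:R :> R by rewrite ltr0n polydim_gt0.
  have [_] := diam_bounds r.
  have n1' : 0 < n.+1%:R :> R by rewrite ltr0n.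
  have l0 : 0 < (s * ell n r)%:R :> R by rewrite rate_denominator !mulr_gt0// invr_gt0.
  rewrite -(ler_pM2r (_ : 0 < (s * ell n r)%:R^-1)) ?invr_gt0//.
  have -> : avg r = (\sum_(k < s) degsum (logcheb K (w k)) r) / (s * ell n r)%:R.
    rewrite /avg /average -mulr_suml rate_denominator /polydimU natrM.
    by field; rewrite !gt_eqF.
  rewrite /logdiam_rate -mulrBl normrM [`|_^-1|]gtr0_norm ?invr_gt0// => h.
  apply: le_trans h _; rewrite le_eqVlt; apply/orP; left; apply/eqP.
  by rewrite rate_denominator /err; field; rewrite !gt_eqF.
exact: cvg_close close cerr cavg.
Qed.

Lemma diam_gt0 r : 0 < diam r.
Proof. by have [] := diam_bounds r. Qed.

Lemma ln_transfinite_diameter :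
  ln (transfinite_diameter herm u K w e) = loglimit.
Proof.
rewrite -[RHS]expRK /transfinite_diameter; congr ln; apply: cvg_lim => //.
have -> : tdiam herm u K w e = expR \o logdiam_rate.
  apply/funext => r; rewrite tdiamE /= /logdiam_rate /powR gt_eqF ?diam_gt0//.
  by rewrite mulrC.
by apply: continuous_cvg; [exact: continuous_expR|exact: cvg_logdiam_rate].
Qed.

(** Common to both limits of the theorem: it only remains to show that the logarithm in question is
    [2 ln D_r + o (r N)]. *)
Lemma cvg_log_of_close (X : nat -> R) :
  (forall eps, 0 < eps -> \forall r \near \oo,
    `|ln (X r) - 2 * ln (diam r)| <= eps * (r * polydimU n s r)%:R) ->
  n.+1%:R / (2 * n * r * polydimU n s r)%:R * ln (X r) @[r --> \oo] -->
    ln (transfinite_diameter herm u K w e).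
Proof.
move=> XD; rewrite ln_transfinite_diameter; apply/cvgrPdist_le => eps eps0.
have eps2 : 0 < eps / 2 by rewrite divr_gt0.
have n0' : 0 < n%:R :> R by rewrite ltr0n.
have n1 : 1 <= n%:R :> R by rewrite ler1n.
have := cvg_logdiam_rate; move/cvgrPdist_le/(_ _ eps2) => crate.
have Xeps := XD _ eps2.
near=> r; have r0 : (0 < r)%N by near: r; exact: nbhs_infty_gt.
have r0' : 0 < r%:R :> R by rewrite ltr0n.
have N0' : 0 < (polydimU n s r)%:R :> R.
  by rewrite ltr0n muln_gt0 s_gt0 polydim_gt0.
have n1' : 0 < n.+1%:R :> R by rewrite ltr0n.
have h1 : `|loglimit - logdiam_rate r| <= eps / 2 by near: r.
have h2 : `|ln (X r) - 2 * ln (diam r)| <= eps / 2 * (r * polydimU n s r)%:R.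
  by near: r.
have k0 : 0 < n.+1%:R / (2 * n * r * polydimU n s r)%:R :> R.
  by rewrite divr_gt0 ?ltr0n// !muln_gt0 n_gt0 r0 s_gt0 polydim_gt0.
have -> : loglimit - n.+1%:R / (2 * n * r * polydimU n s r)%:R * ln (X r) =
    (loglimit - logdiam_rate r) - n.+1%:R / (2 * n * r * polydimU n s r)%:R *
      (ln (X r) - 2 * ln (diam r)).
  rewrite /logdiam_rate rate_denominator !natrM; field.
  by rewrite nat1r !pnatr_eq0 -!lt0n polydim_gt0 s_gt0 r0 n_gt0.
rewrite (le_trans (ler_normB _ _))// [leRHS]splitr lerD//.
rewrite normrM gtr0_norm//; apply: le_trans (ler_wpM2l (ltW k0) h2) _.
(* The last factor is at most 1 because [n >= 1]. *)
rewrite [leLHS](_ : _ = eps / 2 * (n.+1%:R / (2 * n%:R))); last first.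
  rewrite !natrM; field.
  by rewrite !pnatr_eq0 -!lt0n polydim_gt0 s_gt0 r0 n_gt0.
rewrite ler_piMr ?(ltW eps2)// ler_pdivrMr ?mulr_gt0// mul1r -natr1; lra.
Unshelve. all: by end_near. Qed.

End diameter.

(** * Integrals of functions measurable for the completed measure *)

Section integral_domain.
Context {R : realType} {d : measure_display} {T : measurableType d}.
Variable mu : {measure set T -> \bar R}.
Import HBNNSimple.
Local Open Scope ereal_scope.

(** Monotonicity read off the definition as a supremum over simple functions, so that it applies to
    arbitrary nonnegative integrands. *)
Lemma ge0_le_integral_domain (A B : set T) (f g : T -> \bar R) :
  A `<=` B -> (forall x, A x -> 0 <= f x) -> (forall x, B x -> 0 <= g x) ->
  (forall x, A x -> f x <= g x) ->
  \int[mu]_(x in A) f x <= \int[mu]_(x in B) g x.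
Proof.
move=> AB f0 g0 fg; rewrite !ge0_integralE//= le_ereal_sup// => _ [h/= hf <-].
exists h => // x /=; apply: le_trans (hf x) _.
rewrite /patch; case: ifPn => [|_]; first by rewrite inE => Ax; rewrite mem_set ?fg//; exact: AB.
by case: ifPn => //; rewrite inE => /g0.
Qed.

(* [f] need not be measurable: an integral with respect to [mu] is a supremum of
   integrals of simple functions. *)
Lemma integral_conull (A B : set T) (f : T -> \bar R) :
  measurable A -> mu (~` A) = 0 -> A `<=` B ->
  \int[mu]_(x in B) f x = \int[mu]_(x in A) f x.
Proof.
move=> mA muA AB.
suff H (g : T -> \bar R) : (forall x, 0 <= g x) ->
    \int[mu]_(x in B) g x = \int[mu]_(x in A) g x.
  by rewrite integralE [RHS]integralE !H.
move=> g0; apply/eqP; rewrite eq_le; apply/andP; split; last first.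
  by apply: ge0_le_integral_domain.
rewrite !ge0_integralE//= ge_ereal_sup// => _ [h/= hg <-].
apply: le_ereal_sup_tmp; exists (sintegral mu (mul_nnsfun h (indic_nnsfun R mA))).
  exists (mul_nnsfun h (indic_nnsfun R mA)) => // x /=.
  rewrite /measurable_realfun.mindic.
  rewrite /patch; case: ifPn => xA.
    rewrite indicE xA mulr1; apply: le_trans (hg x) _.
    by rewrite /patch mem_set//; apply: AB; exact: set_mem.
  by rewrite indicE (negbTE xA) mulr0.
rewrite -!integralT_nnsfun le_eqVlt; apply/orP; left; apply/eqP.
apply: ge0_ae_eq_integral => //.
- exact/measurable_realfun.measurable_EFinP.
- exact/measurable_realfun.measurable_EFinP.
- by move=> x _; rewrite lee_fin.
- by move=> x _; rewrite lee_fin; exact: fun_ge0.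
- exists (~` A); split => //; first exact: measurableC.
  move=> x /= h1 Ax; apply: h1 => _.
  by rewrite /measurable_realfun.mindic indicE mem_set// mulr1.
Qed.

Lemma iterated_integral_conull (A B : set T) N (F : N.-tuple T -> \bar R) :
  measurable A -> mu (~` A) = 0 -> A `<=` B ->
  iterated_integral mu B F = iterated_integral mu A F.
Proof.
move=> mA muA AB; elim: N F => [//|N IH] F /=.
by rewrite (integral_conull _ mA muA AB); apply: eq_integral => x _; rewrite IH.
Qed.

(** Measurability of the inner integrals in the outer variable is not at hand, hence the estimate by
    [ge0_le_integral_domain]. *)
Lemma iterated_integral_bounds (A : set T) N (F : N.-tuple T -> \bar R) (M : R) :
  measurable A -> (0 <= M)%R ->
  (forall t : N.-tuple T, (forall j, A (tnth t j)) -> 0 <= F t <= M%:E) ->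
  0 <= iterated_integral mu A F <= M%:E * mu A ^+ N.
Proof.
move=> mA M0; elim: N F => [|N IH] F FM.
  by rewrite expe0 mule1 FM// => -[].
have H x : A x -> 0 <= iterated_integral mu A (fun t : N.-tuple T => F [tuple of x :: t])
    <= M%:E * mu A ^+ N.
  move=> Ax; apply: IH => t At; apply: FM => j.
  case: (unliftP ord0 j) => [k|] ->; last by rewrite tnth0.
  by rewrite tnthS.
rewrite [iterated_integral _ _ _]/=; apply/andP; split; first by apply: integral_ge0 => x /H/andP[].
apply: le_trans (ge0_le_integral_domain (g := fun=> M%:E * mu A ^+ N)
  (@subset_refl _ A) _ _ _) _.
- by move=> x /H/andP[].
- by move=> x _; rewrite mule_ge0// expe_ge0.
- by move=> x /H/andP[].
- by rewrite integral_cst// expeS -muleA [mu A * _]muleC.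
Qed.

End integral_domain.

Section Cintegral.
Context {R : realType} {d : measure_display} {T : measurableType d}.
Local Notation C := (R[i])^o.
Variable mu : {finite_measure set T -> \bar R}.
Variable A : set T.
Hypothesis mA : measurable A.

(** Unlike integrability, this is also stable under products, and for a finite measure it implies
    integrability. *)
Definition bounded_measurable (h : T -> R[i]) : Prop :=
  [/\ measurable_fun A (fun x => complex.Re (h x)),
      measurable_fun A (fun x => complex.Im (h x)) &
      exists M, forall x, A x -> rnorm (h x : C) <= M].

Lemma bounded_measurable_cst c : bounded_measurable (fun=> c).
Proof. by split; [exact: measurable_cst|exact: measurable_cst|exists (rnorm (c : C))]. Qed.

Lemma bounded_measurableD f g : bounded_measurable f -> bounded_measurable g ->
  bounded_measurable (fun x => f x + g x).
Proof.
move=> [rf jf [M fM]] [rg jg [M' gM]]; split.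
- rewrite (_ : (fun x => _) = (fun x => complex.Re (f x) + complex.Re (g x))).
    exact: measurable_realfun.measurable_funD.
  by apply/funext => x; rewrite raddfD.
- rewrite (_ : (fun x => _) = (fun x => complex.Im (f x) + complex.Im (g x))).
    exact: measurable_realfun.measurable_funD.
  by apply/funext => x; rewrite raddfD.
- by exists (M + M') => x Ax; rewrite (le_trans (rnormD _ _))// lerD ?fM ?gM.
Qed.

Lemma bounded_measurableM f g : bounded_measurable f -> bounded_measurable g ->
  bounded_measurable (fun x => f x * g x).
Proof.
move=> [rf jf [M fM]] [rg jg [M' gM]]; split.
- rewrite (_ : (fun x => _) = (fun x => complex.Re (f x) * complex.Re (g x) -
    complex.Im (f x) * complex.Im (g x))).
    by apply: measurable_realfun.measurable_funB; apply: measurable_realfun.measurable_funM.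
  by apply/funext => x; case: (f x) => ? ?; case: (g x).
- rewrite (_ : (fun x => _) = (fun x => complex.Re (f x) * complex.Im (g x) +
    complex.Im (f x) * complex.Re (g x))).
    by apply: measurable_realfun.measurable_funD; apply: measurable_realfun.measurable_funM.
  by apply/funext => x; case: (f x) => ? ?; case: (g x).
- exists (M * M') => x Ax; rewrite rnormM ler_pM ?rnorm_ge0 ?fM ?gM//.
Qed.

Lemma bounded_measurableJ f : bounded_measurable f ->
  bounded_measurable (fun x => Num.conj (f x)).
Proof.
move=> [rf jf [M fM]]; split.
- rewrite (_ : (fun x => _) = (fun x => complex.Re (f x)))//.
  by apply/funext => x; case: (f x).
- rewrite (_ : (fun x => _) = (fun x => - complex.Im (f x))).
    exact: measurableT_comp.
  by apply/funext => x; case: (f x).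
- by exists M => x Ax; rewrite rnormJ fM.
Qed.

Lemma bounded_measurable_sum (I : Type) (r : seq I) (F : I -> T -> R[i]) :
  (forall i, bounded_measurable (F i)) ->
  bounded_measurable (fun x => \sum_(i <- r) F i x).
Proof.
move=> bF; elim: r => [|i r IH].
  rewrite (_ : (fun x => _) = fun=> 0); first exact: bounded_measurable_cst.
  by apply/funext => x; rewrite big_nil.
rewrite (_ : (fun x => _) = fun x => F i x + \sum_(i <- r) F i x).
  exact: bounded_measurableD.
by apply/funext => x; rewrite big_cons.
Qed.

Lemma bounded_measurable_integrable f : bounded_measurable f ->
  mu.-integrable A (EFin \o (fun x => complex.Re (f x))) /\
  mu.-integrable A (EFin \o (fun x => complex.Im (f x))).
Proof.
move=> [rf jf [M fM]]; have muA : (mu A < +oo)%E.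
  by rewrite ltey_eq fin_num_measure.
by split; apply: measurable_bounded_integrable => //;
  exists M; split; rewrite ?num_real// => t Mt x Ax /=;
  rewrite (le_trans (_ : _ <= rnorm (f x : C))) ?normr_Re_le ?normr_Im_le//;
  rewrite (le_trans (fM x Ax))// ltW.
Qed.

Lemma Cintegral_scale (c : R[i]) f : bounded_measurable f ->
  Cintegral mu A (fun x => c * f x) = c * Cintegral mu A f.
Proof.
move=> bf; have [iR iI] := bounded_measurable_integrable bf.
have sR (a : R) : mu.-integrable A (EFin \o (fun x => a * complex.Re (f x))).
  by rewrite (_ : _ \o _ = fun x => (a%:E * (complex.Re (f x))%:E)%E); [exact: integrableZl|].
have sI (a : R) : mu.-integrable A (EFin \o (fun x => a * complex.Im (f x))).
  by rewrite (_ : _ \o _ = fun x => (a%:E * (complex.Im (f x))%:E)%E); [exact: integrableZl|].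
case: c => a b; rewrite /Cintegral.
apply/eqP; rewrite eq_complex; apply/andP; split; apply/eqP => /=.
- rewrite -!RintegralZl// -RintegralB//.
  by apply: eq_Rintegral => x _; case: (f x).
- rewrite -!RintegralZl// -RintegralD//.
  by apply: eq_Rintegral => x _; case: (f x).
Qed.

Lemma CintegralD f g : bounded_measurable f -> bounded_measurable g ->
  Cintegral mu A (fun x => f x + g x) = Cintegral mu A f + Cintegral mu A g.
Proof.
move=> /bounded_measurable_integrable[iRf iIf] /bounded_measurable_integrable[iRg iIg].
rewrite /Cintegral; apply/eqP; rewrite eq_complex; apply/andP; split; apply/eqP => /=.
- rewrite -RintegralD//; by apply: eq_Rintegral => x _; case: (f x); case: (g x).
- rewrite -RintegralD//; by apply: eq_Rintegral => x _; case: (f x); case: (g x).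
Qed.

Lemma Cintegral_sum (I : Type) (r : seq I) (c : I -> R[i]) (F : I -> T -> R[i]) :
  (forall i, bounded_measurable (F i)) ->
  Cintegral mu A (fun x => \sum_(i <- r) c i * F i x) =
  \sum_(i <- r) c i * Cintegral mu A (F i).
Proof.
move=> bF; elim: r => [|i r IH].
  rewrite big_nil (_ : (fun x => _) = fun=> 0 * (0 : R[i])); last first.
    by apply/funext => x; rewrite big_nil mul0r.
  by rewrite Cintegral_scale ?mul0r//; exact: bounded_measurable_cst.
rewrite big_cons -IH -Cintegral_scale// -CintegralD.
- by congr Cintegral; apply/funext => x; rewrite big_cons.
- by apply: bounded_measurableM => //; exact: bounded_measurable_cst.
- apply: bounded_measurable_sum => k.
  by apply: bounded_measurableM => //; exact: bounded_measurable_cst.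
Qed.

Lemma Cintegral_conj f : bounded_measurable f ->
  Cintegral mu A (fun x => Num.conj (f x)) = Num.conj (Cintegral mu A f).
Proof.
move=> /bounded_measurable_integrable[iRf iIf].
rewrite /Cintegral; apply/eqP; rewrite eq_complex; apply/andP; split; apply/eqP => /=.
- by apply: eq_Rintegral => x _; case: (f x).
- rewrite -mulN1r -RintegralZl//.
  by apply: eq_Rintegral => x _; rewrite mulN1r; case: (f x).
Qed.

Lemma integral_Re f : bounded_measurable f ->
  (\int[mu]_(x in A) (complex.Re (f x))%:E = (complex.Re (Cintegral mu A f))%:E)%E.
Proof.
move=> /bounded_measurable_integrable[iRf iIf] /=.
by rewrite /Rintegral fineK//; exact: integrable_fin_num.
Qed.

(** Fubini for finite sums of products: the inner integrals come out as constants, one variable at a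
    time, without a product measure. *)
Lemma iterated_integral_sum_prod (I : Type) (r : seq I) N (c : I -> R[i])
    (h : I -> 'I_N -> T -> R[i]) : (forall i j, bounded_measurable (h i j)) ->
  iterated_integral mu A (fun t : N.-tuple T =>
    (complex.Re (\sum_(i <- r) c i * \prod_j h i j (tnth t j)))%:E) =
  (complex.Re (\sum_(i <- r) c i * \prod_j Cintegral mu A (h i j)))%:E.
Proof.
elim: N c h => [|N IH] c h bh.
  rewrite /=; congr (complex.Re _)%:E; apply: eq_bigr => i _.
  by rewrite !big_ord0.
rewrite [LHS]/=.
transitivity (\int[mu]_(x in A) (complex.Re (\sum_(i <- r)
    (c i * \prod_j Cintegral mu A (h i (lift ord0 j))) * h i ord0 x))%:E)%E.
  apply: eq_integral => x _.
  transitivity (iterated_integral mu A (fun t : N.-tuple T =>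
      (complex.Re (\sum_(i <- r) (c i * h i ord0 x) *
        \prod_j h i (lift ord0 j) (tnth t j)))%:E)).
    congr iterated_integral; apply/funext => t; congr (complex.Re _)%:E.
    apply: eq_bigr => i _; rewrite big_ord_recl tnth0 mulrA; congr (_ * _).
    by apply: eq_bigr => j _; rewrite tnthS.
  rewrite (IH (fun i => c i * h i ord0 x) (fun i j => h i (lift ord0 j)))//.
  congr (complex.Re _)%:E.
  by apply: eq_bigr => i _; rewrite mulrAC.
rewrite (integral_Re (f := fun x => \sum_(i <- r)
    (c i * \prod_j Cintegral mu A (h i (lift ord0 j))) * h i ord0 x)); last first.
  apply: bounded_measurable_sum => i; apply: bounded_measurableM => //.
  exact: bounded_measurable_cst.
rewrite Cintegral_sum//; congr (complex.Re _)%:E; apply: eq_bigr => i _.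
by rewrite big_ord_recl -mulrA; congr (_ * _); rewrite mulrC.
Qed.

End Cintegral.

(** Rational thresholds keep the number of sets to be checked, and of null sets to be removed,
    countable. *)
Lemma measurable_fun_rat (R : realType) (d : measure_display) (T : measurableType d)
    (A : set T) (f : T -> R) :
  (forall q : rat, measurable (A `&` [set x | ratr q < f x])) -> measurable_fun A f.
Proof.
move=> fq mA; apply: (measurability _ (measurable_realfun.RGenOInfty.measurableE R)) => //.
move=> /= _ [_ [y ->] <-].
rewrite (_ : _ `&` _ = \bigcup_(q in [set q : rat | y < ratr q])
    (A `&` [set x | ratr q < f x])).
  rewrite bigcup_mkcond; apply: bigcupT_measurable_rat => q.
  by case: ifP.
apply/seteqP; split => x.
  move=> [Ax] /=; rewrite in_itv/= andbT => /rat_in_itvoo[q]; rewrite in_itv/= => /andP[yq qf].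
  by exists q.
move=> [q /= yq [Ax qf]]; split => //=.
by rewrite in_itv/= andbT (lt_trans yq).
Qed.

(* Countably many exceptional sets suffice for a countable family of continuous
   real functions. *)
Lemma mu_measurable_fun_conull (R : realType) (d : measure_display)
    (T : measurableType d) (mu : {measure set T -> \bar R}) (V : topologicalType)
    (I : countType) (phi : I -> V -> R) (K : set T) (f : T -> V) :
  measurable K -> (forall i, continuous (phi i)) -> mu_measurable_fun mu K f ->
  exists2 E, measurable E /\ mu E = 0%E &
    forall A, measurable A -> A `<=` K `\` E ->
      forall i, measurable_fun A (fun x => phi i (f x)).
Proof.
move=> mK cphi mf.
pose O (j : I * rat) : set V := phi j.1 @^-1` [set y | ratr j.2 < y].
have oO j : open (O j).
  by apply: open_comp => [x _|]; [exact: cphi|exact: open_gt].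
have H j : exists p : set T * set T, [/\ measurable p.1, measurable p.2, mu p.2 = 0%E &
    (K `&` f @^-1` O j `\` p.1) `|` (p.1 `\` K `&` f @^-1` O j) `<=` p.2].
  by have [B mB [E [mE E0 BE]]] := mf _ (oO j); exists (B, E).
have {H}/choice[p pP] := H.
(* The exceptional sets are indexed by natural numbers, with the empty set at numbers that code no
   pair. *)
pose F k : set T := if @unpickle (I * rat)%type k is Some j then (p j).2 else set0.
have mF k : measurable (F k).
  by rewrite /F; case: unpickle => [j|//]; have [] := pP j.
exists (\bigcup_k F k).
  split; first exact: bigcupT_measurable.
  apply/negligibleP; first exact: bigcupT_measurable.
  apply: negligible_bigcup => k; apply/negligibleP => //.
  by rewrite /F; case: unpickle => [j|]; [have [] := pP j|exact: measure0].
move=> A mA AKE i; apply: measurable_fun_rat => q.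
have [mB _ _ BE] := pP (i, q).
have pF : (p (i, q)).2 `<=` \bigcup_k F k.
  by move=> x px; exists (pickle (i, q)) => //; rewrite /F pickleK.
rewrite (_ : _ `&` _ = A `&` (p (i, q)).1); first exact: measurableI.
apply/seteqP; split => x [Ax xq]; split => //.
- have [Kx nEx] := AKE x Ax.
  by apply: contrapT => nB; apply: nEx; apply: pF; apply: BE; left; split.
- have [Kx nEx] := AKE x Ax.
  by apply: contrapT => nq; apply: nEx; apply: pF; apply: BE; right; split => // -[].
Qed.

Lemma measurable_fun_within_continuous (R : realType) (n : nat)
    (K : set (Borel R n)) (f : Cspace R n -> R) :
  measurable K -> {within (K : set (Cspace R n)), continuous f} ->
  measurable_fun K (f : Borel R n -> R).
Proof.
move=> mK cf; apply: measurable_fun_rat => q.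
have oP : open ((f : subspace (K : set (Cspace R n)) -> R) @^-1` [set y | ratr q < y]).
  by apply: open_comp => [x _|]; [exact: cf|exact: open_gt].
have [V oV VK] := (open_subspaceP _ _).1 oP.
rewrite (_ : _ `&` _ = V `&` K).
  by apply: measurableI => //; exact: sub_sigma_algebra.
by rewrite VK setIC.
Qed.

(** * The Gram matrix and the free energy *)

(** Stated in coordinates for Gram matrices: [P] is a unitary matrix diagonalising [G], and the
    [j]-th factor is the value of the Hermitian form on the vector with coefficients
    [Num.conj (P j i)]. *)
Lemma hermitian_diagonalization (R : realType) N (G : 'M[R[i]]_N) :
  (forall i j, G i j = Num.conj (G j i)) ->
  exists2 P : 'M[R[i]]_N, rnorm (\det P : (R[i])^o) = 1 &
    \det G = \prod_j \sum_i \sum_k P j i * Num.conj (P j k) * G i k.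
Proof.
move=> GH; pose Q := spectralmx G; pose A := (map_mx Num.conj Q)^T.
have QA : Q *m A = 1%:M.
  have /unitarymxP := spectral_unitarymx G.
  by rewrite -map_trmx.
have Gn : G \is normalmx.
  apply/normalmxP; have -> : (map_mx Num.conj G^T) = G; last by [].
  by apply/matrixP => i j; rewrite !mxE -GH.
have GE : Q *m G *m A = diag_mx (spectral_diag G).
  rewrite {1}((orthomx_spectralP Gn)) !mulmxA mulmxV ?spectral_unit//.
  by rewrite mul1mx -mulmxA QA mulmx1.
have detQA : \det Q * \det A = 1 by rewrite -det_mulmx QA det1.
have detA : \det A = Num.conj (\det Q) by rewrite det_tr det_map_mx.
exists Q.
- have : `|\det Q| ^+ 2 = 1 by rewrite normCK -detA.
  rewrite (norm_rnorm (\det Q : (R[i])^o)) -rmorphXn => /complexI/eqP.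
  by rewrite sqrp_eq1 ?rnorm_ge0// => /eqP.
- have -> : \det G = \det (Q *m G *m A).
    by rewrite !det_mulmx mulrAC detQA mul1r.
  rewrite GE det_diag; apply: eq_bigr => j _.
  have /matrixP/(_ j j) := GE; rewrite !mxE eqxx mulr1n => <-.
  under eq_bigr do rewrite !mxE mulr_suml.
  rewrite exchange_big; apply: eq_bigr => i _; apply: eq_bigr => k _ /=.
  by rewrite mulrAC.
Qed.

Section slater.
Context {R : realType} {U : normedModType R[i]}.
Local Notation C := (R[i])^o.
Variable herm : {dot U for Num.conj}.
Variables (s : nat) (u : s.-tuple U).
Hypothesis u_basis : orthonormal_basis herm u.
Variables (X : Type) (v : X -> U).

Lemma gtensor_sum N (x : 'I_N -> X) (I : finType) (c : I -> R[i])
    (S : I -> @tensor R s N) :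
  gtensor herm u v x (\sum_i c i *: S i) (\sum_i c i *: S i) =
  \sum_i \sum_j Num.conj (c i) * c j * gtensor herm u v x (S i) (S j).
Proof.
pose M k l := \prod_j gform herm v (x j) (tnth u (k j)) (tnth u (l j)).
transitivity (\sum_(k : {ffun 'I_N -> 'I_s}) \sum_(l : {ffun 'I_N -> 'I_s}) \sum_i \sum_j
    Num.conj (c i) * c j * (Num.conj (S i k) * S j l * M k l)).
  rewrite /gtensor; apply: eq_bigr => k _; apply: eq_bigr => l _.
  rewrite !sum_ffunE rmorph_sum/= -mulrA mulr_suml; apply: eq_bigr => i _.
  rewrite mulrA mulr_sumr mulr_suml; apply: eq_bigr => j _.
  rewrite !ffunE rmorphM /= -/(M k l).
  by rewrite (_ : c j *: S j l = c j * S j l)// mulrACA -[LHS]mulrA.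
transitivity (\sum_i \sum_j \sum_(k : {ffun 'I_N -> 'I_s}) \sum_(l : {ffun 'I_N -> 'I_s})
    Num.conj (c i) * c j * (Num.conj (S i k) * S j l * M k l)); last first.
  apply: eq_bigr => i _; apply: eq_bigr => j _.
  by rewrite /gtensor mulr_sumr; apply: eq_bigr => k _; rewrite mulr_sumr.
under eq_bigr do rewrite exchange_big.
rewrite exchange_big; apply: eq_bigr => i _ /=.
under eq_bigr do rewrite exchange_big.
by rewrite exchange_big; apply: eq_bigr => j _ /=.
Qed.

End slater.

Section energy.
Context {R : realType} {n s : nat}.
Local Notation C := (R[i])^o.
Variable K : set (Cspace R n).
Hypotheses (K_compact : compact K) (K0 : K !=set0).
Variables (U : normedModType R[i]) (herm : {dot U for Num.conj}).
Hypothesis U_hermitian : hermitian_norm herm.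
Variable u : s.-tuple U.
Hypothesis u_basis : orthonormal_basis herm u.
Variables (mu : {finite_measure set (Borel R n) -> \bar R}) (v : Cspace R n -> U).

Lemma measurable_K : measurable (K : set (Borel R n)).
Proof.
rewrite -[K]setCK; apply: measurableC; apply: sub_sigma_algebra.
by apply: closed_openC; exact: compact_closed.
Qed.

Lemma continuous_ucoord i : continuous (ucoord herm u i : U -> C).
Proof.
move=> a; apply/continuous_rnormP => eps e0; exists eps => // b ab.
have -> : ucoord herm u i a - ucoord herm u i b = ucoord herm u i (a - b).
  by rewrite /ucoord /hprod linearBl.
by apply: le_lt_trans ab; exact: rnorm_ucoord_le.
Qed.

(** [v] is measurable only for the completed measure and of norm one only almost everywhere.
    Removing a Borel null set from [K] leaves a domain on which its coordinates are Borel measurable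
    and its norm is one everywhere; the integrals over [K] can be taken there. *)
Lemma conull_domain : mu (~` K) = 0%E ->
  mu_measurable_fun mu K (v : Borel R n -> U) ->
  {ae mu, forall x, K x -> rnorm (v x) = 1} ->
  exists D : set (Borel R n), [/\ measurable D, mu (~` D) = 0%E, D `<=` K,
    forall x, D x -> rnorm (v x) = 1 &
    forall i, bounded_measurable D (fun x => ucoord herm u i (v x))].
Proof.
move=> muK vm [E2 [mE2 E20 E2P]].
pose phi (j : 'I_s * bool) (a : U) : R :=
  if j.2 then complex.Re (ucoord herm u j.1 a) else complex.Im (ucoord herm u j.1 a).
have cphi j : continuous (phi j).
  move=> a; rewrite /phi; case: j.2.
    apply: (@continuous_comp _ _ _ (ucoord herm u j.1 : U -> C) (@complex.Re R : C -> R)).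
      exact: continuous_ucoord.
    exact: continuous_Re.
  apply: (@continuous_comp _ _ _ (ucoord herm u j.1 : U -> C) (@complex.Im R : C -> R)).
    exact: continuous_ucoord.
  exact: continuous_Im.
have [E [mE E0] EP] := mu_measurable_fun_conull measurable_K cphi vm.
pose D : set (Borel R n) := K `\` (E `|` E2).
have mD : measurable D.
  by apply: measurableD; [exact: measurable_K|exact: measurableU].
have v1 x : D x -> rnorm (v x) = 1.
  by move=> [Kx nE]; apply: contrapT => v1; apply: nE; right; apply: E2P => /(_ Kx).
have DE : D `<=` K `\` E by move=> x [Kx nE]; split => // Ex; apply: nE; left.
exists D; split => //; last first.
- move=> i; split.
  + exact: (EP D mD DE (i, true)).
  + exact: (EP D mD DE (i, false)).
  + exists 1 => x Dx; rewrite -(v1 x Dx); exact: rnorm_ucoord_le.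
- by move=> x [].
- apply/eqP; rewrite -measure_le0.
  rewrite (_ : ~` D = (~` K) `|` (E `|` E2)); last first.
    by rewrite /D setDE setCI setCK.
  have mK : measurable (~` K : set (Borel R n)) by apply: measurableC; exact: measurable_K.
  rewrite (le_trans (measureU2 _ _ _))//; first exact: measurableU.
  rewrite [X in (X + _ <= _)%E](_ : _ = 0%E)// add0e (le_trans (measureU2 _ _ _))//.
  by rewrite [X in (X + _ <= _)%E](_ : _ = 0%E)// add0e [X in (X <= _)%E](_ : _ = 0%E).
Qed.

Variable D : set (Borel R n).
Hypotheses (mD : measurable D) (D_conull : mu (~` D) = 0%E) (DK : D `<=` K).
Hypothesis v1 : forall x, D x -> rnorm (v x) = 1.
Hypothesis bv : forall i, bounded_measurable D (fun x => ucoord herm u i (v x)).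

Lemma Cintegral_conull (f : Cspace R n -> R[i]) :
  Cintegral mu (K : set (Borel R n)) f = Cintegral mu D f.
Proof. by rewrite /Cintegral /Rintegral !(integral_conull _ mD D_conull DK). Qed.

Lemma bounded_measurable_ucoord (f : Cspace R n -> U) i : contU K f ->
  bounded_measurable D (fun x => ucoord herm u i (f x)).
Proof.
move=> cf.
have cc : continuous ((fun x => ucoord herm u i (f x)) : subspace K -> C).
  move=> x; apply: (@continuous_comp _ _ _ (f : subspace K -> U) (ucoord herm u i : U -> C)).
    exact: cf.
  exact: continuous_ucoord.
split.
- apply: (measurable_funS measurable_K DK).
  apply: (measurable_fun_within_continuous measurable_K) => x.
  apply: (@continuous_comp _ _ _ ((fun x => ucoord herm u i (f x)) : subspace K -> C)
    (@complex.Re R : C -> R)); [exact: cc|exact: continuous_Re].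
- apply: (measurable_funS measurable_K DK).
  apply: (measurable_fun_within_continuous measurable_K) => x.
  apply: (@continuous_comp _ _ _ ((fun x => ucoord herm u i (f x)) : subspace K -> C)
    (@complex.Im R : C -> R)); [exact: cc|exact: continuous_Im].
- exists (max_norm K f) => x /DK Kx.
  rewrite (le_trans (rnorm_ucoord_le U_hermitian u_basis _ _))//.
  exact: max_norm_ub.
Qed.

Lemma hprod_comb a (I : finType) (c : I -> R[i]) (b : I -> U) :
  hprod herm a (\sum_i c i *: b i) = \sum_i c i * hprod herm a (b i).
Proof.
by rewrite /hprod linear_sumlz; apply: eq_bigr => i _; rewrite linearZl_LR.
Qed.

Lemma hprod_coord (a b : U) :
  hprod herm a b = \sum_k Num.conj (ucoord herm u k a) * ucoord herm u k b.
Proof.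
rewrite {1}(ucoord_sum u_basis b) hprod_comb; apply: eq_bigr => k _.
by rewrite mulrC /ucoord -hprodC.
Qed.

Lemma bounded_measurable_gform (f g : Cspace R n -> U) : contU K f -> contU K g ->
  bounded_measurable D (fun x => gform herm v x (f x) (g x)).
Proof.
move=> cf cg.
have H h : contU K h -> bounded_measurable D (fun x => hprod herm (v x) (h x)).
  move=> ch; under eq_fun do rewrite hprod_coord.
  apply: bounded_measurable_sum => k; apply: bounded_measurableM.
    exact: bounded_measurableJ.
  exact: bounded_measurable_ucoord.
apply: bounded_measurableM; last exact: H.
by apply: bounded_measurableJ; exact: H.
Qed.

Lemma vmu_norm_sqr (f : Cspace R n -> U) : contU K f ->
  ((vmu_norm herm K v mu f ^+ 2)%:C)%C =
  Cintegral mu (K : set (Borel R n)) (fun x => gform herm v x (f x) (f x)).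
Proof.
move=> cf.
have gE x : gform herm v x (f x) (f x) = ((rnorm (hprod herm (v x) (f x) : C) ^+ 2)%:C)%C.
  by rewrite /gform mulrC -normCK (norm_rnorm (_ : C)) rmorphXn.
rewrite /vmu_norm sqr_sqrtr; last first.
  by apply: Rintegral_ge0 => x _; rewrite gE /= exprn_ge0// rnorm_ge0.
rewrite /Cintegral; congr (_ +i* _)%C.
rewrite (_ : (fun x => complex.Im _) = fun=> 0); last by apply/funext => x; rewrite gE.
by rewrite /Rintegral integral0.
Qed.

Variable w : 'I_s -> Cspace R n -> R.
Hypothesis w_cont : forall l, {within K, continuous (w l)}.
Variable e : forall r, 'I_(polydimU n s r) -> {ffun 'I_n -> nat} * 'I_s.
Hypothesis e_enum : forall r, monomial_enumeration (@e r).
Variable r : nat.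
Local Notation N := (polydimU n s r).
Local Notation G := (gram herm u K w e v mu r).
Local Notation wq := (wq herm u w e).
Local Notation wr := (weighted herm u w r).

Let bwq (i j : 'I_N) :
  bounded_measurable D (fun x => gform herm v x (wq i x) (wq j x)).
Proof. by apply: bounded_measurable_gform; exact: contU_wq. Qed.

Lemma gramE i j : G i j = Cintegral mu D (fun x => gform herm v x (wq i x) (wq j x)).
Proof. by rewrite mxE Cintegral_conull. Qed.

Lemma gram_hermitian i j : G i j = Num.conj (G j i).
Proof.
rewrite !gramE -Cintegral_conj//; congr Cintegral; apply/funext => x.
by rewrite /gform rmorphM/= conjCK mulrC.
Qed.

Lemma vmu_norm_comb (c : 'I_N -> R[i]) :
  ((vmu_norm herm K v mu (wr (fun x => \sum_i c i *: Defs.qpoly u e i x)) ^+ 2)%:C)%C =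
  \sum_i \sum_k Num.conj (c i) * c k * G i k.
Proof.
rewrite weighted_sum vmu_norm_sqr; last first.
  by apply: contU_sum => i; exact: contU_wq.
rewrite Cintegral_conull pair_bigA/=.
under [RHS]eq_bigr do rewrite gramE.
rewrite -(Cintegral_sum mu mD (index_enum _) (fun p : 'I_N * 'I_N => Num.conj (c p.1) * c p.2)
  (F := fun p x => gform herm v x (wq p.1 x) (wq p.2 x)))//.
congr Cintegral; apply/funext => x.
rewrite /gform !hprod_comb rmorph_sum/= mulr_suml -(pair_bigA _ (fun i k =>
  Num.conj (c i) * c k * (Num.conj (hprod herm (v x) (wq i x)) * hprod herm (v x) (wq k x)))).
apply: eq_bigr => i _; rewrite mulr_sumr; apply: eq_bigr => k _.
by rewrite rmorphM mulrACA.
Qed.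

Lemma slater_gtensor (x : 'I_N -> Cspace R n) :
  let S := slater herm u w e x in
  gtensor herm u v x S S = \sum_(p : 'S_N * 'S_N)
    (-1) ^+ p.1 * (-1) ^+ p.2 *
      \prod_j gform herm v (x j) (wq (p.1 j) (x j)) (wq (p.2 j) (x j)).
Proof.
rewrite /= /slater (gtensor_sum herm u v x (fun p : 'S_N => (-1) ^+ p)).
rewrite pair_bigA/=; apply: eq_bigr => -[p q] _ /=.
by rewrite gtensor_pure// rmorphXn rmorphN1.
Qed.

(** [gform] has rank one, being the product of a conjugate of [(v, a)] with [(v, b)], so the double
    sum over permutations factors as a determinant times its conjugate. *)
Lemma slater_gtensor_det (x : 'I_N -> Cspace R n) :
  let S := slater herm u w e x in
  gtensor herm u v x S S =
  ((rnorm (\det (\matrix_(j, i) evalT herm (v (x j)) (x j) (wq i)) : C) ^+ 2)%:C)%C.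
Proof.
rewrite /= slater_gtensor rmorphXn/= -norm_rnorm normCK mulrC /determinant rmorph_sum mulr_suml.
rewrite -(pair_bigA _ (fun p q : 'S_N => (-1) ^+ p * (-1) ^+ q *
      \prod_j gform herm v (x j) (wq (p j) (x j)) (wq (q j) (x j)))).
apply: eq_bigr => p _; rewrite mulr_sumr; apply: eq_bigr => q _.
rewrite rmorphM rmorphXn rmorphN1 mulrACA; congr (_ * _).
rewrite rmorph_prod -big_split; apply: eq_bigr => j _ /=.
by rewrite !mxE.
Qed.

(** Andreief's identity: integrating a product of two determinants gives [N!] times the determinant
    of the integrals. *)
Lemma iterated_slater :
  iterated_integral mu (K : set (Borel R n)) (fun t : N.-tuple (Borel R n) =>
    (complex.Re (gtensor herm u v (tnth t) (slater herm u w e (tnth t))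
                                           (slater herm u w e (tnth t))))%:E) =
  (complex.Re (N`!%:R * \det G))%:E.
Proof.
rewrite (iterated_integral_conull _ mD D_conull DK).
under eq_fun do rewrite slater_gtensor.
rewrite (iterated_integral_sum_prod mu mD (index_enum _)
  (fun p : 'S_N * 'S_N => (-1) ^+ p.1 * (-1) ^+ p.2)
  (h := fun p j x => gform herm v x (wq (p.1 j) x) (wq (p.2 j) x)))//.
congr (complex.Re _)%:E.
rewrite -(pair_bigA _ (fun p q : 'S_N => (-1) ^+ p * (-1) ^+ q *
      \prod_j Cintegral mu D (fun x => gform herm v x (wq (p j) x) (wq (q j) x)))).
rewrite mulr_natl -card_Sn -sumr_const; apply: eq_bigr => p _ /=.
(* Writing the second permutation as [p * q] leaves the sign of [q] and a reindexed product, so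
   every [p] contributes the same determinant. *)
rewrite /determinant (reindex_inj (mulgI p))/=; apply: eq_bigr => q _.
rewrite odd_permM signr_addb mulrA -signr_addb addbb mul1r; congr (_ * _).
rewrite [RHS](reindex_inj (@perm_inj _ p)); apply: eq_bigr => j _.
by rewrite gramE permM.
Qed.

Lemma free_energyE : free_energy herm u K w e v mu r = complex.Re (N`!%:R * \det G).
Proof. by rewrite /free_energy iterated_slater. Qed.

Hypothesis s_gt0 : (0 < s)%N.

(** The evaluations [f |-> (v (x_j), f (x_j))] have norm one and are therefore admissible in the
    definition of [D_r]. The maximum with 1 keeps the base positive, so that its logarithm can be
    used. *)
Lemma free_energy_le : free_energy herm u K w e v mu r <=
  Num.max 1 (fine (mu D)) ^+ N * diam K herm u w e r ^+ 2.
Proof.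
have hD := has_detset U_hermitian u_basis K_compact K0 w_cont (e_enum r) s_gt0.
have := @iterated_integral_bounds R _ _ mu D N (fun t : N.-tuple (Borel R n) =>
    (complex.Re (gtensor herm u v (tnth t) (slater herm u w e (tnth t))
                                           (slater herm u w e (tnth t))))%:E)
  (diam K herm u w e r ^+ 2) mD (sqr_ge0 _).
move=> /(_ _)/andP[]; first move=> t tD.
  rewrite slater_gtensor_det/= !lee_fin exprn_ge0 ?rnorm_ge0//=.
  have dle : rnorm (\det (\matrix_(j, i) evalT herm (v (tnth t j)) (tnth t j) (wq i)) : C)
      <= diam K herm u w e r.
    apply: sup_upper_bound => //; exists (fun j => evalT herm (v (tnth t j)) (tnth t j)) => //.
    move=> j; split; first by apply: evalT_dual => //; exact: DK.
    by apply: evalT_norm => //; [exact: DK|exact: v1].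
  by rewrite ler_pXn2r ?nnegrE ?rnorm_ge0// (le_trans _ dle)// rnorm_ge0.
move=> _; rewrite -(iterated_integral_conull _ mD D_conull DK) iterated_slater.
have muD : mu D = (fine (mu D))%:E by rewrite fineK// fin_num_measure.
rewrite [X in (_ * X)%E](_ : _ = (fine (mu D) ^+ N)%:E); last first.
  by rewrite EFin_expe -muD.
rewrite -EFinM lee_fin free_energyE mulrC => h; apply: le_trans h _.
rewrite [leLHS]mulrC ler_wpM2r ?sqr_ge0// lerXn2r ?nnegrE ?le_max ?lexx ?orbT ?ler01//.
by rewrite fine_ge0.
Qed.

End energy.

Lemma limn_esup_near (R : realType) (f : nat -> \bar R) (l B : \bar R) :
  (limn_esup f <= l)%E -> (l < B)%E -> \forall r \near \oo, (f r < B)%E.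
Proof.
move=> fl lB; have := le_lt_trans fl lB; rewrite /limn_esup /limf_esup.
move=> /ereal_inf_lt[_ [V VF <-] VB]; apply: filterS VF => r Vr.
by apply: le_lt_trans VB; apply: ereal_sup_ubound; exists r.
Qed.

(** * Consequences of the Bernstein-Markov property *)

Section bernstein_markov.
Context {R : realType} {n s : nat}.
Local Notation C := (R[i])^o.
Hypotheses (n_gt0 : (0 < n)%N) (s_gt0 : (0 < s)%N).
Variable K : set (Cspace R n).
Hypotheses (K_compact : compact K) (K_nonpluripolar : ~ pluripolar K).
Variables (U : normedModType R[i]) (herm : {dot U for Num.conj}).
Hypothesis U_hermitian : hermitian_norm herm.
Variable u : s.-tuple U.
Hypothesis u_basis : orthonormal_basis herm u.
Variable w : 'I_s -> Cspace R n -> R.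
Hypothesis w_gt0 : forall l x, K x -> 0 < w l x.
Hypothesis w_cont : forall l, {within K, continuous (w l)}.
Variable e : forall r, 'I_(polydimU n s r) -> {ffun 'I_n -> nat} * 'I_s.
Hypothesis e_enum : forall r, monomial_enumeration (@e r).
Variables (mu : {finite_measure set (Borel R n) -> \bar R}) (v : Cspace R n -> U).
Hypothesis mu_K : mu (~` K) = 0%E.
Hypothesis v_meas : mu_measurable_fun mu K (v : Borel R n -> U).
Hypothesis v_unit : {ae mu, forall x, K x -> rnorm (v x) = 1}.
Hypothesis BM : bernstein_markov herm u K w v mu.

Local Notation N r := (polydimU n s r).
Local Notation G r := (gram herm u K w e v mu r).
Local Notation wr r := (weighted herm u w r).
Local Notation D r := (diam K herm u w e r).
Local Notation Z r := (free_energy herm u K w e v mu r).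
Local Notation vnorm := (vmu_norm herm K v mu).

Let K0 : K !=set0 := nonpluripolar_nonempty K_nonpluripolar.

Lemma polyU_comb r (c : 'I_(N r) -> R[i]) :
  polyU r (fun x => \sum_i c i *: Defs.qpoly u e i x).
Proof.
(* The coefficient of [x^beta] collects the indices [i] whose multi-index is [beta], one for each
   component. *)
pose a (beta : {ffun 'I_n -> 'I_r.+1}) : U :=
  \sum_i c i *: (if [forall j, (beta j : nat) == (e i).1 j] then tnth u (e i).2 else 0).
exists a; apply/funext => x; rewrite /a.
under [RHS]eq_bigr do rewrite scaler_sumr.
rewrite exchange_big; apply: eq_bigr => i _ /=.
have er : (mdegree (e i).1 <= r)%N by apply/((e_enum r).2 _ (e i).2); exists i; case: (e i).
have le_r j : ((e i).1 j < r.+1)%N.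
  by rewrite ltnS (leq_trans _ er)// /mdegree (bigD1 j)//= leq_addr.
pose b : {ffun 'I_n -> 'I_r.+1} := [ffun j => Ordinal (le_r j)].
rewrite (bigD1 b)/=; last first.
  by apply: leq_trans er; apply: leq_sum => j _; rewrite ffunE.
rewrite [X in _ + X]big1 ?addr0.
  rewrite ifT; last by apply/forallP => j; rewrite ffunE.
  rewrite /Defs.qpoly !scalerA mulrC; congr (_ * _ *: _).
  by apply: eq_bigr => j _; rewrite ffunE.
move=> d /andP[_ db]; rewrite ifF ?scaler0//; apply: contra_neqF db => /forallP h.
by apply/ffunP => j; rewrite ffunE; apply/val_inj/eqP/h.
Qed.

(** Since the limsup is at most 1, the supremum over all polynomials is below [B] from some [r] on,
    and an [r]-th power removes the root. The norm property makes the denominators positive. *)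
Lemma bernstein_markov_near (B : R) : 1 < B -> \forall r \near \oo,
  forall omega, polyU r omega -> contU K (wr r omega) ->
    max_norm K (wr r omega) <= B ^+ r * vnorm (wr r omega).
Proof.
move=> B1; have B0 : 0 < B by exact: lt_trans B1.
have B1' : (1%:E < B%:E)%E by rewrite lte_fin.
have near_bm := limn_esup_near BM.2 B1'.
near=> r => omega po co.
have r0 : (0 < r)%N by near: r; exact: nbhs_infty_gt.
have bmB : (bm_sup herm u K w v mu r < B%:E)%E by near: r.
have [nneg _ _ sep] := BM.1 r.
have [->|omega0] := eqVneq omega 0.
  have w0 : wr r 0 = fun=> 0.
    apply/funext => x; rewrite /weighted /odot big1// => i _.
    by rewrite /ucoord /hprod linear0l mul0r scale0r.
  rewrite (@le_trans _ _ 0)//; last by rewrite mulr_ge0 ?sqrtr_ge0// exprn_ge0 ?(ltW B0).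
  by apply: max_norm_le => // x Kx; rewrite w0 rnorm0.
have v0 : 0 < vnorm (wr r omega).
  rewrite lt_neqAle sqrtr_ge0 andbT eq_sym; apply: contra_neq omega0.
  exact: sep.
rewrite -ler_pdivrMr//; set q := _ / _.
have q0 : 0 <= q.
  rewrite divr_ge0 ?(ltW v0)//; have [x Kx] := K0.
  by rewrite (le_trans (rnorm_ge0 (wr r omega x)))// (max_norm_ub K_compact K0).
have qB : q `^ (r%:R^-1) <= B.
  rewrite -lee_fin (le_trans _ (ltW bmB))//; apply: ereal_sup_ubound.
  by exists omega => //; split => // /eqP; rewrite (negbTE omega0).
have -> : q = (q `^ (r%:R^-1)) ^+ r.
  by rewrite -powR_mulrn ?powR_ge0// -powRrM mulVf ?powRr1// pnatr_eq0 -lt0n.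
by rewrite lerXn2r ?nnegrE ?powR_ge0 ?(ltW B0).
Unshelve. all: by end_near. Qed.

(* The [p j] below are orthogonal for the Gram form, so [\det (G r)] is the product
   of their squared norms; they form a unitary change of basis. *)
Lemma diam_le_det_gram r : \det (G r) = ((complex.Re (\det (G r)))%:C)%C /\
  0 <= complex.Re (\det (G r)) /\
  forall B, 0 <= B ->
  (forall omega, polyU r omega -> contU K (wr r omega) ->
    max_norm K (wr r omega) <= B ^+ r * vnorm (wr r omega)) ->
  D r <= (N r)`!%:R * B ^+ (r * N r) * Num.sqrt (complex.Re (\det (G r))).
Proof.
have [A [mA A0 AK v1 bv]] := conull_domain K_compact U_hermitian u_basis mu_K v_meas v_unit.
have GH := gram_hermitian K_compact K0 U_hermitian u_basis mA A0 AK bv w_cont e_enum (r := r).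
have [P P1 detG] := hermitian_diagonalization GH.
pose p j x := \sum_i Num.conj (P j i) *: Defs.qpoly u e i x.
have pE j : ((vnorm (wr r (p j)) ^+ 2)%:C)%C =
    \sum_i \sum_k P j i * Num.conj (P j k) * G r i k.
  rewrite (vmu_norm_comb K_compact K0 U_hermitian u_basis mA A0 AK bv w_cont e_enum).
  by apply: eq_bigr => i _; apply: eq_bigr => k _; rewrite conjCK.
pose V := \prod_j vnorm (wr r (p j)).
have V0 : 0 <= V by apply: prodr_ge0 => j _; exact: sqrtr_ge0.
have detV : \det (G r) = ((V ^+ 2)%:C)%C.
  by rewrite detG -prodrXl rmorph_prod; apply: eq_bigr => j _; rewrite -pE.
rewrite detV/=; split=> //; split; first exact: sqr_ge0.
move=> B B0 HB; rewrite sqrtr_sqr ger0_norm//.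
have cwq k : contU K (wq herm u w e (r := r) k) by exact: contU_wq.
have wpE j : wr r (p j) = fun x => \sum_i Num.conj (P j i) *: wq herm u w e i x.
  exact: weighted_sum.
have cp j : contU K (wr r (p j)) by rewrite wpE; apply: contU_sum => i.
apply: sup_le_ub.
  by have [] := has_detset U_hermitian u_basis K_compact K0 w_cont (e_enum r) s_gt0.
move=> _ [T TP <-].
(* Passing to the [p j] multiplies the determinant by the conjugate of [\det P], which has modulus
   1. *)
have -> : rnorm (\det (\matrix_(i, j) T i (wq herm u w e j)) : C) =
    rnorm (\det (\matrix_(i, j) T i (wr r (p j))) : C).
  rewrite (_ : \matrix_(i, j) T i (wr r (p j)) =
      (\matrix_(i, j) T i (wq herm u w e j)) *m (map_mx Num.conj P)^T); last first.
    apply/matrixP => i j; rewrite !mxE wpE (dual_sum (TP i).1)//.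
    by apply: eq_bigr => k _; rewrite !mxE mulrC.
  by rewrite det_mulmx det_tr det_map_mx rnormM rnormJ P1 mulr1.
apply: (@le_trans _ _ ((N r)`!%:R * \prod_j max_norm K (wr r (p j)))).
  apply: det_le => i j; rewrite mxE; have [dT T1] := TP i.
  exact: dual_le.
rewrite -mulrA ler_wpM2l// exprM -[N r in leRHS]card_ord -prodr_const -big_split/=.
apply: ler_prod => j _; apply/andP; split; last by apply: HB => //; exact: polyU_comb.
by have [x Kx] := K0; rewrite (le_trans (rnorm_ge0 (wr r (p j) x)))// max_norm_ub.
Qed.

Lemma free_energy_det r : Z r = (N r)`!%:R * complex.Re (\det (G r)).
Proof.
have [A [mA A0 AK v1 bv]] := conull_domain K_compact U_hermitian u_basis mu_K v_meas v_unit.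
rewrite (free_energyE K_compact K0 U_hermitian u_basis mA A0 AK bv w_cont e_enum).
have [-> _] := diam_le_det_gram r.
by rewrite -[(N r)`!%:R](rmorph_nat (real_complex R)) -rmorphM.
Qed.

Lemma free_energy_bound : exists2 M, 1 <= M & forall r, Z r <= M ^+ N r * D r ^+ 2.
Proof.
have [A [mA A0 AK v1 bv]] := conull_domain K_compact U_hermitian u_basis mu_K v_meas v_unit.
exists (Num.max 1 (fine (mu A))) => [|r]; first by rewrite le_max lexx.
exact: free_energy_le.
Qed.

Lemma log_close eps : 0 < eps -> \forall r \near \oo,
  `|ln (complex.Re (\det (G r))) - 2 * ln (D r)| <= eps * (r * N r)%:R /\
  `|ln (Z r) - 2 * ln (D r)| <= eps * (r * N r)%:R.
Proof.
move=> eps0; have [M M1 ZM] := free_energy_bound.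
(* A quarter, because [lo] contains two errors, the Bernstein-Markov factor and [ln N!], and is
   doubled. *)
have eps4 : 0 < eps / 4 by rewrite divr_gt0.
have M0 : 0 < M by exact: lt_le_trans M1.
have B1 : 1 < expR (eps / 4) by rewrite expR_gt1.
have bm := bernstein_markov_near B1.
have cM := @cvg_divr R (ln M); have cN := @cvg_ln_polydimU R n s s_gt0.
near=> r; have r0 : (0 < r)%N by near: r; exact: nbhs_infty_gt.
have r0' : 0 < r%:R :> R by rewrite ltr0n.
have N0 : (0 < N r)%N by rewrite muln_gt0 s_gt0 polydim_gt0.
have N0' : 0 < (N r)%:R :> R by rewrite ltr0n.
have hM : `|0 - ln M / r%:R| <= eps / 4.
  by near: r; move/cvgrPdist_le: cM; exact.
have hN : `|0 - ln (N r)%:R / r%:R| <= eps / 4.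
  by near: r; move/cvgrPdist_le: cN; exact.
have {}hM : ln M <= eps / 4 * r%:R.
  by move: hM; rewrite sub0r normrN => /(le_trans (ler_norm _)); rewrite ler_pdivrMr.
have {}hN : ln (N r)%:R <= eps / 4 * r%:R.
  by move: hN; rewrite sub0r normrN => /(le_trans (ler_norm _)); rewrite ler_pdivrMr.
have D0 : 0 < D r by exact: diam_gt0.
have [_ [g0 Dle]] := diam_le_det_gram r.
set g := complex.Re _ in g0 Dle *.
have F0 : 0 < (N r)`!%:R :> R by rewrite ltr0n fact_gt0.
have {}Dle : D r <= (N r)`!%:R * expR (eps / 4) ^+ (r * N r) * Num.sqrt g.
  by apply: Dle; [exact: expR_ge0|near: r].
(* Positivity of [D_r] forces that of the Gram determinant, so that the logarithms below are
   genuine. *)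
have g1 : 0 < g.
  rewrite lt_neqAle g0 andbT; apply: contraTN D0 => /eqP g00.
  by rewrite -leNgt (le_trans Dle)// -g00 sqrtr0 mulr0.
have Zg : Z r = (N r)`!%:R * g := free_energy_det r.
have lnZ : ln (Z r) = ln (N r)`!%:R + ln g by rewrite Zg lnM.
have up : ln (Z r) <= (N r)%:R * ln M + 2 * ln (D r).
  have Z0 : 0 < Z r by rewrite Zg mulr_gt0.
  have := ZM r; rewrite -ler_ln ?posrE ?mulr_gt0 ?exprn_gt0// lnM ?posrE ?exprn_gt0//.
  by rewrite !lnXn// -[ln M *+ _]mulr_natl -[ln (D r) *+ _]mulr_natl.
have lo : ln (D r) <= ln (N r)`!%:R + eps / 4 * (r * N r)%:R + ln g / 2.
  have sg : 0 < Num.sqrt g by rewrite sqrtr_gt0.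
  have X0 : 0 < expR (eps / 4) ^+ (r * N r) by rewrite exprn_gt0 ?expR_gt0.
  move: Dle; rewrite -ler_ln ?posrE ?mulr_gt0//.
  rewrite lnM ?posrE ?mulr_gt0// lnM ?posrE// lnXn ?expR_gt0// expRK -[eps / 4 *+ _]mulr_natr.
  by rewrite -{2}(sqr_sqrtr g0) lnXn// -[ln (Num.sqrt g) *+ 2]mulr_natr mulfK.
have F1 : 0 <= ln (N r)`!%:R :> R by rewrite ln_ge0// ler1n fact_gt0.
have F2 : ln (N r)`!%:R <= eps / 4 * (r * N r)%:R.
  apply: le_trans (ln_fact_le _) _.
  by rewrite natrM mulrA [leRHS]mulrC ler_wpM2l.
have M2 : (N r)%:R * ln M <= eps / 4 * (r * N r)%:R.
  by rewrite natrM mulrA [leRHS]mulrC ler_wpM2l.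
rewrite !ler_norml; split; lra.
Unshelve. all: by end_near. Qed.

End bernstein_markov.

Theorem proposition3p1 (R : realType) (n s : nat)
    (n_gt0 : (0 < n)%N) (s_gt0 : (0 < s)%N)
    (K : set (Cspace R n))
    (K_compact : compact K) (K_nonpluripolar : ~ pluripolar K)
    (U : normedModType R[i]) (herm : {dot U for Num.conj})
    (U_hermitian : hermitian_norm herm)
    (u : s.-tuple U) (u_basis : orthonormal_basis herm u)
    (w : 'I_s -> Cspace R n -> R)
    (w_gt0 : forall l x, K x -> 0 < w l x)
    (w_cont : forall l, {within K, continuous (w l)})
    (mu : {finite_measure set (Borel R n) -> \bar R})
    (mu_K : mu (~` K) = 0%E)
    (v : Cspace R n -> U)
    (v_meas : mu_measurable_fun mu K (v : Borel R n -> U))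
    (v_unit : {ae mu, forall x, K x -> rnorm (v x) = 1})
    (e : forall r, 'I_(polydimU n s r) -> {ffun 'I_n -> nat} * 'I_s)
    (e_enum : forall r, monomial_enumeration (@e r))
    (BM : bernstein_markov herm u K w v mu) :
  ((n.+1%:R / (2 * n * r * polydimU n s r)%:R *
      ln (complex.Re (\det (gram herm u K w e v mu r))))
     @[r --> \oo] --> ln (transfinite_diameter herm u K w e)) /\
  ((n.+1%:R / (2 * n * r * polydimU n s r)%:R *
      ln (free_energy herm u K w e v mu r))
     @[r --> \oo] --> ln (transfinite_diameter herm u K w e)).
Proof.
have lc := log_close s_gt0 K_compact K_nonpluripolar U_hermitian u_basis
  w_gt0 w_cont e_enum mu_K v_meas v_unit BM.
by split; apply: cvg_log_of_close => // eps /lc; apply: filterS => r [].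
Qed.
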